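(* Let $k$ be an arbitrary field, let $e\ge 1$ and $\ell\ge 2$ be integers, and let $\mathcal{N}(e,\ell)=k\,Q_e/\mathcal{J}^\ell$. Write $\ell=\mu\, e+\ell'$ where $\mu,\ell'\ge 0$ are integers and $\ell'\le e-1$. Let $V$ be a finitely generated indecomposable non-projective $\mathcal{N}(e,\ell)$-module, and define $d_V\ge 0$ to be the distance of $[V]$ from the closest boundary of the stable Auslander-Reiten quiver of $\mathcal{N}(e,\ell)$, where distance $0$ corresponds to modules at a boundary; in other words, if $\ell_V=\min\{\dim_k V,\ \ell-\dim_k V\}$ then $\ell_V=d_V+1$. Write $\ell_V=n\,e+i$ where $n,i\ge 0$ are integers with $i\le e-1$. Then the versal deformation ring $R(\mathcal{N}(e,\ell),V)$ is universal. Moreover, $$R(\mathcal{N}(e,\ell),V)\cong k[[t_1,\ldots,t_n]]/J_n(m_V),$$ where $m_V=\mu$ if $0\le i\le \ell'$ and $m_V=\mu-1$ if $\ell'+1\le i\le e-1$.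
   Context: All modules are finitely generated left modules. The algebra $\mathcal{N}(e,\ell)$: $Q_e$ is the circular quiver with $e$ vertices $1,\ldots,e$ and $e$ arrows $\alpha_1,\ldots,\alpha_e$ with $\alpha_i:i\to i+1$, where vertex $e+1$ is identified with $1$. $\mathcal{J}$ is the ideal of the path algebra $k\,Q_e$ generated by all arrows, and $\mathcal{N}(e,\ell)=k\,Q_e/\mathcal{J}^\ell$. The ideals $J_n(a)$: for $n\ge 1$, $N_n$ is the $n\times n$ matrix over $k[[t_1,\ldots,t_n]]$ whose last column is $(t_n,t_{n-1},\ldots,t_1)^T$ (from top to bottom), whose first $n-1$ columns have zero first row, and whose block in rows $2,\ldots,n$ and columns $1,\ldots,n-1$ is the identity matrix $\mathrm{I}_{n-1}$; in particular $N_1=(t_1)$. For $a\ge 0$ and $n\ge 1$, $J_n(a)$ is the ideal of $k[[t_1,\ldots,t_n]]$ generated by the entries of $(N_n)^a$. For $n=0$, $k[[t_1,\ldots,t_n]]$ means $k$ and $J_0(a)$ is the zero ideal of $k$. Deformation rings: let $\hat{\mathcal{C}}$ be the category of complete local commutative Noetherian $k$-algebras $R$ with residue field $k$, with morphisms the continuous $k$-algebra homomorphisms inducing the identity on $k$. For a finite dimensional $k$-algebra $\Lambda$, a finitely generated $\Lambda$-module $V$ and $R$ in $\hat{\mathcal{C}}$, a lift of $V$ over $R$ is a pair $(M,\phi)$ where $M$ is a finitely generated $R\otimes_k\Lambda$-module that is free over $R$ and $\phi:k\otimes_R M\to V$ is a $\Lambda$-module isomorphism. Lifts $(M,\phi),(M',\phi')$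 are isomorphic if there is an $R\otimes_k\Lambda$-module isomorphism $f:M\to M'$ with $\phi'\circ(k\otimes_R f)=\phi$. $\mathrm{Def}_\Lambda(V,R)$ is the set of isomorphism classes (deformations) of lifts of $V$ over $R$; it is a covariant functor of $R$ via $[M,\phi]\mapsto[R'\otimes_{R,\alpha}M,\phi_\alpha]$ for $\alpha:R\to R'$, where $\phi_\alpha$ is the composition $k\otimes_{R'}(R'\otimes_{R,\alpha}M)\cong k\otimes_R M\xrightarrow{\phi}V$. The versal deformation ring $R(\Lambda,V)$ is the object of $\hat{\mathcal{C}}$ (it exists and is unique up to isomorphism) carrying a deformation $[U,\phi_U]$ of $V$ such that for every $R$ in $\hat{\mathcal{C}}$ the map $\mathrm{Hom}_{\hat{\mathcal{C}}}(R(\Lambda,V),R)\to\mathrm{Def}_\Lambda(V,R)$, $\alpha\mapsto\mathrm{Def}_\Lambda(V,\alpha)([U,\phi_U])$, is surjective, and is bijective for $R=k[\epsilon]$, $\epsilon^2=0$. It is called universal if this map is bijective for all $R$ in $\hat{\mathcal{C}}$. *)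

(* Defs.v *)
From HB Require Import structures.
From mathcomp Require Import all_boot all_order all_algebra.
From mathcomp Require Import boolp classical_sets functions.
From mathcomp Require Import freeg mpoly.

Set Implicit Arguments.
Unset Strict Implicit.
Unset Printing Implicit Defensive.

Import GRing.Theory.
Local Open Scope ring_scope.
Local Open Scope quotient_scope.

(* The algebra structures of MathComp exclude the zero ring.  The quotients    *)
(* below are total in their parameters, so k-algebras are represented here by  *)
(* their structure map from k, and 1 = 0 is allowed.                           *)
HB.mixin Record PzRing_isAlgebraOver (k : pzRingType) A of GRing.PzRing A := {
  kin : k -> A;
  kin_is_zmod_morphism : zmod_morphism kin;
  kin_is_monoid_morphism : monoid_morphism kin;
  kin_central : forall (c : k) (x : A), kin c * x = x * kin c
}.

#[short(type="pzAlgType")]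
HB.structure Definition PzAlgebra (k : pzRingType) :=
  {A of PzRing_isAlgebraOver k A & GRing.PzRing A}.

Section PzAlgebraTheory.
Variables (k : pzRingType) (A : pzAlgType k).

HB.instance Definition _ :=
  GRing.isZmodMorphism.Build k A (@kin k A) (@kin_is_zmod_morphism k A).
HB.instance Definition _ :=
  GRing.isMonoidMorphism.Build k A (@kin k A) (@kin_is_monoid_morphism k A).

End PzAlgebraTheory.

Section Ideals.
Variable A : pzRingType.

Definition ideal_gen (S : A -> Prop) (x : A) : Prop :=
  exists s : seq (A * A * A),
    (forall t, t \in s -> S t.1.2) /\ x = \sum_(t <- s) t.1.1 * t.1.2 * t.2.

Definition products (S : A -> Prop) (n : nat) (x : A) : Prop :=
  exists s : seq A,
    [/\ size s = n, forall y, y \in s -> S y & x = \prod_(y <- s) y].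

Definition ideal_pow (S : A -> Prop) (n : nat) : A -> Prop :=
  ideal_gen (products S n).

Definition is_ideal (I : A -> Prop) : Prop :=
  [/\ I 0, forall x y, I x -> I y -> I (x + y)
     & forall a b x, I x -> I (a * x * b)].

Definition noetherian : Prop :=
  forall I, is_ideal I ->
    exists s : seq A, forall x, I x <-> ideal_gen (fun y => y \in s) x.

Lemma ideal_gen_is_ideal S : is_ideal (ideal_gen S).
Proof.
split=> [|x y [s [sS ->]] [t [tS ->]]|a b x [s [sS ->]]].
- by exists [::]; rewrite big_nil.
- exists (s ++ t); rewrite big_cat; split=> // z.
  by rewrite mem_cat => /orP[/sS|/tS].
exists [seq (a * t.1.1, t.1.2, t.2 * b) | t <- s]; split.
  by move=> z /mapP[t /sS ? ->].
rewrite big_map mulr_sumr mulr_suml; apply: eq_bigr => t _ /=.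
by rewrite !mulrA.
Qed.

Lemma mem_ideal_gen (S : A -> Prop) x : S x -> ideal_gen S x.
Proof.
move=> Sx; exists [:: (1, x, 1)]; rewrite big_seq1 /= mul1r mulr1.
by split=> // t; rewrite inE => /eqP ->.
Qed.

Lemma ideal_gen_min (S I : A -> Prop) :
  is_ideal I -> (forall x, S x -> I x) -> forall x, ideal_gen S x -> I x.
Proof.
case=> I0 ID IM SI x [s [sS ->]]; rewrite big_seq.
by apply: (big_ind I) => // t /sS /SI; apply: IM.
Qed.

Definition ideal_pred (S : A -> Prop) : {pred A} :=
  fun x => `[< ideal_gen S x >].

Lemma ideal_pred_zmod S : zmod_closed (ideal_pred S).
Proof.
have [I0 ID IM] := ideal_gen_is_ideal S.
split=> [|x y /asboolP Ix /asboolP Iy]; apply/asboolP => //.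
by apply: ID => //; rewrite -[y]mulr1 -mulN1r mulrA; apply: IM.
Qed.

HB.instance Definition _ S :=
  GRing.isZmodClosed.Build A (ideal_pred S) (ideal_pred_zmod S).

End Ideals.

Section QuotientAlgebra.
Variables (k : pzRingType) (A : pzAlgType k) (S : A -> Prop).

Definition algquot : Type := {ideal_quot (ideal_pred S)}.

HB.instance Definition _ := GRing.Zmodule.on algquot.

Definition qproj (x : A) : algquot := \pi_algquot x.

Lemma qproj_is_zmod : zmod_morphism qproj.
Proof. by move=> x y; rewrite /qproj !piE. Qed.

HB.instance Definition _ :=
  GRing.isZmodMorphism.Build A algquot qproj qproj_is_zmod.

Lemma qproj_eq x y : qproj x = qproj y <-> ideal_gen S (x - y).
Proof.
rewrite -[ideal_gen S (x - y)](asboolE (ideal_gen S (x - y))).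
rewrite -[asbool _]/(x - y \in ideal_pred S) Quotient.idealrBE.
by split=> [/eqP|/eqP].
Qed.

Lemma qproj_surj (u : algquot) : exists x, u = qproj x.
Proof. by exists (repr u); rewrite /qproj reprK. Qed.

Definition qone : algquot := qproj 1.
Definition qmul (u v : algquot) : algquot := qproj (repr u * repr v).

Lemma qmulE x y : qmul (qproj x) (qproj y) = qproj (x * y).
Proof.
have [_ ID IM] := ideal_gen_is_ideal S.
have e z : ideal_gen S (repr (qproj z) - z).
  by apply/qproj_eq; rewrite /qproj reprK.
apply/qproj_eq.
set x' := repr (qproj x); set y' := repr (qproj y).
have -> : x' * y' - x * y = 1 * (x' - x) * y' + x * (y' - y) * 1.
  by rewrite mul1r mulr1 mulrBl mulrBr addrA subrK.
by apply: ID; apply: IM; apply: e.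
Qed.

Fact qmulA : associative qmul.
Proof.
move=> u v w; have [x ->] := qproj_surj u; have [y ->] := qproj_surj v.
by have [z ->] := qproj_surj w; rewrite !qmulE mulrA.
Qed.

Fact qmul1 : left_id qone qmul.
Proof. by move=> u; have [x ->] := qproj_surj u; rewrite qmulE mul1r. Qed.

Fact qmulq1 : right_id qone qmul.
Proof. by move=> u; have [x ->] := qproj_surj u; rewrite qmulE mulr1. Qed.

Fact qmulDl : left_distributive qmul +%R.
Proof.
move=> u v w; have [x ->] := qproj_surj u; have [y ->] := qproj_surj v.
by have [z ->] := qproj_surj w; rewrite -raddfD !qmulE mulrDl raddfD.
Qed.

Fact qmulDr : right_distributive qmul +%R.
Proof.
move=> u v w; have [x ->] := qproj_surj u; have [y ->] := qproj_surj v.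
by have [z ->] := qproj_surj w; rewrite -raddfD !qmulE mulrDr raddfD.
Qed.

HB.instance Definition _ :=
  GRing.Zmodule_isPzRing.Build algquot qmulA qmul1 qmulq1 qmulDl qmulDr.

Lemma qproj_is_monoid : monoid_morphism qproj.
Proof. by split=> // x y; rewrite -qmulE. Qed.

HB.instance Definition _ :=
  GRing.isMonoidMorphism.Build A algquot qproj qproj_is_monoid.

Definition qkin (c : k) : algquot := qproj (kin c).

Fact qkin_zmod : zmod_morphism qkin.
Proof. by move=> c d; rewrite /qkin !raddfB. Qed.

Fact qkin_monoid : monoid_morphism qkin.
Proof. by split=> [|c d]; rewrite /qkin ?rmorph1 ?rmorphM. Qed.

Fact qkin_central c u : qkin c * u = u * qkin c.
Proof. by have [x ->] := qproj_surj u; rewrite -!rmorphM kin_central. Qed.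

HB.instance Definition _ :=
  PzRing_isAlgebraOver.Build k algquot qkin_zmod qkin_monoid qkin_central.

End QuotientAlgebra.

Section FreegLift.
Variables (R : nzRingType) (K : choiceType) (M : lmodType R).
Implicit Types (f g : K -> M) (D : {freeg K / R}).

HB.instance Definition _ f :=
  GRing.isZmodMorphism.Build {freeg K / R} M (fglift f) (lift_is_additive f).

Lemma fgliftE f D : fglift f D = \sum_(z <- dom D) coeff z D *: f z.
Proof.
rewrite -{1}[D]freeg_sumE raddf_sum /=.
by apply: eq_bigr => z _; rewrite liftU.
Qed.

Lemma fgliftU1 f z : fglift f << z >> = f z.
Proof. by rewrite liftU scale1r. Qed.

Lemma eq_fglift f g D : f =1 g -> fglift f D = fglift g D.
Proof. by move=> e; rewrite !fgliftE; apply: eq_bigr => z _; rewrite e. Qed.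

Lemma fgliftD_fun f g D :
  fglift (fun z => f z + g z) D = fglift f D + fglift g D.
Proof.
by rewrite !fgliftE -big_split; apply: eq_bigr => z _; rewrite scalerDr.
Qed.

Lemma fgliftZ f c D : fglift f (c *: D) = c *: fglift f D.
Proof.
rewrite -[D in LHS]freeg_sumE scaler_sumr raddf_sum fgliftE scaler_sumr /=.
apply: eq_bigr => z _; rewrite scalerA -[RHS](liftU f); congr (fglift _ _).
by apply/eqP/freeg_eqP => y; rewrite coeffZ !coeffU mulrA.
Qed.

Lemma freeg_basisE D : D = \sum_(z <- dom D) coeff z D *: << z >>.
Proof.
rewrite -[LHS]freeg_sumE; apply: eq_bigr => z _.
by apply/eqP/freeg_eqP => y; rewrite coeffZ !coeffU mul1r.
Qed.

End FreegLift.

Record quiver := Quiver {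
  vertex : finType;
  arrow : finType;
  source : arrow -> vertex;
  target : arrow -> vertex
}.

Section PathAlgebra.
Variables (k : fieldType) (Q : quiver).

(* A path is its starting vertex with the list of its arrows, in the order in  *)
(* which they are travelled; the empty list gives the trivial path.            *)
Fixpoint walk (v : vertex Q) (s : seq (arrow Q)) : bool :=
  if s is a :: s' then (source a == v) && walk (target a) s' else true.

Definition qpath : Type := {p : vertex Q * seq (arrow Q) | walk p.1 p.2}.

HB.instance Definition _ := Choice.on qpath.

Definition path_source (p : qpath) : vertex Q := (val p).1.
Definition path_target (p : qpath) : vertex Q :=
  last (path_source p) [seq target a | a <- (val p).2].

Lemma walk_cat v s t :
  walk v (s ++ t) = walk v s && walk (last v [seq target a | a <- s]) t.
Proof. by elim: s v => //= a s IH v; rewrite IH andbA. Qed.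

Definition trivial_path (v : vertex Q) : qpath := exist _ (v, [::]) isT.

Fact arrow_path_walk (a : arrow Q) : walk (source a) [:: a].
Proof. by rewrite /= eqxx. Qed.

Definition arrow_path (a : arrow Q) : qpath :=
  exist _ (source a, [:: a]) (arrow_path_walk a).

(* The composition p q of paths means q followed by p, as for maps, so that    *)
(* left modules over the path algebra are representations of Q.  When p starts *)
(* where q ends, insub does not fail.                                          *)
Definition path_comp (p q : qpath) : option qpath :=
  if path_source p == path_target q
  then insub (path_source q, (val q).2 ++ (val p).2) : option qpath else None.

Lemma path_compT p q : path_source p = path_target q ->
  exists2 r, path_comp p q = Some r
    & val r = (path_source q, (val q).2 ++ (val p).2).
Proof.
move=> e; rewrite /path_comp e eqxx.
set z := (_, _); have w : walk z.1 z.2.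
  by rewrite walk_cat (valP q) -/(path_target q) -e (valP p).
by rewrite (@insubT _ _ qpath z w); exists (Sub z w).
Qed.

Lemma path_compP p q r :
  path_comp p q = Some r <->
  path_source p = path_target q
    /\ val r = (path_source q, (val q).2 ++ (val p).2).
Proof.
split=> [h|[e er]].
  have e : path_source p = path_target q.
    by move: h; rewrite /path_comp; case: eqP.
  by have [r' e' er'] := path_compT e; move: h; rewrite e' => -[<-].
by have [r' -> er'] := path_compT e; congr Some; apply: val_inj; rewrite er er'.
Qed.

Lemma path_compN p q : path_source p <> path_target q -> path_comp p q = None.
Proof. by rewrite /path_comp; case: eqP. Qed.

Lemma path_comp_ends p q r : path_comp p q = Some r ->
  path_source r = path_source q /\ path_target r = path_target p.
Proof.
case/path_compP=> e er; rewrite /path_target /path_source er /=; split=> //.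
by rewrite map_cat last_cat -/(path_target q) -e.
Qed.

Lemma path_compA p q r :
  obind (path_comp p) (path_comp q r) = obind (path_comp^~ r) (path_comp p q).
Proof.
case: (eqVneq (path_source q) (path_target r)) => [eqr|/eqP nqr]; last first.
  rewrite (path_compN nqr) /=; case E: (path_comp p q) => [v|] //=.
  by rewrite path_compN // (path_comp_ends E).1.
have [u Eu vu] := path_compT eqr; have [su tu] := path_comp_ends Eu.
rewrite Eu /=; case: (eqVneq (path_source p) (path_target q)) => [epq|/eqP npq].
  have [v Ev vv] := path_compT epq; have [sv tv] := path_comp_ends Ev.
  rewrite Ev /=.
  have [w -> vw] := path_compT (etrans epq (esym tu)).
  apply/esym/path_compP; split; first by rewrite sv.
  by rewrite vw su vu vv /= catA.
by rewrite (path_compN npq) path_compN // tu.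
Qed.

Lemma path_comp1p v p :
  path_comp (trivial_path v) p = if v == path_target p then Some p else None.
Proof.
case: eqP => [e|ne]; last exact: path_compN.
by apply/path_compP; split=> //=; rewrite cats0 -surjective_pairing.
Qed.

Lemma path_compp1 p v :
  path_comp p (trivial_path v) = if v == path_source p then Some p else None.
Proof.
case: eqP => [e|ne]; last by apply: path_compN => /esym.
by apply/path_compP; split=> //=; rewrite /path_source /= e -surjective_pairing.
Qed.

Definition path_alg : Type := {freeg qpath / k}.

HB.instance Definition _ := GRing.Lmodule.on path_alg.

Definition path_elt (p : qpath) : path_alg := << p >>.

Definition opath_elt (p : option qpath) : path_alg := oapp path_elt 0 p.

Definition path_mul (x y : path_alg) : path_alg :=
  fglift (fun p => fglift (fun q => opath_elt (path_comp p q)) y) x.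

Definition path_one : path_alg := \sum_(v : vertex Q) path_elt (trivial_path v).


Lemma path_mulE p q :
  path_mul (path_elt p) (path_elt q) = opath_elt (path_comp p q).
Proof. by rewrite /path_mul !fgliftU1. Qed.

Fact path_mulDl : left_distributive path_mul +%R.
Proof. by move=> x y z; rewrite /path_mul raddfD. Qed.

Fact path_mulDr : right_distributive path_mul +%R.
Proof.
move=> x y z; rewrite /path_mul -fgliftD_fun.
by apply: eq_fglift => p; rewrite raddfD.
Qed.

Lemma path_mulZl c x y : path_mul (c *: x) y = c *: path_mul x y.
Proof. exact: fgliftZ. Qed.

Lemma path_mulZr c x y : path_mul x (c *: y) = c *: path_mul x y.
Proof.
rewrite /path_mul !fgliftE scaler_sumr; apply: eq_bigr => p _.
by rewrite fgliftZ !scalerA mulrC.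
Qed.

Lemma path_mulx0 x : path_mul x 0 = 0.
Proof. by have := path_mulZr 0 x 0; rewrite !scale0r. Qed.

Lemma path_mul0x x : path_mul 0 x = 0.
Proof. by have := path_mulZl 0 0 x; rewrite !scale0r. Qed.

Lemma path_alg_ind (P : path_alg -> Prop) :
  P 0 -> (forall p, P (path_elt p)) -> (forall x y, P x -> P y -> P (x + y)) ->
  (forall c x, P x -> P (c *: x)) -> forall x, P x.
Proof.
move=> P0 Pp PD PZ x; rewrite (freeg_basisE x).
by apply: (big_ind P) => // p _; apply/PZ/Pp.
Qed.

Fact path_mulA : associative path_mul.
Proof.
move=> x y z; elim/path_alg_ind: x => [|p|x x' ex ex'|c x ex].
- by rewrite !path_mul0x.
- elim/path_alg_ind: y => [|q|y y' ey ey'|c y ey].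
  + by rewrite !(path_mul0x, path_mulx0).
  + elim/path_alg_ind: z => [|r|z z' ez ez'|c z ez].
    * by rewrite !path_mulx0.
    * rewrite !path_mulE; move: (path_compA p q r).
      case: (path_comp q r) => [u|]; case: (path_comp p q) => [v|] /= e;
        rewrite ?path_mulE ?path_mulx0 ?path_mul0x //= ?e // -?e //.
    * by rewrite !path_mulDr ez ez'.
    * by rewrite !path_mulZr ez.
  + by rewrite path_mulDl !path_mulDr path_mulDl ey ey'.
  + by rewrite !(path_mulZl, path_mulZr) ey.
- by rewrite !path_mulDl ex ex'.
- by rewrite !path_mulZl ex.
Qed.

Fact path_mul1x : left_id path_one path_mul.
Proof.
elim/path_alg_ind=> [|p|x x' ex ex'|c x ex].
- exact: path_mulx0.
- rewrite /path_one (big_morph (path_mul^~ _) (fun x y => path_mulDl x y _) (path_mul0x _)).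
  rewrite (bigD1 (path_target p)) //= path_mulE path_comp1p eqxx big1 ?addr0 //.
  by move=> v /negbTE ne; rewrite path_mulE path_comp1p ne.
- by rewrite path_mulDr ex ex'.
- by rewrite path_mulZr ex.
Qed.

Fact path_mulx1 : right_id path_one path_mul.
Proof.
elim/path_alg_ind=> [|p|x x' ex ex'|c x ex].
- exact: path_mul0x.
- rewrite /path_one (big_morph (path_mul _) (path_mulDr _) (path_mulx0 _)).
  rewrite (bigD1 (path_source p)) //= path_mulE path_compp1 eqxx big1 ?addr0 //.
  by move=> v /negbTE ne; rewrite path_mulE path_compp1 ne.
- by rewrite path_mulDl ex ex'.
- by rewrite path_mulZl ex.
Qed.

HB.instance Definition _ := GRing.Zmodule_isPzRing.Build path_alg
  path_mulA path_mul1x path_mulx1 path_mulDl path_mulDr.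

Definition path_kin (c : k) : path_alg := c *: path_one.

Fact path_kin_zmod : zmod_morphism path_kin.
Proof. by move=> c d; rewrite /path_kin scalerBl. Qed.

Fact path_kin_monoid : monoid_morphism path_kin.
Proof.
split=> [|c d]; first exact: scale1r.
by rewrite [RHS]path_mulZl path_mul1x scalerA.
Qed.

Fact path_kin_central c x : path_kin c * x = x * path_kin c.
Proof.
by rewrite [LHS]path_mulZl [RHS]path_mulZr path_mul1x path_mulx1.
Qed.

HB.instance Definition _ := PzRing_isAlgebraOver.Build k path_alg
  path_kin_zmod path_kin_monoid path_kin_central.

Definition arrow_ideal : path_alg -> Prop :=
  ideal_gen (fun x => exists a : arrow Q, x = path_elt (arrow_path a)).

End PathAlgebra.

(* The circular quiver; its vertices are numbered from 0 to e - 1. *)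
Definition circular_quiver (e : nat) : quiver :=
  {| vertex := 'I_e; arrow := 'I_e; source := id; target := @ordS e |}.

Definition Nalg (k : fieldType) (e l : nat) : pzAlgType k :=
  algquot (ideal_pow (@arrow_ideal k (circular_quiver e)) l).

Section PowerSeries.
Variables (k : fieldType) (n : nat).

(* A power series in t_1, ..., t_n is the family of its coefficients, indexed  *)
(* by the monomials; the variable t_(i+1) is mps_var i for i : 'I_n.           *)
Definition mps : Type := 'X_{1..n} -> k.

HB.instance Definition _ := GRing.Zmodule.on mps.

Definition mps_const (c : k) : mps := fun m => c *+ (m == 0%MM).

Definition mps_var (i : 'I_n) : mps := fun m => (m == U_(i)%MM)%:R.

Definition mps_mul (f g : mps) : mps := fun m =>
  \sum_(h : 'X_{1..n < (mdeg m).+1, (mdeg m).+1} | m == (h.1 + h.2)%MM)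
    f h.1 * g h.2.

Lemma mpsP (f g : mps) : (forall m, f m = g m) -> f = g.
Proof. exact: funext. Qed.

Definition mps_trunc (d : nat) (f : mps) : {mpoly k[n]} :=
  \sum_(m : 'X_{1..n < d}) f m *: 'X_[m].

Lemma mps_truncE d f (m : 'X_{1..n}) :
  (mps_trunc d f)@_m = if (mdeg m < d)%N then f m else 0.
Proof.
rewrite /mps_trunc raddf_sum /=; case: ifP => [h|h].
  rewrite (bigD1 (BMultinom h)) //= mcoeffZ mcoeffX eqxx mulr1 big1 ?addr0 //.
  move=> i ne; rewrite mcoeffZ mcoeffX; case: eqP => [e|]; last by rewrite mulr0.
  by case/eqP: ne; apply/val_inj.
rewrite big1 // => i _; rewrite mcoeffZ mcoeffX; case: eqP => [e|].
  by move: (bmdeg i); rewrite e h.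
by rewrite mulr0.
Qed.

Lemma mps_mulE d f g (m : 'X_{1..n}) : (mdeg m < d)%N ->
  mps_mul f g m = (mps_trunc d f * mps_trunc d g)@_m.
Proof.
move=> h; rewrite mcoeffM; apply: eq_bigr => -[[a ha] [b hb]] _ /=.
by rewrite !mps_truncE !(leq_trans _ h).
Qed.

Lemma mps_mul_trunc d (p q : {mpoly k[n]}) f g (m : 'X_{1..n}) :
  (forall m', (mdeg m' < d)%N -> p@_m' = f m') ->
  (forall m', (mdeg m' < d)%N -> q@_m' = g m') ->
  (mdeg m < d)%N -> (p * q)@_m = mps_mul f g m.
Proof.
move=> hp hq h; rewrite mcoeffM; apply: eq_bigr => -[[a ha] [b hb]] _ /=.
by rewrite hp ?hq // (leq_trans _ h).
Qed.

Lemma mps_truncP d f (m : 'X_{1..n}) :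
  (mdeg m < d)%N -> (mps_trunc d f)@_m = f m.
Proof. by rewrite mps_truncE => ->. Qed.

Fact mps_mulC : commutative mps_mul.
Proof.
move=> f g; apply: mpsP => m.
by rewrite !(mps_mulE _ _ (ltnSn (mdeg m))) mulrC.
Qed.

Fact mps_mulA : associative mps_mul.
Proof.
move=> f g h; apply: mpsP => m; pose d := (mdeg m).+1.
have T := @mps_truncP d.
have E u v m' : (mdeg m' < d)%N ->
    (mps_trunc d u * mps_trunc d v)@_m' = mps_mul u v m'.
  by move=> h'; rewrite -mps_mulE.
rewrite -(mps_mul_trunc (T f) (E g h) (ltnSn _)).
by rewrite -(mps_mul_trunc (E f g) (T h) (ltnSn _)) mulrA.
Qed.

Lemma mps_mulcx c f m : mps_mul (mps_const c) f m = c * f m.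
Proof.
have C m' : (mdeg m' < (mdeg m).+1)%N -> (c%:MP_[n])@_m' = mps_const c m'.
  by rewrite mcoeffC /mps_const mulr_natr eq_sym.
rewrite -(mps_mul_trunc C (@mps_truncP _ f) (ltnSn _)) mul_mpolyC mcoeffZ.
by rewrite mps_truncP.
Qed.

Fact mps_mul1 : left_id (mps_const 1) mps_mul.
Proof. by move=> f; apply: mpsP => m; rewrite mps_mulcx mul1r. Qed.

Fact mps_mulDl : left_distributive mps_mul +%R.
Proof.
move=> f g h; apply: mpsP => m.
rewrite -[RHS]/(mps_mul f h m + mps_mul g h m) /mps_mul -big_split.
by apply: eq_bigr => a _; rewrite mulrDl.
Qed.

HB.instance Definition _ := GRing.Zmodule_isComPzRing.Build mps
  mps_mulA mps_mulC mps_mul1 mps_mulDl.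

Fact mps_const_zmod : zmod_morphism mps_const.
Proof. by move=> c d; apply: mpsP => m; rewrite /mps_const mulrnBl. Qed.

Fact mps_const_monoid : monoid_morphism mps_const.
Proof.
split=> // c d; apply: mpsP => m; rewrite [RHS]mps_mulcx /mps_const.
by rewrite mulrnAr.
Qed.

Fact mps_const_central c f : mps_const c * f = f * mps_const c.
Proof. exact: mulrC. Qed.

HB.instance Definition _ := PzRing_isAlgebraOver.Build k mps
  mps_const_zmod mps_const_monoid mps_const_central.

(* The entry of the last column in the row of index i, counted from 0, is      *)
(* t_(n-i), whose index is rev_ord i.                                          *)
Definition Nmx : 'M[mps]_n :=
  \matrix_(i < n, j < n)
    if j.+1 == n :> nat then mps_var (rev_ord i) else (i == j.+1 :> nat)%:R.

Definition Jideal (a : nat) : mps -> Prop :=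
  ideal_gen (fun x => exists i j : 'I_n, x = (Nmx ^+ a) i j).

End PowerSeries.

Definition mps_quot (k : fieldType) (n a : nat) : pzAlgType k :=
  algquot (@Jideal k n a).

Section Modules.
Variable S : pzRingType.

Definition fin_gen (M : lmodType S) : Prop :=
  exists s : seq M, forall x,
    exists c : 'I_(size s) -> S, x = \sum_(i < size s) c i *: s`_i.

Definition is_submodule (M : lmodType S) (U : M -> Prop) : Prop :=
  U 0 /\ forall (a : S) (x y : M), U x -> U y -> U (a *: x + y).

Definition indecomposable (M : lmodType S) : Prop :=
  (exists x : M, x <> 0) /\
  forall U W : M -> Prop, is_submodule U -> is_submodule W ->
    (forall x, exists u w, [/\ U u, W w & x = u + w]) ->
    (forall x, U x -> W x -> x = 0) ->
    (forall x, U x -> x = 0) \/ (forall x, W x -> x = 0).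

Definition projective (P : lmodType S) : Prop :=
  forall (X Y : lmodType S) (g : {linear X -> Y}) (f : {linear P -> Y}),
    (forall y, exists x, g x = y) ->
    exists h : {linear P -> X}, forall p, g (h p) = f p.

Definition is_basis (M : lmodType S) (B : M -> Prop) : Prop :=
  (forall x, exists s : seq (S * M),
      (forall p, p \in s -> B p.2) /\ x = \sum_(p <- s) p.1 *: p.2) /\
  (forall s : seq (S * M),
      uniq [seq p.2 | p <- s] -> (forall p, p \in s -> B p.2) ->
      \sum_(p <- s) p.1 *: p.2 = 0 -> forall p, p \in s -> p.1 = 0).

Definition free_module (M : lmodType S) : Prop := exists B, @is_basis M B.

End Modules.

Definition restrict (S T : pzRingType) (f : {rmorphism S -> T})
  (M : lmodType T) : Type := M.

Section RestrictScalars.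
Variables (S T : pzRingType) (f : {rmorphism S -> T}) (M : lmodType T).
Local Notation N := (restrict f M).

HB.instance Definition _ := GRing.Zmodule.copy N M.

Definition restrict_scale (a : S) (x : N) : N := f a *: (x : M).

Fact restrict_scaleA a b x :
  restrict_scale a (restrict_scale b x) = restrict_scale (a * b) x.
Proof. by rewrite /restrict_scale rmorphM scalerA. Qed.

Fact restrict_scale1 : left_id 1 restrict_scale.
Proof. by move=> x; rewrite /restrict_scale rmorph1; apply: scale1r. Qed.

Fact restrict_scaleDr : right_distributive restrict_scale +%R.
Proof. by move=> a x y; apply: scalerDr. Qed.

Fact restrict_scaleDl x : {morph restrict_scale^~ x : a b / a + b}.
Proof. by move=> a b; rewrite /restrict_scale rmorphD scalerDl. Qed.

HB.instance Definition _ := GRing.Zmodule_isLmodule.Build S N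
  restrict_scaleA restrict_scale1 restrict_scaleDr restrict_scaleDl.

End RestrictScalars.

(* The dimension of a finite dimensional vector space (0 if there is no finite *)
(* basis).                                                                     *)
Definition vdim (k : fieldType) (V : lmodType k) : nat :=
  xget 0%N [set d | exists b : 'I_d -> V,
                      forall v, exists! c : 'rV[k]_d, v = \sum_i c 0 i *: b i].

Definition kdim (k : fieldType) (L : pzAlgType k) (V : lmodType L) : nat :=
  vdim (restrict (@kin k L : {rmorphism _ -> _}) V).

Section Tensor.
(* The tensor product over K of A and B, where K acts on A on the right by ra  *)
(* and on B on the left by lb: the quotient of the free abelian group on A * B *)
(* by the subgroup generated by the usual relations.                           *)
Variables (K : Type) (A B : zmodType) (ra : K -> A -> A) (lb : K -> B -> B).

Inductive tensor_rel : {freeg (A * B)} -> Prop :=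
| TensorDl a a' b : tensor_rel (<< (a + a', b) >> - << (a, b) >> - << (a', b) >>)
| TensorDr a b b' : tensor_rel (<< (a, b + b') >> - << (a, b) >> - << (a, b') >>)
| TensorM c a b : tensor_rel (<< (ra c a, b) >> - << (a, lb c b) >>).

Definition tensor_null : {pred {freeg (A * B)}} := fun x =>
  `[< exists s : seq (int * {freeg (A * B)}),
        (forall p, p \in s -> tensor_rel p.2) /\ x = \sum_(p <- s) p.2 *~ p.1 >].

Fact tensor_null_zmod : zmod_closed tensor_null.
Proof.
split=> [|x y /asboolP[s [sR ->]] /asboolP[t [tR ->]]]; apply/asboolP.
  by exists [::]; rewrite big_nil.
exists (s ++ [seq (- p.1, p.2) | p <- t]); split.
  by move=> p; rewrite mem_cat => /orP[/sR//|/mapP[q /tR ? ->]].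
rewrite big_cat big_map -sumrN; congr (_ + _).
by apply: eq_bigr => p _ /=; rewrite mulrNz.
Qed.

HB.instance Definition _ :=
  GRing.isZmodClosed.Build {freeg (A * B)} tensor_null tensor_null_zmod.

Definition tensor : Type := {ideal_quot tensor_null}.

HB.instance Definition _ := GRing.Zmodule.on tensor.

Definition tproj (x : {freeg (A * B)}) : tensor := \pi_tensor x.

Fact tproj_is_zmod : zmod_morphism tproj.
Proof. by move=> x y; rewrite /tproj !piE. Qed.

HB.instance Definition _ :=
  GRing.isZmodMorphism.Build {freeg (A * B)} tensor tproj tproj_is_zmod.

Definition tpure (a : A) (b : B) : tensor := tproj << (a, b) >>.

Definition balanced (Z : zmodType) (f : A -> B -> Z) : Prop :=
  [/\ forall a a' b, f (a + a') b = f a b + f a' b,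
      forall a b b', f a (b + b') = f a b + f a b'
    & forall c a b, f (ra c a) b = f a (lb c b)].

Lemma tproj_surj (u : tensor) : exists x, u = tproj x.
Proof. by exists (repr u); rewrite /tproj reprK. Qed.

Lemma tproj_eq x y : tproj x = tproj y <-> x - y \in tensor_null.
Proof. by rewrite Quotient.idealrBE; split=> /eqP. Qed.

Lemma tensor_rel_null x : tensor_rel x -> tproj x = 0.
Proof.
move=> rx; rewrite -(raddf0 tproj); apply/tproj_eq; rewrite subr0.
apply/asboolP; exists [:: (1, x)]; rewrite big_seq1; split=> // p.
by rewrite inE => /eqP ->.
Qed.

Lemma tpure_balanced : balanced tpure.
Proof.
split=> [a a' b|a b b'|c a b]; apply/eqP; rewrite -subr_eq0.
- by rewrite opprD addrA /tpure -!tproj_is_zmod tensor_rel_null //; exact: TensorDl.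
- by rewrite opprD addrA /tpure -!tproj_is_zmod tensor_rel_null //; exact: TensorDr.
- by rewrite /tpure -tproj_is_zmod tensor_rel_null //; exact: TensorM.
Qed.

Lemma tpureDl a a' b : tpure (a + a') b = tpure a b + tpure a' b.
Proof. by case: tpure_balanced. Qed.

Lemma tpureDr a b b' : tpure a (b + b') = tpure a b + tpure a b'.
Proof. by case: tpure_balanced. Qed.

Lemma tpureM c a b : tpure (ra c a) b = tpure a (lb c b).
Proof. by case: tpure_balanced. Qed.

Lemma tpure0 b : tpure 0 b = 0.
Proof. by apply: (addrI (tpure 0 b)); rewrite -tpureDl !addr0. Qed.

Lemma tpureN a b : tpure (- a) b = - tpure a b.
Proof.
by apply: (addrI (tpure a b)); rewrite -tpureDl !subrr tpure0.
Qed.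

Lemma tensor_ind (P : tensor -> Prop) :
  (forall a b, P (tpure a b)) -> (forall x y, P x -> P y -> P (x + y)) ->
  forall x, P x.
Proof.
move=> Pp PD x; have P0 : P 0 by rewrite -(tpure0 0).
have PM y n : P y -> P (y *+ n).
  by move=> Py; elim: n => // n IH; rewrite mulrS; apply: PD.
have [u ->] := tproj_surj x; rewrite (freeg_basisE u) raddf_sum.
apply: (big_ind P) => // -[a b] _.
have E (z : int) : tproj (z *: << (a, b) >>) = tpure a b *~ z.
  by rewrite -[z in LHS]intz scaler_int raddfMz.
rewrite [_ (_ *: _)]E; case: (coeff _ _) => n; first exact: PM.
by rewrite NegzE mulrNz -mulNrz -tpureN; apply: PM.
Qed.

(* For a balanced f this is the induced additive map, see tliftE and tliftD.   *)
Definition tlift (Z : zmodType) (f : A -> B -> Z) (x : tensor) : Z :=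
  \sum_(p <- dom (repr x)) f p.1 p.2 *~ coeff p (repr x).

Section Lift.
Variables (Z : zmodType).
Implicit Types (f g : A -> B -> Z).

Local Notation ev f :=
  (fglift (fun p : A * B => f p.1 p.2 : zmodule Z) : {freeg (A * B)} -> _).

Lemma tlift_ev f x : tlift f x = ev f (repr x).
Proof. by rewrite fgliftE. Qed.

Lemma ev_null f x : balanced f -> x \in tensor_null -> ev f x = 0.
Proof.
move=> [Dl Dr M] /asboolP[s [sR ->]]; rewrite raddf_sum big_seq big1 //= => p ps.
suff Z0 : ev f p.2 = 0.
  by rewrite -scaler_int intz /= fgliftZ Z0 scaler0.
case: (sR _ ps) => *; rewrite !raddfB /= !fgliftU1 /= ?Dl ?Dr ?M.
- by rewrite -addrA -opprD subrr.
- by rewrite -addrA -opprD subrr.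
- exact: subrr.
Qed.

Lemma tlift_proj f x : balanced f -> tlift f (tproj x) = ev f x.
Proof.
move=> fb; rewrite tlift_ev.
have E : ev f (repr (tproj x)) - ev f x = 0.
  by rewrite -lift_is_additive; apply/ev_null/tproj_eq; rewrite // /tproj reprK.
exact: subr0_eq E.
Qed.

Lemma tliftE f a b : balanced f -> tlift f (tpure a b) = f a b.
Proof. by move=> fb; rewrite tlift_proj // fgliftU1. Qed.

Lemma tliftD f x y : balanced f -> tlift f (x + y) = tlift f x + tlift f y.
Proof.
move=> fb; have [u ->] := tproj_surj x; have [v ->] := tproj_surj y.
by rewrite -raddfD !tlift_proj // raddfD.
Qed.

Lemma eq_tlift f g x : (forall a b, f a b = g a b) -> tlift f x = tlift g x.
Proof. by move=> e; apply: eq_bigr => p _; rewrite e. Qed.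

Lemma tliftD_fun f g x :
  tlift (fun a b => f a b + g a b) x = tlift f x + tlift g x.
Proof. by rewrite -big_split; apply: eq_bigr => p _; rewrite mulrzDl. Qed.

End Lift.

End Tensor.

Section TensorAlgebra.
Variables (k : fieldType) (R : comAlgType k) (L : pzAlgType k).

Definition tensor_alg : Type :=
  tensor (fun (c : k) (r : R) => c *: r) (fun c (l : L) => kin c * l).

HB.instance Definition _ := GRing.Zmodule.on tensor_alg.

Definition tpair (r : R) (l : L) : tensor_alg := tpure _ _ r l.

Definition tmul (x y : tensor_alg) : tensor_alg :=
  tlift (fun r l => tlift (fun r' l' => tpair (r * r') (l * l')) y) x.

Lemma tpairZ c r l : tpair (c *: r) l = tpair r (kin c * l).
Proof. exact: tpureM. Qed.

Fact tmul_balancedr r l :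
  balanced (fun (c : k) (r : R) => c *: r) (fun c (l : L) => kin c * l)
    (fun r' l' => tpair (r * r') (l * l')).
Proof.
split=> [a a' b|a b b'|c a b].
- by rewrite mulrDr; apply: tpureDl.
- by rewrite mulrDr; apply: tpureDr.
- by rewrite -scalerAr tpairZ mulrA kin_central -mulrA.
Qed.

Fact tmul_balancedl (y : tensor_alg) :
  balanced (fun (c : k) (r : R) => c *: r) (fun c (l : L) => kin c * l)
    (fun r l => tlift (fun r' l' => tpair (r * r') (l * l')) y).
Proof.
split=> [a a' b|a b b'|c a b].
- by rewrite -tliftD_fun; apply: eq_tlift => r' l'; rewrite mulrDl; apply: tpureDl.
- by rewrite -tliftD_fun; apply: eq_tlift => r' l'; rewrite mulrDl; apply: tpureDr.
- by apply: eq_tlift => r' l'; rewrite -scalerAl tpairZ mulrA.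
Qed.

Lemma tmulE r l r' l' : tmul (tpair r l) (tpair r' l') = tpair (r * r') (l * l').
Proof.
by rewrite /tmul tliftE ?tliftE //; [exact: tmul_balancedr | exact: tmul_balancedl].
Qed.

Fact tmulDl : left_distributive tmul +%R.
Proof. by move=> x y z; apply: tliftD; apply: tmul_balancedl. Qed.

Fact tmulDr : right_distributive tmul +%R.
Proof.
move=> x y z; rewrite /tmul -tliftD_fun; apply: eq_tlift => r l.
by rewrite tliftD //; apply: tmul_balancedr.
Qed.

Fact tmulA : associative tmul.
Proof.
move=> x y z; elim/tensor_ind: x => [r l|x x' e e']; last first.
  by rewrite !tmulDl e e'.
elim/tensor_ind: y => [r' l'|y y' e e']; last first.
  by rewrite !(tmulDl, tmulDr) e e'.
elim/tensor_ind: z => [r'' l''|z z' e e']; last by rewrite !tmulDr e e'.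
by rewrite -![tpure _ _ _ _]/(tpair _ _) !tmulE !mulrA.
Qed.

Fact tmul1x : left_id (tpair 1 1) tmul.
Proof.
elim/tensor_ind=> [r l|x y ex ey]; last by rewrite tmulDr ex ey.
by rewrite -[tpure _ _ _ _]/(tpair _ _) tmulE !mul1r.
Qed.

Fact tmulx1 : right_id (tpair 1 1) tmul.
Proof.
elim/tensor_ind=> [r l|x y ex ey]; last by rewrite tmulDl ex ey.
by rewrite -[tpure _ _ _ _]/(tpair _ _) tmulE !mulr1.
Qed.

HB.instance Definition _ := GRing.Zmodule_isPzRing.Build tensor_alg
  tmulA tmul1x tmulx1 tmulDl tmulDr.

Lemma tpairM r l r' l' : tpair r l * tpair r' l' = tpair (r * r') (l * l').
Proof. exact: tmulE. Qed.

Definition tens_l (r : R) : tensor_alg := tpair r 1.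
Definition tens_r (l : L) : tensor_alg := tpair 1 l.

Fact tens_l_zmod : zmod_morphism tens_l.
Proof.
by move=> r r'; rewrite /tens_l /tpair tpureDl tpureN.
Qed.

Fact tens_l_monoid : monoid_morphism tens_l.
Proof. by split=> // r r'; rewrite tpairM mulr1. Qed.

HB.instance Definition _ :=
  GRing.isZmodMorphism.Build R tensor_alg tens_l tens_l_zmod.
HB.instance Definition _ :=
  GRing.isMonoidMorphism.Build R tensor_alg tens_l tens_l_monoid.

Fact tens_r_zmod : zmod_morphism tens_r.
Proof.
by move=> l l'; apply/eqP; rewrite eq_sym subr_eq /tens_r /tpair -tpureDr subrK.
Qed.

Fact tens_r_monoid : monoid_morphism tens_r.
Proof. by split=> // l l'; rewrite tpairM mulr1. Qed.

HB.instance Definition _ :=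
  GRing.isZmodMorphism.Build L tensor_alg tens_r tens_r_zmod.
HB.instance Definition _ :=
  GRing.isMonoidMorphism.Build L tensor_alg tens_r tens_r_monoid.

Lemma tens_comm r l : tens_l r * tens_r l = tens_r l * tens_l r.
Proof. by rewrite !tpairM !mulr1 !mul1r. Qed.

Lemma tens_kin c : tens_r (kin c) = tens_l (c%:A).
Proof. by rewrite /tens_l tpairZ mulr1. Qed.

End TensorAlgebra.

Definition base_change (k : fieldType) (R R' : comAlgType k) (L : pzAlgType k)
    (f : {lrmorphism R -> R'}) (M : lmodType (tensor_alg R L)) : Type :=
  tensor (fun (s : R) (r : R') => r * f s) (fun s (m : M) => tens_l L s *: m).

Section BaseChange.
Variables (k : fieldType) (R R' : comAlgType k) (L : pzAlgType k).
Variables (f : {lrmorphism R -> R'}) (M : lmodType (tensor_alg R L)).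
Local Notation N := (base_change f M).

HB.instance Definition _ := GRing.Zmodule.on N.

Definition bpure (r : R') (m : M) : N := tpure _ _ r m.

Definition bscale (x : tensor_alg R' L) (y : N) : N :=
  tlift (fun r l => tlift (fun r' m => bpure (r * r') (tens_r R l *: m)) y) x.

Lemma bpureM s r m : bpure (r * f s) m = bpure r (tens_l L s *: m).
Proof. exact: (tpureM (fun (s : R) (r : R') => r * f s)). Qed.

Fact bscale_balancedr r l :
  balanced (fun (s : R) (r : R') => r * f s) (fun s (m : M) => tens_l L s *: m)
    (fun r' m => bpure (r * r') (tens_r R l *: m)).
Proof.
split=> [a a' b|a b b'|c a b].
- by rewrite mulrDr; apply: tpureDl.
- by rewrite scalerDr; apply: tpureDr.
- by rewrite mulrA bpureM !scalerA tens_comm.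
Qed.

Fact bscale_balancedl (y : N) :
  balanced (fun (c : k) (r : R') => c *: r) (fun c (l : L) => kin c * l)
    (fun r l => tlift (fun r' m => bpure (r * r') (tens_r R l *: m)) y).
Proof.
split=> [a a' b|a b b'|c a b].
- by rewrite -tliftD_fun; apply: eq_tlift => r m; rewrite mulrDl; apply: tpureDl.
- rewrite -tliftD_fun; apply: eq_tlift => r m.
  by rewrite raddfD scalerDl; apply: tpureDr.
- apply: eq_tlift => r m; rewrite (rmorphM (@tens_r _ R L)) /= tens_kin -scalerA -bpureM.
  by rewrite rmorph_alg -scalerAr mulr1 scalerAl.
Qed.

Lemma bscaleE r l r' m :
  bscale (tpair r l) (bpure r' m) = bpure (r * r') (tens_r R l *: m).
Proof.
rewrite /bscale tliftE ?tliftE //; first exact: bscale_balancedr.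
exact: bscale_balancedl.
Qed.

Fact bscaleDr : right_distributive bscale +%R.
Proof.
move=> x y z; rewrite /bscale -tliftD_fun; apply: eq_tlift => r l.
by rewrite tliftD //; apply: bscale_balancedr.
Qed.

Fact bscaleDl y : {morph bscale^~ y : a b / a + b}.
Proof. by move=> a b; apply: tliftD; apply: bscale_balancedl. Qed.

Fact bscaleA a b x : bscale a (bscale b x) = bscale (a * b) x.
Proof.
elim/tensor_ind: a => [r l|a a' e e']; last by rewrite mulrDl !bscaleDl e e'.
elim/tensor_ind: b => [r' l'|b b' e e'].
  elim/tensor_ind: x => [r'' m|x x' e e']; last by rewrite !bscaleDr e e'.
  rewrite -[tpure _ _ r l]/(tpair r l) -[tpure _ _ r' l']/(tpair r' l').
  rewrite tpairM -[tpure _ _ _ _]/(bpure r'' m) !bscaleE scalerA mulrA.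
  by rewrite -(rmorphM (@tens_r _ R L)).
by rewrite mulrDr !(bscaleDl, bscaleDr) e e'.
Qed.

Fact bscale1 : left_id 1 bscale.
Proof.
elim/tensor_ind=> [r m|x x' e e']; last by rewrite bscaleDr e e'.
rewrite -[tpure _ _ r m]/(bpure r m) -[1]/(tpair 1 1) bscaleE mul1r.
by rewrite -[tens_r R 1]/(1 : tensor_alg R L) scale1r.
Qed.

HB.instance Definition _ := GRing.Zmodule_isLmodule.Build (tensor_alg R' L) N
  bscaleA bscale1 bscaleDr bscaleDl.

End BaseChange.

(* The residue map identifies the quotient of the algebra by its maximal ideal *)
(* with k; it is determined by the algebra.  The last two fields say that the  *)
(* algebra is separated and complete for the adic topology.                    *)
Record Chat (k : fieldType) := MkChat {
  Chat_alg :> comAlgType k;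
  residue : {lrmorphism Chat_alg -> k^o};
  Chat_local : forall x, residue x <> 0 <-> exists y, x * y = 1;
  Chat_noetherian : noetherian Chat_alg;
  Chat_separated : forall x,
    (forall n, ideal_pow (fun y => residue y = 0) n x) -> x = 0;
  Chat_complete : forall u : nat -> Chat_alg,
    (forall n, ideal_pow (fun y => residue y = 0) n (u n.+1 - u n)) ->
    exists x, forall n, ideal_pow (fun y => residue y = 0) n (x - u n)
}.
Arguments residue {k}.

Definition max_pow (k : fieldType) (R : Chat k) : nat -> R -> Prop :=
  ideal_pow (fun x => residue R x = 0).

Record Chat_hom (k : fieldType) (R R' : Chat k) := MkChatHom {
  Chat_fun :> {lrmorphism R -> R'};
  Chat_fun_continuous : forall n, exists m, forall x : R,
    max_pow m x -> max_pow n (Chat_fun x);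
  Chat_fun_residue : forall x : R, residue R' (Chat_fun x) = residue R x
}.

Section DualNumbers.
Variable k : fieldType.

(* Dual a b stands for a + b epsilon. *)
Record dual : Type := Dual { dual_re : k; dual_eps : k }.

Definition dual_pair (x : dual) : k * k := (dual_re x, dual_eps x).
Definition pair_dual (x : k * k) : dual := Dual x.1 x.2.

Fact dual_pairK : cancel dual_pair pair_dual. Proof. by case. Qed.

HB.instance Definition _ := Choice.copy dual (can_type dual_pairK).

Definition dual_add (x y : dual) : dual :=
  Dual (dual_re x + dual_re y) (dual_eps x + dual_eps y).
Definition dual_opp (x : dual) : dual := Dual (- dual_re x) (- dual_eps x).
Definition dual_mul (x y : dual) : dual :=
  Dual (dual_re x * dual_re y) (dual_re x * dual_eps y + dual_eps x * dual_re y).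
Definition dual_scale (c : k) (x : dual) : dual :=
  Dual (c * dual_re x) (c * dual_eps x).

Fact dual_addA : associative dual_add.
Proof. by move=> x y z; congr Dual; apply: addrA. Qed.

Fact dual_addC : commutative dual_add.
Proof. by move=> x y; congr Dual; apply: addrC. Qed.

Fact dual_add0 : left_id (Dual 0 0) dual_add.
Proof. by case=> a b; congr Dual; apply: add0r. Qed.

Fact dual_addN : left_inverse (Dual 0 0) dual_opp dual_add.
Proof. by case=> a b; congr Dual; apply: addNr. Qed.

HB.instance Definition _ :=
  GRing.isZmodule.Build dual dual_addA dual_addC dual_add0 dual_addN.

Fact dual_scaleA a b x : dual_scale a (dual_scale b x) = dual_scale (a * b) x.
Proof. by congr Dual; apply: mulrA. Qed.

Fact dual_scale1 : left_id 1 dual_scale.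
Proof. by case=> a b; congr Dual; apply: mul1r. Qed.

Fact dual_scaleDr : right_distributive dual_scale +%R.
Proof. by move=> a x y; congr Dual; apply: mulrDr. Qed.

Fact dual_scaleDl x : {morph dual_scale^~ x : a b / a + b}.
Proof. by move=> a b; congr Dual; apply: mulrDl. Qed.

HB.instance Definition _ := GRing.Zmodule_isLmodule.Build k dual
  dual_scaleA dual_scale1 dual_scaleDr dual_scaleDl.

Fact dual_mulA : associative dual_mul.
Proof.
move=> x y z; congr Dual => /=; first exact: mulrA.
by rewrite mulrDr mulrDl !mulrA addrA.
Qed.

Fact dual_mulC : commutative dual_mul.
Proof.
move=> x y; congr Dual => /=; first exact: mulrC.
by rewrite addrC; congr (_ + _); apply: mulrC.
Qed.

Fact dual_mul1 : left_id (Dual 1 0) dual_mul.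
Proof. by case=> a b; rewrite /dual_mul /= !mul1r mul0r addr0. Qed.

Fact dual_mulDl : left_distributive dual_mul +%R.
Proof.
move=> x y z; congr Dual => /=; first exact: mulrDl.
by rewrite !mulrDl addrACA.
Qed.

Fact dual_1neq0 : Dual 1 0 != 0.
Proof. by apply/eqP => -[/eqP]; rewrite oner_eq0. Qed.

HB.instance Definition _ := GRing.Zmodule_isComNzRing.Build dual
  dual_mulA dual_mulC dual_mul1 dual_mulDl dual_1neq0.

Fact dual_scaleAl (c : k) (x y : dual) : c *: (x * y) = (c *: x) * y.
Proof. by congr Dual => /=; rewrite ?mulrDr !mulrA. Qed.

HB.instance Definition _ := GRing.Lmodule_isLalgebra.Build k dual dual_scaleAl.
HB.instance Definition _ := GRing.Lalgebra_isComAlgebra.Build k dual.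

Definition dual_residue (x : dual) : k^o := dual_re x.

Fact dual_residue_zmod : zmod_morphism dual_residue. Proof. by []. Qed.
Fact dual_residue_monoid : monoid_morphism dual_residue. Proof. by []. Qed.
Fact dual_residue_scalable : scalable dual_residue. Proof. by []. Qed.

HB.instance Definition _ :=
  GRing.isZmodMorphism.Build dual k^o dual_residue dual_residue_zmod.
HB.instance Definition _ :=
  GRing.isMonoidMorphism.Build dual k^o dual_residue dual_residue_monoid.
HB.instance Definition _ :=
  GRing.isScalable.Build k dual k^o *:%R dual_residue dual_residue_scalable.

Lemma dualP (x y : dual) :
  dual_re x = dual_re y -> dual_eps x = dual_eps y -> x = y.
Proof. by case: x y => [a b] [c d] /= -> ->. Qed.

Fact dual_local (x : dual) : dual_residue x <> 0 <-> exists y, x * y = 1.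
Proof.
split=> [/eqP na|[y e]]; last first.
  move=> x0; move/(congr1 dual_re)/eqP: e.
  by rewrite /= [dual_re x]x0 mul0r eq_sym oner_eq0.
exists (Dual (dual_re x)^-1 (- dual_eps x / dual_re x ^+ 2)).
apply: dualP => /=; first exact: mulfV.
by rewrite expr2 invfM mulNr mulrN mulrCA !mulrA mulfK // addNr.
Qed.

Fact dual_noetherian : noetherian dual.
Proof.
move=> I II; have [I0 ID IM] := II.
have gen (s : seq dual) : (forall y, y \in s -> I y) ->
    (forall x, I x -> ideal_gen (fun y => y \in s) x) ->
    forall x, I x <-> ideal_gen (fun y => y \in s) x.
  by move=> sI Is x; split=> [/Is//|]; apply: ideal_gen_min.
have [[x [Ix nx]]|no1] := pselect (exists x, I x /\ dual_residue x <> 0).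
  exists [:: 1]; apply: gen => [y|y _].
    rewrite inE => /eqP ->; have [z <-] := (dual_local x).1 nx.
    by rewrite -[x]mul1r; apply: IM.
  by exists [:: (y, 1, 1)]; rewrite big_seq1 !mulr1; split=> // t;
    rewrite inE => /eqP ->; rewrite inE.
have I1 x : I x -> dual_re x = 0.
  by move=> Ix; apply/eqP/negPn/negP => /eqP n; apply: no1; exists x.
have [[x [Ix /eqP nx]]|no2] := pselect (exists x, I x /\ dual_eps x <> 0).
  exists [:: Dual 0 1]; apply: gen => [y|y Iy].
    rewrite inE => /eqP ->.
    have -> : Dual 0 1 = Dual (dual_eps x)^-1 0 * x * 1.
      by rewrite mulr1; apply: dualP; rewrite /= (I1 _ Ix) mulr0 ?addr0 ?mulVf.
    exact: IM.
  exists [:: (Dual (dual_eps y) 0, Dual 0 1, 1)].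
  rewrite big_seq1 /= mulr1; split.
    by move=> t; rewrite inE => /eqP ->; rewrite inE.
  by apply: dualP; rewrite /= ?(I1 _ Iy) mulr0 // mulr1 addr0.
exists [::]; apply: gen => // y Iy; exists [::]; rewrite big_nil; split=> //.
apply: dualP; first exact: I1.
by apply/eqP/negPn/negP => /eqP n; apply: no2; exists y.
Qed.

Fact dual_pow2 n (x : dual) :
  ideal_pow (fun y => dual_residue y = 0) n.+2 x -> x = 0.
Proof.
case=> s [sP ->]; rewrite big_seq big1 // => t /sP[[|y [|z r]] [//= _ rP ->]].
rewrite !big_cons [y * _]mulrA; have -> : y * z = 0; last by rewrite !(mul0r, mulr0).
have y0 : dual_re y = 0 by apply: rP; rewrite inE eqxx.
have z0 : dual_re z = 0 by apply: rP; rewrite !inE eqxx orbT.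
by apply: dualP; rewrite /= y0 z0 ?(mul0r, mulr0) ?addr0.
Qed.

Fact dual_separated (x : dual) :
  (forall n, ideal_pow (fun y => dual_residue y = 0) n x) -> x = 0.
Proof. by move/(_ 2%N)/dual_pow2. Qed.

Fact dual_complete (u : nat -> dual) :
  (forall n, ideal_pow (fun y => dual_residue y = 0) n (u n.+1 - u n)) ->
  exists x, forall n, ideal_pow (fun y => dual_residue y = 0) n (x - u n).
Proof.
move=> uC; have E n : u n.+2 = u 2%N.
  elim: n => // n <-; apply/eqP; rewrite -subr_eq0; apply/eqP.
  exact: dual_pow2 (uC n.+2).
exists (u 2%N) => -[|[|n]].
- exists [:: (u 2%N - u 0%N, 1, 1)]; rewrite big_seq1 !mulr1; split=> // t.
  by rewrite inE => /eqP -> /=; exists [::]; rewrite big_nil.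
- exact: uC.
- by rewrite E subrr; exists [::]; rewrite big_nil.
Qed.

Definition dual_numbers : Chat k :=
  @MkChat k dual dual_residue dual_local dual_noetherian dual_separated
    dual_complete.

End DualNumbers.

Section Deformations.
Variables (k : fieldType) (L : pzAlgType k) (V : lmodType L).

(* The data of a lift (M, phi) of V over R, where phi is defined on k (x)_R M  *)
(* and k is an R-module through the residue map.                               *)
Record lift_data (R : Chat k) := LiftData {
  lift_mod :> lmodType (tensor_alg R L);
  lift_red : base_change (residue R) lift_mod -> V
}.

Definition is_lift (R : Chat k) (M : lift_data R) : Prop :=
  [/\ fin_gen M,
      free_module (restrict (tens_l L : {rmorphism R -> tensor_alg R L}) M),
      forall x y : base_change (residue R) M,
        lift_red (x + y) = lift_red x + lift_red y,
      forall (l : L) (x : base_change (residue R) M),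
        lift_red (tens_r k^o l *: x) = l *: lift_red x
    & bijective (@lift_red R M)].

Definition lift_iso (R : Chat k) (M M' : lift_data R) : Prop :=
  exists f : {linear M -> M'}, bijective f /\
    forall x : base_change (residue R) M,
      lift_red (tlift (fun c m => bpure (residue R) c (f m)) x) = lift_red x.

(* The canonical map from k (x)_R' (R' (x)_R M) to k (x)_R M. *)
Definition residue_base_change (R R' : Chat k) (f : Chat_hom R R')
    (M : lmodType (tensor_alg R L))
    (x : base_change (residue R') (base_change f M)) :
    base_change (residue R) M :=
  tlift (fun c y => tlift (fun r m => bpure (residue R) (c * residue R' r) m) y) x.

Lemma residue_base_changeE (R R' : Chat k) (f : Chat_hom R R')
    (M : lmodType (tensor_alg R L)) (c : k) (r : R') (m : M) :
  residue_base_change (bpure (residue R') c (bpure f r m))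
    = bpure (residue R) (c * residue R' r) m.
Proof.
have B d : balanced (fun (s : R) (r : R') => r * f s)
    (fun s (m : M) => tens_l L s *: m)
    (fun r m => bpure (residue R) (d * residue R' r) m).
  split=> [a a' b|a b b'|a b x].
  - by rewrite rmorphD mulrDr; apply: tpureDl.
  - exact: tpureDr.
  - rewrite [residue R' _]rmorphM /= Chat_fun_residue mulrA; exact: bpureM.
rewrite /residue_base_change tliftE ?tliftE //.
split=> [a a' b|a b b'|a b x]; last 1 first.
- elim/tensor_ind: x => [r' m'|x x' e e']; last first.
    by rewrite scalerDr !tliftD // e e'.
  rewrite -[tpure _ _ _ _]/(bpure f r' m') [_ *: _]bscaleE !tliftE //.
  rewrite -[tens_r R 1]/(1 : tensor_alg R L) scale1r.
  by rewrite rmorphM mulrA.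
- rewrite -tliftD_fun; apply: eq_tlift => r' m'.
  by rewrite mulrDl; apply: tpureDl.
- exact: tliftD.
Qed.

Definition push (R R' : Chat k) (f : Chat_hom R R') (M : lift_data R) :
    lift_data R' :=
  @LiftData R' (base_change f M) (fun x => lift_red (residue_base_change x)).

Section Versal.
Variables (R : Chat k) (U : lift_data R).

(* The map from Hom(R, R') to Def(V, R') that is given by the deformation of U *)
(* is surjective, respectively injective.                                      *)
Definition def_surjective (R' : Chat k) : Prop :=
  forall M : lift_data R', is_lift M ->
    exists f : Chat_hom R R', lift_iso (push f U) M.

Definition def_injective (R' : Chat k) : Prop :=
  forall f g : Chat_hom R R', lift_iso (push f U) (push g U) -> f =1 g.

Definition versal : Prop :=
  [/\ is_lift U, forall R', def_surjective R'
    & def_injective (dual_numbers k)].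

Definition universal : Prop :=
  is_lift U /\ forall R', def_surjective R' /\ def_injective R'.

End Versal.

End Deformations.

Definition alg_iso (k : fieldType) (R : Chat k) (A : pzAlgType k) : Prop :=
  exists f : {rmorphism R -> A},
    (forall c : k, f c%:A = kin c) /\ bijective f.

(* Main.v *)
(* The uniserial module V = k[X]/(X^d), where X is the sum of the arrows, lifts to R
   exactly by the modules R[X]/(f), where f is the characteristic polynomial of X: f is
   monic of degree d, its exponents are congruent to d modulo e, and it divides X^l.
   The isomorphism class of a lift determines f and, because the automorphisms of V are
   polynomials in X^e and so lift to automorphisms of every R[X]/(f), it is determined
   by f.  The cofactor of f in X^l satisfies the same conditions with l - d in place of
   d, so that one may work with the one of degree ne + i <= l/2.  It is X^i g(X^e) for a
   monic g of degree n, and it divides X^l if and only if g divides Y^a with a = m_V,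
   that is, if and only if the companion matrix of g has a-th power zero.  Hence the
   deformations of V over R are the points of k[[t_1,...,t_n]]/J_n(a) in R.

   This ring is finite dimensional: the non-leading coefficients of a monic divisor of
   Y^a are nilpotent.  This makes it an object of the category of complete local
   algebras, and morphisms out of it are evaluations of truncated power series. *)

From HB Require Import structures.
From mathcomp Require Import all_boot all_order all_algebra.
From mathcomp Require Import boolp classical_sets.
From mathcomp Require Import freeg mpoly.
From mathcomp Require Import ring zify.
Require Import Defs.

Set Implicit Arguments.
Unset Strict Implicit.
Unset Printing Implicit Defensive.

Import GRing.Theory.
Local Open Scope ring_scope.

(** * Monic divisors of a power of the variable *)

(** Two obstacles shape the argument. The isomorphism [phi] belongs to a deformation, so a lift is
    described by a generator that reduces to one fixed generator v of V. Every lift has such a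
    generator, which is how the automorphisms of V get lifted; two lifts with the same f are then
    identified by sending one such generator to the other, and this is compatible with [phi].
    Moreover, the theorem is about any R carrying a versal deformation, and uniqueness of versal
    rings is not taken for granted: surjectivity onto deformations and injectivity over the dual
    numbers are translated into properties of a tuple c in R with [tuple_mx c ^+ a = 0], and these
    alone force R to be the quotient of the power series ring. The number a comes from writing l = i
    + r + e a with r < e: the cofactor of X^i g(X^e) in X^l must be X^r h(X^e) with g h = Y^a. The
    choice of the smaller of the two dimensions gives n <= a, which puts J_n(a) inside the maximal
    ideal. *)

Section MonicDivisors.
Variable R : comNzRingType.
Implicit Types f p q : {poly R}.

Lemma monic_divide f p : f \is monic ->
  exists q r, p = q * f + r /\ (size r < size f)%N.
Proof.
move=> fm; exists (Pdiv.CommonRing.rdivp p f), (Pdiv.CommonRing.rmodp p f).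
split; first exact: Pdiv.RingMonic.rdivp_eq.
by rewrite Pdiv.Ring.ltn_rmodpN0 // monic_neq0.
Qed.

(** Comparing coefficients of X^r for r < a gives f_0^(r+1) q_r = 0 by induction on r. As f is not
    constant, the degree of q is such an r, and there q has coefficient 1. *)
Lemma coef_Xn_dvd_nilp f q a : f \is monic -> (1 < size f)%N -> 'X^a = q * f ->
  exists K, f`_0 ^+ K = 0.
Proof.
move=> fm sf e; have sf0 : (0 < size f)%N by apply: ltnW.
have q0 : q != 0.
  by apply: contraTneq (monic_neq0 (monicXn R a)) => q0; rewrite e q0 mul0r negbK.
have sq : (size q <= a)%N.
  have := size_Mmonic q0 fm; rewrite -e size_polyXn => sE.
  by rewrite -ltnS sE -[size f]prednK // addnS /= -[X in (X < _)%N]addn0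
    ltn_add2l -ltnS prednK.
have H r : (r < a)%N -> f`_0 ^+ r.+1 * q`_r = 0.
  elim/ltn_ind: r => r IH ra.
  have := congr1 (fun p : {poly R} => p`_r) e; rewrite coefXn ltn_eqF // mulrC
    coefM.
  rewrite big_ord_recl /= subn0 => /esym/eqP; rewrite addr_eq0 => /eqP E.
  rewrite exprSr -mulrA E mulrN mulr_sumr big1 ?oppr0 // => i _ /=.
  have lt : (r - bump 0 i < r)%N.
    by rewrite /bump /= add1n; rewrite subnS prednK ?subn_gt0 // leq_subr.
  have -> : f`_0 ^+ r = f`_0 ^+ (r - (r - bump 0 i).+1) * f`_0 ^+ (r - bump 0 i).+1.
    by rewrite -exprD subnK.
  by rewrite mulrCA -mulrA IH ?mulr0 //; apply: ltn_trans ra.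
exists (size q).-1.+1; have sqr : ((size q).-1 < a)%N.
  by rewrite prednK // lt0n size_poly_eq0.
have := H _ sqr; have : lead_coef ('X^a : {poly R}) = lead_coef q.
  by rewrite e lead_coef_Mmonic.
by rewrite lead_coefXn /lead_coef => <-; rewrite mulr1.
Qed.

(* If [f_0 ^+ K = 0] then [f ^+ K] is divisible by [f - f_0], so [(f - f_0) / X]
   divides a power of [X] and the induction goes on. *)
Lemma coef_dvdXn_nilp f q a : f \is monic -> 'X^a = q * f ->
  forall j, (j < (size f).-1)%N -> exists K, f`_j ^+ K = 0.
Proof.
move=> fm e j; elim: j => [|j IH] in f q a fm e *.
  by move=> sf; apply: coef_Xn_dvd_nilp e; rewrite // -ltn_predRL.
move=> sf; have [||K fK] := coef_Xn_dvd_nilp _ _ e => //.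
  by rewrite -ltn_predRL (leq_ltn_trans _ sf).
pose g := drop_poly 1 f.
have fE : f - (f`_0)%:P = g * 'X.
  apply/polyP => -[|i]; rewrite coefB coefC coefMX /= ?subrr //.
  by rewrite subr0 coef_drop_poly addn1.
have sg : size g = (size f).-1 by rewrite size_drop_poly subn1.
have gm : g \is monic.
  rewrite monicE lead_coefE sg coef_drop_poly addn1 prednK.
    by rewrite -lead_coefE -monicE.
  by rewrite -subn1 subn_gt0 -ltn_predRL (leq_ltn_trans _ sf).
have eK : 'X^(a * K) = q ^+ K * (\sum_(i < K) f ^+ (K.-1 - i) * (f`_0)%:P ^+ i)
  * 'X * g.
  have f0K : (f`_0)%:P ^+ K = 0 by rewrite -polyC_exp fK.
  rewrite exprM e exprMn -[f ^+ K]subr0 -[X in _ - X]f0K subrXX fE -!mulrA.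
  by congr (_ * _); rewrite mulrA mulrC; congr (_ * _); apply: mulrC.
have := IH g _ _ gm eK; rewrite sg coef_drop_poly addn1; apply.
by rewrite ltn_predRL.
Qed.

End MonicDivisors.

(** * Evaluation of polynomials and companion matrices *)

Section PolynomialEvaluation.
Variables (R : comNzRingType) (T : pzRingType) (iota : {rmorphism R -> T}).
Variable X : T.
Implicit Types p q : {poly R}.

(** The target may be noncommutative or zero: it will be a ring of matrices (possibly of size 0),
    [Nalg k e l] or [tensor_alg R L]. *)
Definition peval p : T := \sum_(j < size p) iota p`_j * X ^+ j.

Lemma peval_widen N p :
  (size p <= N)%N -> peval p = \sum_(j < N) iota p`_j * X ^+ j.
Proof.
move=> sp; rewrite /peval (big_ord_widen N (fun j => iota p`_j * X ^+ j) sp)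
  big_mkcond.
apply: eq_bigr => j _; case: ltnP => // /(nth_default 0) ->.
by rewrite rmorph0 mul0r.
Qed.

Lemma pevalD p q : peval (p + q) = peval p + peval q.
Proof.
rewrite (peval_widen (size_polyD p q)) (peval_widen (leq_maxl _ (size q))).
rewrite (peval_widen (leq_maxr (size p) _)) -big_split.
by apply: eq_bigr => j _; rewrite coefD rmorphD mulrDl.
Qed.

Lemma peval0 : peval 0 = 0.
Proof. by rewrite /peval size_poly0 big_ord0. Qed.

Lemma pevalN p : peval (- p) = - peval p.
Proof. by apply/eqP; rewrite -addr_eq0 -pevalD addNr peval0. Qed.

Lemma pevalB p q : peval (p - q) = peval p - peval q.
Proof. by rewrite pevalD pevalN. Qed.

Lemma pevalC c : peval c%:P = iota c.
Proof.
by rewrite (peval_widen (size_polyC_leq1 c)) big_ord1 coefC mulr1.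
Qed.

Lemma pevalZ c p : peval (c *: p) = iota c * peval p.
Proof.
rewrite (peval_widen (size_scale_leq c p)) mulr_sumr.
by apply: eq_bigr => j _; rewrite coefZ rmorphM mulrA.
Qed.

Lemma pevalMX p : peval (p * 'X) = peval p * X.
Proof.
have sp : (size (p * 'X)%R <= (size p).+1)%N.
  by have [->|/size_mulX ->] := eqVneq p 0; rewrite // mul0r size_poly0.
rewrite (peval_widen sp) big_ord_recl coefMX rmorph0 mul0r add0r mulr_suml.
by apply: eq_bigr => j _; rewrite coefMX /= exprSr mulrA.
Qed.

Lemma pevalXn j : peval 'X^j = X ^+ j.
Proof.
elim: j => [|j IH]; first by rewrite expr0 -[1 in LHS]polyC1 pevalC rmorph1.
by rewrite exprSr pevalMX IH exprSr.
Qed.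

Lemma pevalX : peval 'X = X. Proof. by rewrite -['X]expr1 pevalXn. Qed.

Lemma pevalMXn p j : peval (p * 'X^j) = peval p * X ^+ j.
Proof.
by elim: j => [|j IH]; rewrite ?mulr1 // !exprSr !mulrA pevalMX IH.
Qed.

Hypothesis iotaX : forall c, iota c * X = X * iota c.

Lemma pevalM p q : peval (p * q) = peval p * peval q.
Proof.
elim/poly_ind: q => [|q c IH]; first by rewrite mulr0 peval0 mulr0.
rewrite mulrDr mulrA !pevalD !pevalMX IH mulrDr mulrA; congr (_ + _).
rewrite mulrC mul_polyC pevalZ pevalC /peval mulr_sumr mulr_suml.
have iotaXn j : GRing.comm (iota c) (X ^+ j) by apply/commrX/iotaX.
by apply: eq_bigr => j _; rewrite -mulrA -iotaXn !mulrA -!rmorphM mulrC.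
Qed.

End PolynomialEvaluation.

Section Companion.
Variable R : comNzRingType.
Implicit Types f p q : {poly R}.

Definition companion d f : 'M[R]_d :=
  \matrix_(i, j) if j.+1 == d :> nat then - f`_i else (i == j.+1 :> nat)%:R.

Local Notation scal d := (@scalar_mx R d : {rmorphism R -> 'M[R]_d}).
Local Notation ev d f := (peval (scal d) (companion d f)).

Lemma scalar_companion d f c :
  scal d c * companion d f = companion d f * scal d c.
Proof. exact/esym/scalar_mxC. Qed.

Section CompanionPowers.
Variables (d : nat) (f : {poly R}).
Hypotheses (fm : f \is monic) (sf : size f = d.+2).
Local Notation C := (companion d.+1 f).
Local Notation ev := (ev d.+1 f).
Local Notation ej j := (delta_mx j 0 : 'cV[R]_d.+1).

Lemma companion_delta (j : 'I_d.+1) : C ^+ j *m ej ord0 = ej j.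
Proof.
case: j => j; elim: j => [|j IH] lt.
  by rewrite expr0 mul1mx; congr delta_mx; apply: val_inj.
rewrite exprS -mulmxA (IH (ltnW lt)) -colE; apply/matrixP => i z.
by rewrite !mxE ord1 eqxx andbT /= (ltn_eqF lt).
Qed.

Lemma peval_companion_delta p : (size p <= d.+1)%N -> ev p *m ej ord0 = \col_i p`_i.
Proof.
move=> sp; rewrite (peval_widen _ _ sp) mulmx_suml; apply/matrixP => i z.
rewrite summxE mxE (bigD1 i) //= big1 ?addr0 => [|j ji].
  rewrite [scal _ _ * _]mul_scalar_mx -scalemxAl companion_delta !mxE.
  by rewrite ord1 !eqxx mulr1.
rewrite [scal _ _ * _]mul_scalar_mx -scalemxAl companion_delta !mxE.
by rewrite eq_sym (negbTE ji) mulr0.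
Qed.

(** f(C) kills e_0, because C^(d+1) e_0 is the last column of C. It commutes with the powers C^j,
    which carry e_0 to every e_j, so it kills all columns. *)
Lemma peval_companion_self : ev f = 0.
Proof.
have e0 : ev f *m ej ord0 = 0.
  have fE : f = (\poly_(j < d.+1) f`_j) + 'X^(d.+1).
    apply/polyP => j; rewrite coefD coef_poly coefXn; case: ltngtP => h.
    - by rewrite addr0.
    - by rewrite addr0 nth_default ?sf.
    - by rewrite h add0r -(monicP fm) lead_coefE sf.
  rewrite [X in peval _ _ X]fE pevalD mulmxDl peval_companion_delta ?size_poly //.
  rewrite pevalXn exprS -[d in _ ^+ d]/(nat_of_ord (@ord_max d)) -mulmxA.
  rewrite companion_delta -colE; apply/matrixP => i z.
  by rewrite !mxE eqxx coef_poly ltn_ord subrr.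
apply/matrixP => i j; have := companion_delta j.
move/(congr1 (fun v => (ev f *m v) i 0)); rewrite mulmxA.
rewrite -[ev f *m C ^+ j]/(ev f * C ^+ j) -pevalMXn mulrC.
rewrite (pevalM (@scalar_companion d.+1 f)) -mulmxA e0 mulmx0 -colE !mxE => <-.
by [].
Qed.

(** After division by f only a remainder is left, and the value of a remainder at C, applied to e_0,
    is the column of its coefficients. *)
Lemma peval_companionS_eq0 p : ev p = 0 <-> exists q, p = q * f.
Proof.
split=> [p0|[q ->]]; last first.
  by rewrite (pevalM (@scalar_companion d.+1 f)) peval_companion_self mulr0.
have [q [r [e sr]]] := monic_divide p fm; exists q.
suff r0 : r = 0 by rewrite e r0 addr0.
have : ev r *m ej ord0 = 0.
  have -> : r = p - q * f by rewrite e addrAC subrr add0r.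
  rewrite pevalB p0 (pevalM (@scalar_companion d.+1 f)) peval_companion_self
    mulr0 subrr.
  by rewrite mul0mx.
rewrite sf ltnS in sr; rewrite peval_companion_delta // => /matrixP E;
  apply/polyP => j.
rewrite coef0; case: (ltnP j d.+1) => h; last by rewrite nth_default
  ?(leq_trans sr).
by have := E (Ordinal h) 0; rewrite !mxE.
Qed.

End CompanionPowers.

Lemma peval_companion_eq0 d f p : f \is monic -> size f = d.+1 ->
  ev d f p = 0 <-> exists q, p = q * f.
Proof.
case: d => [|d] fm sf; last exact: peval_companionS_eq0.
(* For d = 0 the matrix ring is zero and f = 1, so both sides hold; this serves the case n = 0. *)
split=> [_|_]; last by apply/matrixP => -[].
exists p; rewrite (size1_polyC (eq_leq sf)).
have := monicP fm; rewrite lead_coefE sf /= => ->.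
by rewrite polyC1 mulr1.
Qed.

Lemma companion_exp_eq0 d f a : f \is monic -> size f = d.+1 ->
  companion d f ^+ a = 0 <-> exists q, 'X^a = q * f.
Proof.
move=> fm sf.
have E : peval (scal d) (companion d f) 'X^a = companion d f ^+ a.
  by rewrite pevalXn.
rewrite -E.
exact: peval_companion_eq0.
Qed.

End Companion.

(** * Polynomials with exponents in one class modulo e *)

Section HomogeneousPolynomials.
Variables (R : comNzRingType) (e : nat).
Hypothesis e_gt0 : (0 < e)%N.
Implicit Types f p q g : {poly R}.

(** Homogeneity of degree r for the grading of R[X] by the integers modulo e in which X has degree
    1. *)
Definition congr_exp (r : nat) p : Prop :=
  forall j, p`_j <> 0 -> j = r %[mod e].

(** Descending induction on j. As f is monic, the coefficient of X^(j+d) expresses q_j through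
    products f_s q_(j+d-s) with s < d. If f_s is nonzero, then s = d modulo e, so the index j+d-s is
    larger than j and in the same class. Monicity replaces the absence of zero divisors. *)
Lemma cofactor_congr_exp f q l d : f \is monic -> size f = d.+1 ->
  'X^l = q * f -> congr_exp d f -> forall j, q`_j <> 0 -> (j + d = l %[mod e])%N.
Proof.
move=> fm sf E hf j; have [t] := ubnP (size q - j)%N.
elim: t => // t IH in j *; rewrite ltnS => st qj; apply/eqP/negPn/negP => ne.
have sj : (j < size q)%N by rewrite ltnNge; apply/negP => h; apply: qj; apply:
  nth_default.
case: qj; have := congr1 (fun p : {poly R} => p`_(j + d)) E.
have -> : ('X^l : {poly R})`_(j + d) = 0.
  by rewrite coefXn; have [h|//] := eqVneq (j + d)%N l; rewrite h eqxx in ne.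
have lt : (d < (j + d).+1)%N by rewrite ltnS leq_addl.
rewrite mulrC coefM (bigD1 (Ordinal lt)) //= addnK -[X in f`_X]/(d.+1.-1) -sf.
rewrite -lead_coefE (monicP fm) mul1r big1 ?addr0 // => s; rewrite -val_eqE /=
  => sd.
case: (ltnP d s) => ds; first by rewrite nth_default ?mul0r // sf.
have {sd}ds : (s < d)%N by rewrite ltn_neqAle sd.
have [->|/eqP fs] := eqVneq f`_s 0; first by rewrite mul0r.
have [->|/eqP qs] := eqVneq q`_(j + d - s) 0; first by rewrite mulr0.
have lj : (j < j + d - s)%N by rewrite -addnBA ?(ltnW ds) // -[X in (X <
  _)%N]addn0 ltn_add2l subn_gt0.
have := IH (j + d - s)%N.
have -> : (size q - (j + d - s) < t)%N by rewrite (leq_trans _ st) // ltn_sub2l.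
move=> /(_ isT qs) h; case/eqP: ne; rewrite -h.
have := hf _ fs => sE.
rewrite -[RHS]modnDmr -sE modnDmr subnK //.
by rewrite (leq_trans (ltnW ds)) // leq_addl.
Qed.

Lemma congr_exp_comp r p : (r < e)%N -> congr_exp r p ->
  exists q, p = 'X^r * (q \Po 'X^e).
Proof.
move=> re hp; exists (\poly_(s < size p) p`_(r + s * e)).
apply/polyP => j; rewrite coefXnM coef_comp_poly_Xn //.
have [pj|/eqP pj] := eqVneq p`_j 0.
  case: ifP => // jr; case: ifP => // /dvdnP[s sE].
  rewrite sE mulnK // coef_poly; case: ifP => // _.
  by rewrite -sE subnKC ?pj // leqNgt jr.
have jr := hp _ pj; rewrite (modn_small re) in jr.
have rj : (r <= j)%N by rewrite -jr leq_mod.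
have jE : (j = r + j %/ e * e)%N by rewrite [LHS](divn_eq j e) jr addnC.
rewrite ltnNge rj /= jE addKn dvdn_mull // mulnK // coef_poly -jE.
case: ltnP => // h; case: pj; rewrite nth_default // jE.
by rewrite (leq_trans h) // (leq_trans _ (leq_addl _ _)) // leq_pmulr.
Qed.

End HomogeneousPolynomials.

Section TuplePolynomials.
Variable R : comNzRingType.
Implicit Types f p q g : {poly R}.

(** Signs and order are chosen so that the companion matrix is N_n at the point c: c_1 goes with
    X^(n-1) and c_n with the constant term. *)
Definition tuple_poly n (c : 'I_n -> R) : {poly R} :=
  'X^n - \sum_(j < n) c (rev_ord j) *: 'X^j.

Section TuplePoly.
Variable n : nat.
Implicit Types c : 'I_n -> R.

Lemma coef_tuple_poly c (j : 'I_n) : (tuple_poly c)`_j = - c (rev_ord j).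
Proof.
rewrite coefB coefXn ltn_eqF // sub0r coef_sum (bigD1 j) //=.
rewrite coefZ coefXn eqxx mulr1 big1 ?addr0 // => s sj.
by rewrite coefZ coefXn val_eqE eq_sym (negbTE sj) mulr0.
Qed.

Lemma coef_tuple_poly_ge c j : (n <= j)%N -> (tuple_poly c)`_j = (j == n)%:R.
Proof.
move=> nj; rewrite coefB coefXn coef_sum big1 ?subr0 // => s _.
by rewrite coefZ coefXn gtn_eqF ?mulr0 // (leq_trans (ltn_ord s)).
Qed.

Lemma size_tuple_poly c : size (tuple_poly c) = n.+1.
Proof.
apply/anti_leq/andP; split.
  by apply/leq_sizeP => j nj; rewrite coef_tuple_poly_ge ?gtn_eqF // ltnW.
rewrite ltnNge; apply/negP => /leq_sizeP/(_ _ (leqnn n))/eqP.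
by rewrite coef_tuple_poly_ge // eqxx oner_eq0.
Qed.

Lemma tuple_poly_monic c : tuple_poly c \is monic.
Proof.
by rewrite monicE lead_coefE size_tuple_poly coef_tuple_poly_ge ?eqxx.
Qed.

Lemma tuple_poly_surj g : g`_n = 1 -> (forall j, (n < j)%N -> g`_j = 0) ->
  g = tuple_poly (fun j : 'I_n => - g`_(rev_ord j)).
Proof.
move=> gn g0; apply/polyP => j; have [nj|jn] := leqP n j; last first.
  by rewrite -[j]/(nat_of_ord (Ordinal jn)) coef_tuple_poly rev_ordK opprK.
rewrite coef_tuple_poly_ge //; case: eqVneq nj => [->//|ne nj].
by rewrite g0 // ltn_neqAle eq_sym ne.
Qed.

Lemma tuple_poly_inj c c' : tuple_poly c = tuple_poly c' -> c =1 c'.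
Proof.
move=> E j; have := congr1 (fun p : {poly R} => p`_(rev_ord j)) E.
by rewrite !coef_tuple_poly rev_ordK => /oppr_inj.
Qed.

(* The matrix [N_n] of the statement, at the point [c]. *)
Definition tuple_mx c : 'M[R]_n :=
  \matrix_(i, j) if j.+1 == n :> nat then c (rev_ord i) else (i == j.+1 :> nat)%:R.

Lemma tuple_mx_exp_eq0 c a :
  tuple_mx c ^+ a = 0 <-> exists q, 'X^a = q * tuple_poly c.
Proof.
have -> : tuple_mx c = companion n (tuple_poly c).
  by apply/matrixP => i j; rewrite !mxE coef_tuple_poly opprK.
exact: companion_exp_eq0 (tuple_poly_monic c) (size_tuple_poly c).
Qed.

End TuplePoly.

Section StretchedPolynomials.
Variables (e n i : nat).
Hypothesis ie : (i < e)%N.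
Implicit Types c : 'I_n -> R.

Let e_gt0 : (0 < e)%N := leq_ltn_trans (leq0n i) ie.

Definition stretch c : {poly R} := 'X^i * (tuple_poly c \Po 'X^e).

Lemma coef_stretch c j : (stretch c)`_j =
  if (j < i)%N then 0
  else if (e %| j - i)%N then (tuple_poly c)`_((j - i) %/ e) else 0.
Proof. by rewrite coefXnM coef_comp_poly_Xn. Qed.

Lemma coef_stretchM c s : (stretch c)`_(s * e + i) = (tuple_poly c)`_s.
Proof.
by rewrite coef_stretch ltnNge leq_addl addnK dvdn_mull //= mulnK.
Qed.

Lemma stretch_monic c : stretch c \is monic /\ size (stretch c) = (n * e + i).+1.
Proof.
have lc : (stretch c)`_(n * e + i) = 1.
  by rewrite coef_stretchM coef_tuple_poly_ge ?eqxx.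
have sz : size (stretch c) = (n * e + i).+1.
  apply/anti_leq/andP; split.
    apply/leq_sizeP => j nj; rewrite coef_stretch; case: ifP => // ji.
    case: ifP => // /dvdnP[s sE]; rewrite sE mulnK //.
    have jE : (j = s * e + i)%N by rewrite -sE subnK // leqNgt ji.
    have ns : (n < s)%N by rewrite jE ltn_add2r ltn_pmul2r in nj.
    by rewrite coef_tuple_poly_ge ?gtn_eqF // ltnW.
  rewrite ltnNge; apply/negP => /leq_sizeP/(_ _ (leqnn _))/eqP.
  by rewrite lc oner_eq0.
by rewrite monicE lead_coefE sz lc.
Qed.

Lemma stretch_congr_exp c : congr_exp e (n * e + i) (stretch c).
Proof.
move=> j; rewrite coef_stretch; case: ifP => // ji; case: ifP => // /dvdnP[s sE] _.
have jE : (j = s * e + i)%N by rewrite -sE subnK // leqNgt ji.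
by rewrite jE !modnMDl.
Qed.

Lemma stretch_surj f : f \is monic -> size f = (n * e + i).+1 ->
  congr_exp e (n * e + i) f -> exists c, f = stretch c.
Proof.
move=> fm sf hf.
have [q qE] : exists q, f = 'X^i * (q \Po 'X^e).
  by apply: congr_exp_comp => // j /hf; rewrite modnMDl.
have cq s : q`_s = f`_(s * e + i).
  by rewrite qE coefXnM ltnNge leq_addl addnK coef_comp_poly_Xn // dvdn_mull
    //= mulnK.
exists (fun j => - q`_(rev_ord j)); rewrite qE /stretch -tuple_poly_surj // =>
  [|j nj].
  by rewrite cq -(monicP fm) lead_coefE sf.
by rewrite cq nth_default // sf ltn_add2r ltn_pmul2r.
Qed.

Lemma stretch_inj c c' : stretch c = stretch c' -> c =1 c'.
Proof.
move=> E; apply: tuple_poly_inj; apply/polyP => j.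
by rewrite -!coef_stretchM E.
Qed.

(** The cofactor is homogeneous of class r, hence of the form X^r p(X^e) as r < e. Cancelling
    X^(i+r) and comparing coefficients at the multiples of e leaves an identity in X^a. *)
Lemma stretch_dvd c r a : (r < e)%N ->
  (exists q, 'X^(i + r + e * a) = q * stretch c) <->
  (exists q, 'X^a = q * tuple_poly c).
Proof.
move=> re; have [sm ss] := stretch_monic c; split=> -[q E]; last first.
  exists ('X^r * (q \Po 'X^e)); rewrite /stretch mulrACA -comp_polyM -E.
  by rewrite comp_Xn_poly -exprM -!exprD (addnC r).
have hq : congr_exp e r q.
  move=> j qj; have := cofactor_congr_exp sm ss E (@stretch_congr_exp c) qj.
  rewrite addnCA modnMDl (addnC _ (e * a)%N) (mulnC e) modnMDl (addnC i) => /eqP.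
  by rewrite eqn_modDr => /eqP.
have [p pE] := congr_exp_comp e_gt0 re hq; exists p.
have {}E : ('X^a \Po 'X^e) = (p * tuple_poly c) \Po 'X^e :> {poly R}.
  apply: (monic_lreg (monicXn R (i + r))).
  rewrite comp_Xn_poly -exprM -exprD E pE comp_polyM /stretch exprD.
  by rewrite mulrACA (mulrC 'X^r).
apply/polyP => j; have := congr1 (fun p : {poly R} => p`_(j * e)) E.
by rewrite /= !coef_comp_poly_Xn // dvdn_mull // mulnK.
Qed.

End StretchedPolynomials.

End TuplePolynomials.

Lemma map_stretch (R R' : comNzRingType) (phi : {rmorphism R -> R'}) e n i
    (c : 'I_n -> R) :
  map_poly phi (stretch e i c) = stretch e i (fun s => phi (c s)).
Proof.
rewrite /stretch rmorphM /= map_comp_poly !map_polyXn; congr (_ * (_ \Po _)).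
rewrite /tuple_poly rmorphB /= map_polyXn rmorph_sum /=; congr (_ - _).
by apply: eq_bigr => j _; rewrite map_polyZ map_polyXn.
Qed.

(** * Coefficient tuples as parameters *)

Section Parametrization.
Variables (e l n i r a d : nat) (sw : bool).
Hypotheses (ie : (i < e)%N) (re : (r < e)%N) (lE : l = (i + r + e * a)%N).
Hypothesis nl : (n * e + i <= l)%N.
Hypothesis dE : d = (if sw then l - (n * e + i) else n * e + i)%N.

Let e_gt0 : (0 < e)%N := leq_ltn_trans (leq0n i) ie.

(* [sw] is the case of a module of dimension more than [l / 2], whose syzygy then
   has the smaller dimension [n * e + i]; the parameter [c] is read off the cofactor
   of [f] in ['X^l], which is the polynomial of the deformed syzygy. *)
Definition parametrizes (R : comNzRingType) (c : 'I_n -> R) (f : {poly R}) :=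
  if sw then 'X^l = f * stretch e i c else f = stretch e i c.

Definition deform_poly (R : comNzRingType) (f : {poly R}) : Prop :=
  [/\ f \is monic, size f = d.+1, congr_exp e d f & exists q, 'X^l = q * f].

Variable R : comNzRingType.
Implicit Types (f : {poly R}) (c : 'I_n -> R).

Lemma cofactor_monic f q j m : f \is monic -> size f = m.+1 -> 'X^j = q * f ->
  [/\ q \is monic, size q = (j - m).+1 & (m <= j)%N].
Proof.
move=> fm sf E; have qm : q \is monic.
  by rewrite monicE -(lead_coef_Mmonic _ fm) -E lead_coefXn.
have := size_Mmonic (monic_neq0 qm) fm; rewrite -E size_polyXn sf addnS /= => sE.
have q0 : (0 < size q)%N by rewrite lt0n size_poly_eq0 monic_neq0.
have mj : (m <= j)%N.
  by rewrite -ltnS sE -[X in (X < _)%N]add0n ltn_add2r.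
split=> //; apply/eqP; rewrite -(eqn_add2r m) -sE addSn subnK //.
Qed.

(** If [sw] holds, the cofactor of f has degree l - d = n e + i and exponents in that class, so it
    is a stretched polynomial; its own cofactor is f, and [stretch_dvd] applies to it. *)
Lemma deform_poly_param f : deform_poly f ->
  exists c, parametrizes c f /\ tuple_mx c ^+ a = 0.
Proof.
case=> fm sf hf [q E]; rewrite /parametrizes; case: sw dE => dE'.
  have [qm sq dl] := cofactor_monic fm sf E.
  have dn : (l - d = n * e + i)%N by rewrite dE' subKn.
  rewrite dn in sq.
  have hq : congr_exp e (n * e + i) q.
    move=> j qj; have := cofactor_congr_exp fm sf E hf qj.
    rewrite -[in X in _ = X -> _](subnK nl) -dE' (addnC d) => /eqP.
    by rewrite eqn_modDr => /eqP.
  have [c qE] := stretch_surj ie qm sq hq.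
  exists c; rewrite -qE E mulrC; split=> //; apply/tuple_mx_exp_eq0.
  by apply/(stretch_dvd ie c a re); exists f; rewrite -lE E mulrC qE.
rewrite dE' in sf hf; have [c fE] := stretch_surj ie fm sf hf.
exists c; split=> //; apply/tuple_mx_exp_eq0.
by apply/(stretch_dvd ie c a re); exists q; rewrite -lE E fE.
Qed.

Lemma param_deform_poly c : tuple_mx c ^+ a = 0 ->
  exists f, parametrizes c f /\ deform_poly f.
Proof.
move/tuple_mx_exp_eq0/(stretch_dvd ie c a re); rewrite -lE => -[q E].
have [sm ss] := stretch_monic ie c.
have sc : congr_exp e (n * e + i) (stretch e i c) by apply: stretch_congr_exp.
rewrite /parametrizes /deform_poly; case: sw dE => dE'; last first.
  by exists (stretch e i c); rewrite dE'; split=> //; split=> //; exists q.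
have [qm sq _] := cofactor_monic sm ss E.
exists q; rewrite dE'; split=> //; split=> // [j qj|]; last first.
  by exists (stretch e i c); rewrite E mulrC.
have := cofactor_congr_exp sm ss E sc qj.
by rewrite -[in X in _ = X -> _](subnK nl) => /eqP; rewrite eqn_modDr => /eqP.
Qed.

Lemma parametrizes_fun c f f' :
  parametrizes c f -> parametrizes c f' -> f = f'.
Proof.
rewrite /parametrizes; case: sw => [-> E|-> ->] //.
have [sm _] := stretch_monic ie c.
by apply: (monic_lreg sm); rewrite /= mulrC E mulrC.
Qed.

Lemma parametrizes_inj f c c' : f \is monic ->
  parametrizes c f -> parametrizes c' f -> c =1 c'.
Proof.
rewrite /parametrizes => fm; case: sw => [-> E|-> E]; apply: (stretch_inj ie) => //.
exact: (monic_lreg fm).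
Qed.

Lemma parametrizes_map (R' : comNzRingType) (phi : {rmorphism R -> R'}) c f :
  parametrizes c f -> parametrizes (fun s => phi (c s)) (map_poly phi f).
Proof.
rewrite /parametrizes -map_stretch; case: sw => [E|->] //.
by rewrite -rmorphM -E /= map_polyXn.
Qed.

End Parametrization.

(** * The ring k[[t_1,...,t_n]]/J_n(a) *)

Section PowerSeriesConstantTerm.
Variables (k : fieldType) (n : nat).

Definition mps_ct (f : mps k n) : k := f 0%MM.

Fact mps_ct_zmod : zmod_morphism mps_ct. Proof. by []. Qed.

Fact mps_ct_monoid : monoid_morphism mps_ct.
Proof.
split=> [|f g]; first by rewrite /mps_ct -[LHS]/(mps_const 1 0%MM : k)
  /mps_const /= eqxx.
rewrite /mps_ct [LHS](mps_mulE f g (ltnSn _)) mdeg0.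
by rewrite (rmorphM (mcoeff 0%MM)) /= !mps_truncP ?mdeg0.
Qed.

HB.instance Definition _ := GRing.isZmodMorphism.Build (mps k n) k mps_ct
  mps_ct_zmod.
HB.instance Definition _ :=
  GRing.isMonoidMorphism.Build (mps k n) k mps_ct mps_ct_monoid.

Lemma map_Nmx (S : comNzRingType) (phi : {rmorphism mps k n -> S}) :
  map_mx phi (Nmx k n) = tuple_mx (fun s => phi (mps_var k s)).
Proof.
by apply/matrixP => i j; rewrite !mxE; case: ifP => // _; rewrite rmorph_nat.
Qed.

(** At t = 0 the polynomial [tuple_poly] is X^n, which divides X^a because n <= a; so the origin
    satisfies the equations of J_n(a). *)
Lemma Jideal_ct a f : (n <= a)%N -> Jideal a f -> mps_ct f = 0.
Proof.
move=> na Jf.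
have N0 : tuple_mx (fun s : 'I_n => mps_ct (mps_var k s)) ^+ a = 0.
  apply/tuple_mx_exp_eq0; exists 'X^(a - n).
  rewrite /tuple_poly big1 ?subr0 -?exprD ?subnK // => j _.
  by rewrite /mps_ct /mps_var eq_sym mnm1_eq0 scale0r.
move: f Jf; apply: ideal_gen_min => [|_ [i [j ->]]].
  split=> [|x y x0 y0|x y z z0]; first exact: rmorph0.
    by rewrite rmorphD /= x0 y0 addr0.
  by rewrite !rmorphM /= z0 mulr0 mul0r.
have NX b : map_mx mps_ct (Nmx k n ^+ b) = tuple_mx (fun s => mps_ct (mps_var k
  s)) ^+ b.
  by elim: b => [|b IH]; rewrite ?map_mx1 // !exprS map_mxM IH map_Nmx.
by have /matrixP/(_ i j) := NX a; rewrite N0 !mxE.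
Qed.

End PowerSeriesConstantTerm.

(** The proof [na] is an argument of the type so that the structure of a nonzero ring, which fails
    for a < n, can be attached to it canonically. *)
Definition versal_ring (k : fieldType) (n a : nat) (na : (n <= a)%N) : Type :=
  algquot (@Jideal k n a).

Section VersalRing.
Variables (k : fieldType) (n a : nat) (na : (n <= a)%N).
Local Notation B := (versal_ring k na).

HB.instance Definition _ := GRing.PzRing.copy B (algquot (@Jideal k n a)).

Fact versal_ring_mulC : commutative (@GRing.mul B).
Proof.
move=> u v; have [x ->] := qproj_surj u; have [y ->] := qproj_surj v.
by rewrite -[LHS](rmorphM (qproj (@Jideal k n a))) mulrC [LHS]rmorphM.
Qed.

HB.instance Definition _ :=
  GRing.PzRing_hasCommutativeMul.Build B versal_ring_mulC.

Fact versal_ring_neq0 : (1 : B) != 0.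
Proof.
apply/eqP => E; have /qproj_eq : qproj (@Jideal k n a) 1 = qproj _ 0 by rewrite
  raddf0; exact: E.
rewrite subr0 => J1.
have : mps_ct (1 : mps k n) = 0.
  apply: (ideal_gen_min (I := fun f => mps_ct f = 0) _ _ J1) => [|f]; last first.
    exact: Jideal_ct.
  split=> [|x y x0 y0|x y z z0]; first exact: rmorph0.
    by rewrite rmorphD /= x0 y0 addr0.
  by rewrite !rmorphM /= z0 mulr0 mul0r.
by move/eqP; rewrite rmorph1 oner_eq0.
Qed.

HB.instance Definition _ := GRing.PzSemiRing_isNonZero.Build B versal_ring_neq0.

Definition versal_proj (f : mps k n) : B := qproj (@Jideal k n a) f.

HB.instance Definition _ :=
  GRing.isZmodMorphism.Build (mps k n) B versal_proj (qproj_is_zmod _).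
HB.instance Definition _ :=
  GRing.isMonoidMorphism.Build (mps k n) B versal_proj (qproj_is_monoid _).

Lemma versal_proj_surj (u : B) : exists f, u = versal_proj f.
Proof. exact: qproj_surj. Qed.

Lemma versal_proj_eq f g :
  versal_proj f = versal_proj g <-> ideal_gen (@Jideal k n a) (f - g).
Proof. exact: qproj_eq. Qed.

Definition versal_scale (c : k) (u : B) : B := versal_proj (kin c) * u.

Fact versal_scaleA c d u :
  versal_scale c (versal_scale d u) = versal_scale (c * d) u.
Proof.
by rewrite /versal_scale mulrA -rmorphM /= -(rmorphM kin).
Qed.

Fact versal_scale1 : left_id 1 versal_scale.
Proof. by move=> u; rewrite /versal_scale (rmorph1 kin) rmorph1 mul1r. Qed.

Fact versal_scaleDr : right_distributive versal_scale +%R.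
Proof. by move=> c u v; rewrite /versal_scale mulrDr. Qed.

Fact versal_scaleDl u : {morph versal_scale^~ u : c d / c + d}.
Proof.
by move=> c d; rewrite /versal_scale (rmorphD kin) rmorphD mulrDl.
Qed.

HB.instance Definition _ := GRing.Zmodule_isLmodule.Build k B
  versal_scaleA versal_scale1 versal_scaleDr versal_scaleDl.

Fact versal_scaleAl (c : k) (u v : B) : c *: (u * v) = (c *: u) * v.
Proof. exact: mulrA. Qed.

HB.instance Definition _ := GRing.Lmodule_isLalgebra.Build k B versal_scaleAl.
HB.instance Definition _ := GRing.Lalgebra_isComAlgebra.Build k B.

Lemma versal_proj_const c : versal_proj (mps_const c) = c%:A.
Proof. by rewrite -[RHS]/(versal_proj (kin c) * 1) mulr1. Qed.

End VersalRing.

Section PowerSeriesOrder.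
Variables (k : fieldType) (n : nat).
Implicit Types (f g : mps k n) (p q : {mpoly k[n]}).

(** The order of vanishing of f at the origin is at least d. *)
Definition mps_ord d f := forall m : 'X_{1..n}, (mdeg m < d)%N -> f m = 0.

Lemma mps_ordM i j f g : mps_ord i f -> mps_ord j g -> mps_ord (i + j) (f * g).
Proof.
move=> fi gj m lt; rewrite [LHS]big1 // => -[[a ?] [b ?]] /= /eqP mE.
have [ai|ia] := ltnP (mdeg a) i; first by rewrite fi ?mul0r.
rewrite gj ?mulr0 //; move: lt; rewrite mE mdegD => lt.
by rewrite -(ltn_add2l i) (leq_ltn_trans _ lt) // leq_add2r.
Qed.

Lemma mps_ord1 f : mps_ord 1 f <-> mps_ct f = 0.
Proof.
split=> [f1|f0 m]; first by apply: f1; rewrite mdeg0.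
by rewrite ltnS leqn0 mdeg_eq0 => /eqP ->.
Qed.

Definition mps_of_mpoly p : mps k n := fun m => p@_m.

Fact mps_of_mpoly_zmod : zmod_morphism mps_of_mpoly.
Proof. by move=> p q; apply: mpsP => m; rewrite /mps_of_mpoly mcoeffB. Qed.

Fact mps_of_mpoly_monoid : monoid_morphism mps_of_mpoly.
Proof.
split=> [|p q]; apply: mpsP => m.
  by rewrite /mps_of_mpoly mcoeff1 -[RHS]/(mps_const 1 m).
by rewrite /mps_of_mpoly (mps_mul_trunc (f := mps_of_mpoly p) (g :=
  mps_of_mpoly q) _ _ (ltnSn _)).
Qed.

HB.instance Definition _ :=
  GRing.isZmodMorphism.Build {mpoly k[n]} (mps k n) mps_of_mpoly mps_of_mpoly_zmod.
HB.instance Definition _ :=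
  GRing.isMonoidMorphism.Build {mpoly k[n]} (mps k n) mps_of_mpoly
    mps_of_mpoly_monoid.

Lemma mps_of_mpolyC c : mps_of_mpoly c%:MP = kin c.
Proof.
apply: mpsP => m; rewrite /mps_of_mpoly mcoeffC -[RHS]/(mps_const c m).
by rewrite /mps_const mulr_natr.
Qed.

Lemma mps_of_mpolyX (i : 'I_n) : mps_of_mpoly 'X_i = mps_var k i.
Proof. by apply: mpsP => m; rewrite /mps_of_mpoly mcoeffX eq_sym. Qed.

Lemma mps_mulX (u m : 'X_{1..n}) f :
  (mps_of_mpoly 'X_[u] * f) m = if (u <= m)%MM then f (m - u)%MM else 0.
Proof.
rewrite -[LHS](mps_mul_trunc (fun _ _ => erefl) (@mps_truncP k n _ f) (ltnSn _)).
rewrite mulrC; have [um|num] := boolP (u <= m)%MM.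
  by rewrite -[in LHS](submK um) addmC mcoeffMX mps_truncP // mdegD ltnS leq_addl.
apply: contraNeq num; rewrite -mcoeff_msupp (perm_mem (msuppMX _ _)).
by case/mapP => v _ ->; apply: lem_addr.
Qed.

(** Every monomial other than 1 is charged to a single variable dividing it, the one chosen by [ix];
    g_i collects the monomials charged to t_i, divided by t_i. *)
Lemma mps_ord_split d f : mps_ord d.+1 f ->
  exists2 g : 'I_n -> mps k n, forall i, mps_ord d (g i)
    & f = \sum_i mps_var k i * g i.
Proof.
move=> fd; pose ix (m : 'X_{1..n}) := [pick i | (0 < m i)%N].
exists (fun i m => if ix (m + U_(i))%MM == Some i then f (m + U_(i))%MM else 0).
  by move=> i m lt; case: ifP => // _; apply: fd; rewrite mdegD mdeg1 addn1 ltnS.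
have sumE (h : 'I_n -> mps k n) m : (\sum_i h i) m = \sum_i h i m.
  by elim/big_rec2: _ => // i x y _ <-.
apply: mpsP => m; rewrite sumE.
under eq_bigr => i _ do rewrite -mps_of_mpolyX mps_mulX.
case E: (ix m) => [i|]; last first.
  have m0 : m = 0%MM.
    apply/mnmP => i; rewrite mnm0E; apply/eqP; rewrite -leqn0 leqNgt.
    by move: E; rewrite /ix; case: pickP => // /(_ i) ->.
  rewrite fd ?m0 ?mdeg0 // big1 // => i _; case: ifP => //.
  by move/mnm_lepP/(_ i); rewrite mnm0E mnm1E eqxx.
have mi : (U_(i) <= m)%MM.
  apply/mnm_lepP => j; rewrite mnm1E; case: eqP => // <-.
  by move: E; rewrite /ix; case: pickP => // j' h [<-].
rewrite (bigD1 i) //= mi submK // E eqxx big1 ?addr0 // => j ji.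
case: ifP => // mj; rewrite submK // E; case: eqP => // -[ij].
by rewrite ij eqxx in ji.
Qed.

End PowerSeriesOrder.

(** * Power series at nilpotent elements *)

Section NilpotentEvaluation.
Variables (k : fieldType) (n : nat).

Lemma prod_nilp (A : comPzRingType) (x : 'I_n -> A) K (m : 'X_{1..n}) :
  (forall i, x i ^+ K = 0) -> (n * K < mdeg m)%N -> \prod_i x i ^+ m i = 0.
Proof.
move=> xK lt; case: (pickP (fun i => K <= m i)%N) => [i Ki|no].
  by rewrite (bigD1 i) //= -(subnK Ki) exprD xK mulr0 mul0r.
move: lt; rewrite ltnNge mdegE => /negP[].
have -> : (n * K = \sum_(i < n) K)%N by rewrite sum_nat_const card_ord.
by apply: leq_sum => i _; rewrite ltnW // ltnNge no.
Qed.

(** No continuity of [psi] is assumed. Variables are split off the series one at a time and moved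
    into a monomial, until its degree exceeds n K; then some variable occurs at least K times in
    it. *)
Lemma mps_ord_nilp (A : comPzRingType) (psi : {rmorphism mps k n -> A}) K f :
  (forall i, psi (mps_var k i) ^+ K = 0) -> mps_ord (n * K).+1 f -> psi f = 0.
Proof.
move=> xK.
suff H d (m : 'X_{1..n}) g : (n * K < d + mdeg m)%N -> mps_ord d g ->
    psi (mps_of_mpoly 'X_[m]) * psi g = 0.
  move=> fo; have := H (n * K).+1 0%MM f; rewrite mpolyX0 !rmorph1 mul1r;
    apply=> //.
  by rewrite mdeg0 addn0.
elim: d m g => [|d IH] m h lt fo.
  rewrite mpolyXE_id rmorph_prod rmorph_prod /=.
  under eq_bigr => i _ do rewrite rmorphXn rmorphXn /= mps_of_mpolyX.
  by rewrite (prod_nilp xK) ?mul0r.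
have [g go ->] := mps_ord_split fo; rewrite rmorph_sum mulr_sumr big1 // => i _.
rewrite -mps_of_mpolyX -rmorphM mulrA -rmorphM -mpolyXD rmorphM; apply: IH => //.
by rewrite mdegD mdeg1 addn1 addnS -addSn.
Qed.

Variables (R : comAlgType k) (c : 'I_n -> R) (K : nat).
Hypothesis cK : forall i, c i ^+ K = 0.

Definition mps_eval (f : mps k n) : R :=
  mmap (GRing.in_alg R) c (mps_trunc (n * K).+2 f).

Lemma mmap_nilp (p : {mpoly k[n]}) :
  (forall m, (mdeg m < (n * K).+2)%N -> p@_m = 0) -> mmap (GRing.in_alg R) c p = 0.
Proof.
move=> p0; rewrite /mmap big1 // => m _.
have [lt|ge] := ltnP (mdeg m) (n * K).+2; first by rewrite p0 // rmorph0 mul0r.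
by rewrite /mmap1 (prod_nilp cK) ?mulr0 // (leq_trans _ ge).
Qed.

(** Truncation is not multiplicative, but the product of two truncations agrees with the product
    series below the cut. So the freedom in the choice of p makes evaluation a ring morphism. *)
Lemma mps_evalE f p :
  (forall m, (mdeg m < (n * K).+2)%N -> p@_m = f m) ->
  mps_eval f = mmap (GRing.in_alg R) c p.
Proof.
move=> pf; apply/eqP; rewrite /mps_eval -subr_eq0 -mmapB; apply/eqP/mmap_nilp
  => m lt.
by rewrite mcoeffB pf // mps_truncP // subrr.
Qed.

Fact mps_eval_zmod : zmod_morphism mps_eval.
Proof.
move=> f g; rewrite -mmapB; apply: mps_evalE => m lt.
by rewrite mcoeffB !mps_truncP.
Qed.

Fact mps_eval_monoid : monoid_morphism mps_eval.
Proof.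
split=> [|f g].
  rewrite (@mps_evalE _ 1) ?rmorph1 // => m _; rewrite mcoeff1.
  by rewrite -[RHS]/(mps_const 1 m).
rewrite -rmorphM; apply: mps_evalE => m lt.
by apply: mps_mul_trunc lt => m' lt'; apply: mps_truncP.
Qed.

Lemma mps_evalX i : mps_eval (mps_var k i) = c i.
Proof.
rewrite (@mps_evalE _ 'X_i) ?mmapX ?mmap1U // => m _.
by rewrite -[RHS]/(mps_var k i m) -mps_of_mpolyX.
Qed.

Lemma mps_evalC (a : k) : mps_eval (kin a) = a%:A.
Proof.
by rewrite (@mps_evalE _ a%:MP) ?mmapC // => m _; rewrite -mps_of_mpolyC.
Qed.

End NilpotentEvaluation.

(** Among the matrices with rows in W one of maximal rank is taken: a vector of W outside its row
    space would raise the rank. *)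
Lemma subspace_row_space (k : fieldType) N (W : 'rV[k]_N -> Prop) :
  W 0 -> (forall c u v, W u -> W v -> W (c *: u + v)) ->
  exists G : 'M[k]_N, forall w, W w <-> (w <= G)%MS.
Proof.
move=> W0 WL.
have Wsub m (A : 'M[k]_(m, N)) w : (forall i, W (row i A)) -> (w <= A)%MS -> W w.
  move=> WA /submxP[u ->]; rewrite mulmx_sum_row.
  by elim/big_rec: _ => // i x _ Wx; apply: WL.
pose P (r : nat) := `[< exists2 G : 'M[k]_N, (forall i, W (row i G)) & \rank G
  = r >].
have P0 : exists r, P r.
  exists 0%N; apply/asboolP; exists 0 => [i|]; last exact: mxrank0.
  by rewrite row0.
have PN r : P r -> (r <= N)%N by case/asboolP => G _ <-; apply: rank_leq_row.
have [r /asboolP[G WG rG] rmax] := ex_maxnP P0 PN.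
exists G => w; split; last exact: Wsub.
move=> Ww; apply/negPn/negP => nw.
have WA i : W (row i (col_mx G w)).
  rewrite -[i]fintype.splitK; case: (fintype.split i) => j /=.
    by rewrite rowKu.
  rewrite rowKd; suff -> : row j w = w by [].
  by apply/rowP => z; rewrite !mxE ord1.
have lt : (G < col_mx G w)%MS.
  have Gc : (G <= col_mx G w)%MS by rewrite -addsmxE addsmxSl.
  have wc : (w <= col_mx G w)%MS by rewrite -addsmxE addsmxSr.
  by rewrite ltmxE Gc; apply: contra nw; apply: submx_trans.
have /rmax : P (\rank (col_mx G w)).
  (* The N + 1 rows are traded for N rows with the same span, since [P] speaks of square
     matrices. *)
  apply/asboolP; exists <<col_mx G w>>%MS; last exact: mxrank_gen.
  by move=> i; apply: Wsub WA _; rewrite -(genmxE (col_mx G w)) row_sub.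
by rewrite leqNgt -rG rank_ltmx.
Qed.

(** An ideal is a subspace; pulled back along the spanning family it is a row space, and the rows
    give finitely many generators. *)
Lemma fin_dim_noetherian (k : fieldType) (A : comAlgType k) N (b : 'I_N -> A) :
  (forall x, exists c : 'rV[k]_N, x = \sum_i c 0 i *: b i) -> noetherian A.
Proof.
move=> bA I II; have [I0 ID IM] := II.
have IZ (c : k) x : I x -> I (c *: x).
  by move=> Ix; rewrite -[c *: x]mulr1 -mulr_algl; apply: IM.
have [||G WG] := subspace_row_space (W := fun c : 'rV[k]_N => I (\sum_i c 0 i
  *: b i)).
- by rewrite big1 // => i _; rewrite mxE scale0r.
- move=> c u v Iu Iv; rewrite (eq_bigr (fun i => c *: (u 0 i *: b i) + v 0 i *:
  b i)).
    by rewrite big_split -scaler_sumr; apply: ID => //; apply: IZ.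
  by move=> i _; rewrite !mxE scalerDl scalerA.
pose g i := \sum_j G i j *: b j.
exists [seq g i | i <- enum 'I_N] => x; split; last first.
  apply: ideal_gen_min => // y /mapP[i _ ->].
  have /WG := row_sub i G; congr I; apply: eq_bigr => j _; by rewrite mxE.
have [c ->] := bA x; move/WG/submxP => [u ->].
exists [seq ((u 0 i)%:A, g i, 1) | i <- enum 'I_N]; split.
  by move=> t /mapP[i _ ->] /=; apply: map_f; rewrite mem_enum.
rewrite big_map big_enum /=.
under [RHS]eq_bigr => i _ do rewrite mulr1 mulr_algl scaler_sumr.
rewrite exchange_big; apply: eq_bigr => j _.
rewrite mxE scaler_suml; apply: eq_bigr => i _.
by rewrite scalerA.
Qed.

(** * The quotient by J_n(a) as a complete local algebra *)

Section VersalChat.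
Variables (k : fieldType) (n a : nat) (na : (n <= a)%N).
Local Notation B := (versal_ring k na).
Local Notation pr := (versal_proj (k := k) na).

Definition versal_param (s : 'I_n) : B := pr (mps_var k s).

Lemma versal_param_exp : tuple_mx versal_param ^+ a = 0.
Proof.
have NX b : map_mx pr (Nmx k n ^+ b) = tuple_mx versal_param ^+ b.
  by elim: b => [|b IH]; rewrite ?map_mx1 // !exprS map_mxM IH map_Nmx.
rewrite -NX; apply/matrixP => i j; rewrite !mxE -(rmorph0 pr).
(* Two memberships are needed: the quotient is by the ideal generated by [Jideal], which is itself
   given by generators. *)
apply/versal_proj_eq/mem_ideal_gen; rewrite subr0.
by apply: mem_ideal_gen; exists i, j.
Qed.

(** This is why a point c reduces to 0 in the residue field without that being imposed, and why
    power series are evaluated at c by finite sums. *)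
Lemma tuple_nilp (R : comNzRingType) (c : 'I_n -> R) : tuple_mx c ^+ a = 0 ->
  exists K, forall s, c s ^+ K = 0.
Proof.
case/tuple_mx_exp_eq0 => q E.
have cn s : exists K, c s ^+ K = 0.
  have := coef_dvdXn_nilp (tuple_poly_monic c) E (j := rev_ord s).
  rewrite size_tuple_poly coef_tuple_poly rev_ordK => /(_ (ltn_ord _))[K cK].
  by exists K; have := cK; rewrite exprNn => /(congr1 ( *%R ((-1) ^+ K)));
    rewrite mulrA -exprMn mulrNN mulr1 expr1n mul1r mulr0.
have [K cK] := choice cn.
exists (\sum_s K s)%N => s.
by rewrite (bigD1 s) //= exprD cK mul0r.
Qed.

Lemma versal_nilp : exists D, forall f, mps_ord D f -> pr f = 0.
Proof.
have [K cK] := tuple_nilp versal_param_exp.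
by exists (n * K).+1 => f; apply: mps_ord_nilp.
Qed.

Definition versal_residue (u : B) : k^o := mps_ct (repr (u : algquot _)).

Lemma versal_residueE f : versal_residue (pr f) = mps_ct f.
Proof.
apply/eqP; rewrite -subr_eq0 -[X in X == 0](rmorphB (@mps_ct k n)); apply/eqP.
have : ideal_gen (@Jideal k n a) (repr (pr f : algquot _) - f).
  by apply/(versal_proj_eq na); rewrite /versal_proj /qproj reprK.
apply: (ideal_gen_min (I := fun f => mps_ct f = 0)) => [|x]; last exact: Jideal_ct.
split=> [|x y x0 y0|x y z z0]; first exact: rmorph0.
  by rewrite rmorphD /= x0 y0 addr0.
by rewrite !rmorphM /= z0 mulr0 mul0r.
Qed.

Fact versal_residue_zmod : zmod_morphism versal_residue.
Proof.
move=> u v; have [f ->] := versal_proj_surj u; have [g ->] := versal_proj_surj v.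
by rewrite -rmorphB !versal_residueE rmorphB.
Qed.

Fact versal_residue_monoid : monoid_morphism versal_residue.
Proof.
split=> [|u v]; first by rewrite -(rmorph1 pr) versal_residueE rmorph1.
have [f ->] := versal_proj_surj u; have [g ->] := versal_proj_surj v.
by rewrite -rmorphM !versal_residueE rmorphM.
Qed.

Fact versal_residue_scalable : scalable versal_residue.
Proof.
move=> c u; rewrite -mulr_algl versal_residue_monoid.2 -versal_proj_const.
rewrite versal_residueE; congr (_ * _).
by rewrite -[LHS]/(mps_const c 0%MM) /mps_const eqxx.
Qed.

HB.instance Definition _ :=
  GRing.isZmodMorphism.Build B k^o versal_residue versal_residue_zmod.
HB.instance Definition _ :=
  GRing.isMonoidMorphism.Build B k^o versal_residue versal_residue_monoid.
HB.instance Definition _ :=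
  GRing.isScalable.Build k B k^o *:%R versal_residue versal_residue_scalable.

Lemma versal_residue_ord1 u : versal_residue u = 0 ->
  exists2 f, mps_ord 1 f & u = pr f.
Proof.
have [f ->] := versal_proj_surj u; rewrite versal_residueE => f0.
by exists f => //; apply/mps_ord1.
Qed.

Lemma versal_max_pow_ord j u : ideal_pow (fun y => versal_residue y = 0) j u ->
  exists2 f, mps_ord j f & u = pr f.
Proof.
have ordD m f g : mps_ord m f -> mps_ord m g -> mps_ord m (f + g).
  by move=> fm gm t lt; rewrite -[LHS]/(f t + g t) fm ?gm ?addr0.
have ordM m f g : mps_ord m f -> mps_ord m (g * f).
  by move=> fm; rewrite -[m]add0n; apply: mps_ordM.
case=> s [sP ->]; rewrite big_seq; elim/big_rec: _ => [|t u' /sP tP [f fj ->]].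
  by exists 0; rewrite ?rmorph0.
suff [g gj ->] : exists2 g, mps_ord j g & t.1.2 = pr g.
  have [x ->] := versal_proj_surj t.1.1; have [y ->] := versal_proj_surj t.2.
  exists (x * g * y + f); last by rewrite rmorphD !rmorphM.
  by apply: ordD => //; rewrite mulrC; apply/ordM/ordM.
case: tP => r [<- rP ->] {sP}; elim: r rP => [|y r IH] rP.
  by exists 1; rewrite ?big_nil ?rmorph1.
have [g gr gE] := IH (fun z zr => rP z (mem_behead (s := y :: r) zr)).
have [h h1 hE] := versal_residue_ord1 (rP y (mem_head _ _)).
exists (h * g); last by rewrite big_cons gE hE rmorphM.
by rewrite -[size _]add1n; apply: mps_ordM.
Qed.

Lemma versal_max_pow_eq0 : exists D, forall u : B,
  ideal_pow (fun y => versal_residue y = 0) D u -> u = 0.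
Proof.
have [D D0] := versal_nilp; exists D => u /versal_max_pow_ord[f fD ->].
exact: D0.
Qed.

End VersalChat.

Lemma nilp_unit (A : comPzRingType) (y : A) D : y ^+ D = 0 ->
  exists z, (1 - y) * z = 1.
Proof.
move=> yD; exists (\sum_(i < D) 1 ^+ (D.-1 - i) * y ^+ i).
by rewrite -subrXX yD expr1n subr0.
Qed.

Lemma mem_products (A : pzRingType) (S : A -> Prop) y D :
  S y -> products S D (y ^+ D).
Proof.
move=> Sy; exists (nseq D y); split; first exact: size_nseq.
  by move=> z; rewrite mem_nseq => /andP[_ /eqP ->].
by rewrite big_nseq -Monoid.iteropE.
Qed.

Section VersalChatStructure.
Variables (k : fieldType) (n a : nat) (na : (n <= a)%N).
Local Notation B := (versal_ring k na).
Local Notation pr := (versal_proj (k := k) na).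
Local Notation res := (@versal_residue k n a na).

(** A series differs from its truncation by a series of order D, which dies in the quotient; so the
    quotient is finite dimensional. *)
Lemma versal_polynomial : exists D, forall f,
  pr f = \sum_(m : 'X_{1..n < D}) f m *: pr (mps_of_mpoly 'X_[m]).
Proof.
have [D D0] := versal_nilp k na; exists D => f.
have -> : pr f = pr (mps_of_mpoly (mps_trunc D f)).
  apply/eqP; rewrite -subr_eq0 -rmorphB /= D0 // => m lt.
  by rewrite -[LHS]/(f m - (mps_trunc D f)@_m) mps_truncP // subrr.
rewrite /mps_trunc !raddf_sum /=; apply: eq_bigr => m _.
by rewrite -mul_mpolyC rmorphM /= mps_of_mpolyC rmorphM.
Qed.

Lemma versal_ext (A : comAlgType k) (phi psi : {lrmorphism B -> A}) :
  (forall s, phi (versal_param k na s) = psi (versal_param k na s)) -> phi =1 psi.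
Proof.
move=> E u; have [D uE] := versal_polynomial.
have [f ->] := versal_proj_surj u; rewrite uE !linear_sum; apply: eq_bigr => m _.
rewrite !linearZ /=; congr (_ *: _); rewrite mpolyXE_id !rmorph_prod.
apply: eq_bigr => s _; rewrite !rmorphXn /= mps_of_mpolyX; congr (_ ^+ _).
exact: E.
Qed.

Fact versal_local (x : B) : res x <> 0 <-> exists y, x * y = 1.
Proof.
split=> [/eqP x0|[y e] x0]; last first.
  have := congr1 res e; rewrite rmorphM /= x0 mul0r rmorph1 => /eqP.
  by rewrite eq_sym oner_eq0.
have [D D0] := versal_max_pow_eq0 k na.
have y0 : res (1 - (res x : k)^-1 *: x) = 0.
  by rewrite rmorphB rmorph1 [X in _ - X]versal_residue_scalable [_ *: _]mulVf
    ?subrr.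
have [|z] := @nilp_unit B (1 - (res x : k)^-1 *: x) D.
  by apply/D0/mem_ideal_gen/mem_products.
rewrite opprB addrC subrK => E; exists ((res x : k)^-1 *: z).
by rewrite -scalerAr scalerAl.
Qed.

Fact versal_noetherian : noetherian B.
Proof.
have [D uE] := versal_polynomial.
pose T : finType := 'X_{1..n < D}; pose mon (i : 'I_#|T|) : T := enum_val i.
apply: (fin_dim_noetherian (b := fun i => pr (mps_of_mpoly 'X_[mon i]))) => u.
have [f ->] := versal_proj_surj u; exists (\row_i f (mon i)).
rewrite uE (reindex mon) /=; last exact/onW_bij/enum_val_bij.
by apply: eq_bigr => i _; rewrite mxE.
Qed.

Fact versal_separated (x : B) :
  (forall m, ideal_pow (fun y => res y = 0) m x) -> x = 0.
Proof. by have [D D0] := versal_max_pow_eq0 k na; move/(_ D)/D0. Qed.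

Fact versal_complete (u : nat -> B) :
  (forall m, ideal_pow (fun y => res y = 0) m (u m.+1 - u m)) ->
  exists x, forall m, ideal_pow (fun y => res y = 0) m (x - u m).
Proof.
move=> uC; have [D D0] := versal_max_pow_eq0 k na.
have II m : is_ideal (ideal_pow (fun y => res y = 0) m) by apply:
  ideal_gen_is_ideal.
have powS m j x : ideal_pow (fun y => res y = 0) (m + j) x ->
    ideal_pow (fun y => res y = 0) m x.
  have [_ _ IM] := II m; apply: ideal_gen_min => // _ [s [sz sP ->]].
  rewrite -(cat_take_drop m s) big_cat -[X in ideal_pow _ _ X]mul1r mulrA.
  apply: IM; apply: mem_ideal_gen; exists (take m s); split=> //.
    by rewrite size_takel // sz leq_addr.
  by move=> y /mem_take/sP.
have uE m : u (D + m)%N = u D.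
  elim: m => [|m IH]; first by rewrite addn0.
  rewrite addnS; apply/eqP; rewrite -IH -subr_eq0; apply/eqP/D0.
  exact: powS (uC _).
(* The D-th power of the maximal ideal is zero, so u is constant from D on. For m < D the difference
   to u m telescopes inside the m-th power. *)
exists (u D) => m.
have H j : ideal_pow (fun y => res y = 0) m (u (m + j)%N - u m).
  have [I0 ID _] := II m; elim: j => [|j IH]; first by rewrite addn0 subrr.
  rewrite addnS -(subrK (u (m + j)%N) (u _.+1)) -addrA; apply: ID => //.
  exact: powS (uC _).
have [Dm|mD] := leqP D m; last by have := H (D - m)%N; rewrite subnKC // ltnW.
by rewrite -[in u m](subnKC Dm) uE subrr; have [] := II m.
Qed.

Definition versal_chat : Chat k :=
  @MkChat k B res versal_local versal_noetherian versal_separated versal_complete.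

Lemma chat_nilp (R : Chat k) (x : R) K : x ^+ K = 0 -> residue R x = 0.
Proof.
move=> xK; apply/eqP; have := congr1 (residue R) xK.
rewrite rmorphXn rmorph0 => /eqP; rewrite expf_eq0 => /andP[_].
by [].
Qed.

Lemma residue_alg (R : Chat k) (c : k) : residue R c%:A = c.
Proof. by rewrite rmorph_alg [_%:A]mulr1. Qed.

(** Evaluation at c sends the entries of N_n^a to those of [tuple_mx c ^+ a], so it kills J_n(a) and
    descends to the quotient. *)
Lemma versal_hom (R : Chat k) (c : 'I_n -> R) : tuple_mx c ^+ a = 0 ->
  exists phi : Chat_hom versal_chat R, forall s, phi (versal_param k na s) = c s.
Proof.
move=> c0; have [K cK] := tuple_nilp c0.
pose ev := mps_eval c K.
pose evz : {rmorphism mps k n -> R} := HB.pack ev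
  (GRing.isZmodMorphism.Build _ _ ev (mps_eval_zmod cK))
  (GRing.isMonoidMorphism.Build _ _ ev (mps_eval_monoid cK)).
have evX s : evz (mps_var k s) = c s by apply: (mps_evalX cK).
have ev0 f : ideal_gen (@Jideal k n a) f -> evz f = 0.
  have EI : is_ideal (fun f => evz f = 0).
    split=> [|x y x0 y0|x y z z0]; first exact: rmorph0.
      by rewrite rmorphD x0 y0 addr0.
    by rewrite !rmorphM z0 mulr0 mul0r.
  apply: (ideal_gen_min EI) => g; apply: (ideal_gen_min EI) => _ [i [j ->]].
  have NX b : map_mx evz (Nmx k n ^+ b) = tuple_mx c ^+ b.
    elim: b => [|b IH]; rewrite ?map_mx1 // !exprS map_mxM IH map_Nmx.
    by congr (_ * _); apply/matrixP => i' j'; rewrite !mxE evX.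
  by have /matrixP/(_ i j) := NX a; rewrite c0 !mxE.
pose phi (u : B) : R := evz (repr (u : algquot _)).
have phiE f : phi (pr f) = evz f.
  apply/eqP; rewrite -subr_eq0 -rmorphB; apply/eqP/ev0.
  by apply/(versal_proj_eq na); rewrite /versal_proj /qproj reprK.
have phiB : zmod_morphism phi.
  move=> u v; have [f ->] := versal_proj_surj u; have [g ->] := versal_proj_surj v.
  by rewrite -rmorphB !phiE rmorphB.
have phiM : monoid_morphism phi.
  split=> [|u v]; first by rewrite -(rmorph1 pr) phiE rmorph1.
  have [f ->] := versal_proj_surj u; have [g ->] := versal_proj_surj v.
  by rewrite -rmorphM !phiE rmorphM.
have phiA (d : k) : phi d%:A = d%:A.
  by rewrite -versal_proj_const phiE; apply: (mps_evalC cK).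
have phiZ : scalable phi.
  by move=> d u; rewrite -mulr_algl phiM.2 phiA mulr_algl.
pose F : {lrmorphism versal_chat -> R} := HB.pack phi
  (GRing.isZmodMorphism.Build B R phi phiB)
  (GRing.isMonoidMorphism.Build B R phi phiM)
  (GRing.isScalable.Build k B R *:%R phi phiZ).
(* An element minus its residue is nilpotent in the quotient, hence so is its image in R, and
   nilpotent elements have residue 0. *)
have Fres (x : versal_chat) : residue R (F x) = residue versal_chat x.
  have [D D0] := versal_max_pow_eq0 k na.
  have y0 : res (x - (res x : k)%:A) = 0.
    rewrite versal_residue_zmod versal_residue_scalable (@versal_residue_monoid
      k n a na).1.
    by rewrite [_ *: _]mulr1 subrr.
  have yD : (x - (res x : k)%:A : B) ^+ D = 0.
    by apply/D0/mem_ideal_gen/mem_products.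
  have : residue R (F (x - (res x : k)%:A)) = 0.
    by apply: (@chat_nilp R _ D); rewrite -rmorphXn yD rmorph0.
  have -> : F (x - (res x : k)%:A) = F x - (res x : k)%:A by rewrite [LHS]phiB phiA.
  by rewrite rmorphB /= residue_alg => /eqP; rewrite subr_eq0 => /eqP.
have Fcont m : exists m', forall x : versal_chat,
    max_pow m' x -> max_pow m (F x).
  have [D D0] := versal_max_pow_eq0 k na; exists D => x /D0 ->.
  by rewrite rmorph0; have [] := ideal_gen_is_ideal (products (fun x => residue
    R x = 0) m).
exists (MkChatHom Fcont Fres) => s; rewrite -evX; exact: phiE.
Qed.

End VersalChatStructure.

(** * The algebra N(e,l) and its cyclic modules *)

(* The algebra [T] over [R] is spanned by the [X ^+ j * E b] with [j < l], where
   the [E b] are orthogonal idempotents and [X] maps the part at the vertex [b] to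
   the part at the next vertex.  Both [Nalg k e l] over [k] and [tensor_alg R _] over
   [R] are instances. *)
Record circular_alg (e l : nat) (R : comNzRingType) (T : pzRingType)
    (iota : {rmorphism R -> T}) (E : 'I_e -> T) (X : T) : Prop := {
  circ_central : forall r t, iota r * t = t * iota r;
  circ_orth : forall a b, E a * E b = if a == b then E a else 0;
  circ_sum : \sum_b E b = 1;
  circ_shift : forall b, X * E b = E (ordS b) * X;
  circ_nil : X ^+ l = 0;
  circ_span : forall t, exists c : 'I_e -> nat -> R,
    t = \sum_b \sum_(j < l) iota (c b j) * X ^+ j * E b
}.

Section NakayamaRelations.
Variables (k : fieldType) (e l : nat).
Local Notation Q := (circular_quiver e).
Local Notation PA := (path_alg k Q).

Definition vertex_path (b : 'I_e) : PA := path_elt k (@trivial_path Q b).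
Definition arrow_sum : PA := \sum_(b : 'I_e) path_elt k (@arrow_path Q b).

Lemma vertex_path_mul (b : 'I_e) p :
  vertex_path b * path_elt k p = if b == path_target p then path_elt k p else 0.
Proof. by rewrite [LHS]path_mulE path_comp1p; case: ifP. Qed.

Lemma arrow_sum_mul (p q : qpath Q) :
  val q = (path_source p, rcons (val p).2 (path_target p)) ->
  arrow_sum * path_elt k p = path_elt k q.
Proof.
move=> qE; rewrite /arrow_sum mulr_suml (bigD1 (path_target p)) //= big1 ?addr0.
  rewrite [LHS]path_mulE; have -> // : path_comp (@arrow_path Q (path_target
    p)) p = Some q.
  by apply/path_compP; rewrite qE -cats1.
move=> b /eqP nb; rewrite [LHS]path_mulE path_compN //.
Qed.

(** Exactly one arrow leaves each vertex of the circular quiver, so a path is determined by its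
    source and its length. *)
Lemma path_eltE (p : qpath Q) :
  path_elt k p = arrow_sum ^+ size (val p).2 * vertex_path (path_source p).
Proof.
case: p => -[v s] w; elim/last_ind: s w => [|s b IH] w.
  rewrite expr0 mul1r; congr path_elt; exact: val_inj.
have /andP[ws wb] : walk (v : vertex Q) s && walk (last v [seq target a | a <-
  s]) [:: b].
  by rewrite -walk_cat cats1.
have {wb} bE : b = last v [seq target a | a <- s] by move: wb; rewrite /= andbT
  => /eqP.
rewrite -[size _]/(size (rcons s b)) size_rcons exprS -mulrA.
rewrite -[path_source _]/(path_source (exist _ (v, s) ws : qpath Q)).
rewrite -[size s]/(size (val (exist _ (v, s) ws : qpath Q)).2) -IH.
by apply/esym/arrow_sum_mul; rewrite /= bE.
Qed.

Lemma vertex_path_orth (a b : 'I_e) :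
  vertex_path a * vertex_path b = if a == b then vertex_path a else 0.
Proof. by rewrite vertex_path_mul; case: eqP => // ->. Qed.

Lemma arrow_sum_shift (b : 'I_e) :
  arrow_sum * vertex_path b = vertex_path (ordS b) * arrow_sum.
Proof.
rewrite /arrow_sum mulr_suml mulr_sumr; apply: eq_bigr => a _.
rewrite vertex_path_mul [LHS]path_mulE path_compp1 -[path_target _]/(ordS a).
rewrite -[path_source _]/a (inj_eq (can_inj (@ordSK _))).
by case: ifP.
Qed.

Local Notation L := (Nalg k e l).
Local Notation pr := (qproj (ideal_pow (@arrow_ideal k Q) l)).

Definition vertex_elt (b : 'I_e) : L := pr (vertex_path b).
Definition arrow_elt : L := pr arrow_sum.

Lemma arrow_elt_nil : arrow_elt ^+ l = 0.
Proof.
rewrite -(rmorphXn pr) -(rmorph0 pr); apply/qproj_eq; rewrite subr0.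
apply/mem_ideal_gen/mem_ideal_gen/mem_products.
have [I0 ID _] := ideal_gen_is_ideal (fun x : PA => exists a : arrow Q, x =
  path_elt k (arrow_path a)).
rewrite /arrow_sum; apply: (big_ind (@arrow_ideal k Q)) => //.
by move=> b _; apply: mem_ideal_gen; exists b.
Qed.

Lemma Nalg_circular : circular_alg l (@kin k L : {rmorphism _ -> _}) vertex_elt
  arrow_elt.
Proof.
split=> [||||| u].
- exact: kin_central.
- move=> a b; rewrite -[LHS](rmorphM pr) vertex_path_orth; case: ifP => // _.
  exact: rmorph0.
- by rewrite -(rmorph_sum pr) -(rmorph1 pr).
- by move=> b; rewrite -[LHS](rmorphM pr) arrow_sum_shift [LHS]rmorphM.
- exact: arrow_elt_nil.
have nil := arrow_elt_nil.
have [x ->] := qproj_surj u; elim/path_alg_ind: x => [|p|x y [c xE] [d yE]|a x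
  [c xE]].
- exists (fun _ _ => 0); rewrite raddf0 big1 // => b _; rewrite big1 // => j _.
  by rewrite rmorph0 !mul0r.
- rewrite path_eltE; set m := size _; set v := path_source p.
  exists (fun b j => ((b == v) && (j == m))%:R).
  rewrite (bigD1 v) //= [X in _ + X]big1 ?addr0; last first.
    by move=> b /negbTE bv; rewrite big1 // => j _; rewrite bv rmorph0 !mul0r.
  have [ml|lm] := ltnP m l.
    rewrite (bigD1 (Ordinal ml)) //= big1 ?addr0 => [|j].
      by rewrite !eqxx rmorph1 mul1r rmorphM rmorphXn.
    by rewrite -val_eqE /= => /negbTE jm; rewrite jm andbF rmorph0 !mul0r.
  rewrite big1 => [|j _]; last first.
    by rewrite ltn_eqF ?andbF ?rmorph0 ?mul0r // (leq_trans (ltn_ord j)).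
  by rewrite rmorphM rmorphXn /= -(subnK lm) exprD nil mulr0 mul0r.
- exists (fun b j => c b j + d b j); rewrite raddfD /= xE yE -big_split.
  apply: eq_bigr => b _; rewrite -big_split; apply: eq_bigr => j _.
  by rewrite rmorphD !mulrDl.
- exists (fun b j => a * c b j).
  have -> : pr (a *: x) = kin a * pr x.
    rewrite -[RHS](rmorphM pr); congr qproj; rewrite -[RHS]/(path_mul (path_kin
      Q a) x).
    by rewrite path_mulZl path_mul1x.
  rewrite xE mulr_sumr; apply: eq_bigr => b _; rewrite mulr_sumr.
  by apply: eq_bigr => j _; rewrite rmorphM !mulrA.
Qed.

End NakayamaRelations.

(** * Cyclic modules and their polynomials *)

Section CircularModules.
Variables (e l : nat) (R : comNzRingType) (T : pzRingType).
Variables (iota : {rmorphism R -> T}) (E : 'I_e -> T) (X : T).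
Hypothesis H : circular_alg l iota E X.
Implicit Types (p q f : {poly R}) (a b : 'I_e).

Local Notation ev := (peval iota X).

Lemma iter_ordS_val a j : iter j (@ordS e) a = ((a + j) %% e)%N :> nat.
Proof.
elim: j => [|j IH] /=; first by rewrite addn0 modn_small.
by rewrite IH -addn1 modnDml -addnA addn1.
Qed.

Lemma iter_ordS_eq a i j :
  (iter i (@ordS e) a == iter j (@ordS e) a) = (i == j %[mod e])%N.
Proof. by rewrite -val_eqE /= !iter_ordS_val eqn_modDl. Qed.

Lemma circ_shiftX a j : X ^+ j * E a = E (iter j (@ordS e) a) * X ^+ j.
Proof.
elim: j => [|j IH]; first by rewrite mul1r mulr1.
by rewrite exprS -mulrA IH mulrA (circ_shift H) -mulrA.
Qed.

Lemma circ_pevalM p q : ev (p * q) = ev p * ev q.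
Proof. by apply: pevalM => c; apply: (circ_central H). Qed.

(** The terms of p whose exponent is the length of a path from a to b. *)
Definition vertex_part a b p : {poly R} :=
  \poly_(j < size p) (if iter j (@ordS e) a == b then p`_j else 0).

Lemma coef_vertex_part a b p j :
  (vertex_part a b p)`_j = if iter j (@ordS e) a == b then p`_j else 0.
Proof.
rewrite coef_poly; case: ltnP => // sj.
by rewrite nth_default // if_same.
Qed.

Lemma vertex_partE a b p : E b * ev p * E a = ev (vertex_part a b p) * E a.
Proof.
rewrite (peval_widen iota X (size_poly _ _)) /peval mulr_sumr !mulr_suml.
apply: eq_bigr => j _; rewrite coef_vertex_part mulrA -(circ_central H) -!mulrA
  circ_shiftX.
rewrite (mulrA (E b)) (circ_orth H) eq_sym; case: eqP => [<-|_].
  by rewrite -circ_shiftX.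
by rewrite rmorph0 !(mul0r, mulr0).
Qed.

Section Linear.
Variables (M M' : lmodType T) (g : M -> M').
Hypotheses (gD : forall x y, g (x + y) = g x + g y).
Hypotheses (gR : forall r x, g (iota r *: x) = iota r *: g x).
Hypotheses (gX : forall x, g (X *: x) = X *: g x).
Hypotheses (gE : forall b x, g (E b *: x) = E b *: g x).

Lemma circ_linear : exists h : {linear M -> M'}, forall x, h x = g x.
Proof.
have g0 : g 0 = 0 by apply: (addrI (g 0)); rewrite -gD !addr0.
have gS I (r : seq I) (F : I -> M) : g (\sum_(i <- r) F i) = \sum_(i <- r) g (F i).
  by elim/big_rec2: _ => // i x y _ <-; rewrite gD.
have gXn j x : g (X ^+ j *: x) = X ^+ j *: g x.
  by elim: j x => [|j IH] x; rewrite ?scale1r // exprS -!scalerA gX IH.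
have gT t x : g (t *: x) = t *: g x.
  have [c ->] := circ_span H t; rewrite !scaler_suml gS; apply: eq_bigr => b _.
  rewrite !scaler_suml gS; apply: eq_bigr => j _.
  by rewrite -!scalerA gR gXn gE.
have gL : linear g by move=> t x y; rewrite gD gT.
pose h : {linear M -> M'} := HB.pack g (GRing.isLinear.Build T M M' *:%R g gL).
by exists h.
Qed.

End Linear.

Lemma circ_fin_gen (M : lmodType T) : fin_gen M -> exists N (b : 'I_N -> M),
  forall y, exists c : 'rV[R]_N, y = \sum_i iota (c 0 i) *: b i.
Proof.
case=> s sM; pose I : finType := ('I_(size s) * 'I_e * 'I_l)%type.
pose g (t : I) : M := (X ^+ t.2 * E t.1.2) *: s`_t.1.1.
pose val (i : 'I_#|I|) : I := enum_val i.
exists #|I|, (fun i => g (val i)) => y.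
have [u ->] := sM y; have [c cE] := choice (fun i => circ_span H (u i)).
exists (\row_i (c (val i).1.1 (val i).1.2 (val i).2)).
under [RHS]eq_bigr => i _ do rewrite mxE.
have -> : \sum_i iota (c (val i).1.1 (val i).1.2 (val i).2) *: g (val i) =
    \sum_(t : I) iota (c t.1.1 t.1.2 t.2) *: g t.
  by rewrite (reindex val) //=; exact/onW_bij/enum_val_bij.
rewrite -(pair_bigA _ (fun (p : 'I_(size s) * 'I_e) (j : 'I_l) => iota (c p.1
  p.2 j) *: g (p, j))) /=.
rewrite -(pair_bigA _ (fun (i : 'I_(size s)) (b : 'I_e) => \sum_(j < l) iota (c
  i b j) *: g (i, b, j))) /=.
apply: eq_bigr => i _; rewrite cE scaler_suml; apply: eq_bigr => b _.
by rewrite scaler_suml; apply: eq_bigr => j _; rewrite scalerA mulrA.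
Qed.

(* [f] is the characteristic polynomial of [X] on [M], which is why it does not
   depend on the generator [m], see [cyc_unique]. *)
Record cyclic_module (M : lmodType T) a d f (m : M) : Prop := {
  cyc_vertex : E a *: m = m;
  cyc_monic : f \is monic;
  cyc_size : size f = d.+1;
  cyc_rel : ev f *: m = 0;
  cyc_gen : forall y, exists2 p : {poly R}, (size p <= d)%N & y = ev p *: m;
  cyc_free : forall p : {poly R}, (size p <= d)%N -> ev p *: m = 0 -> p = 0
}.

Section CyclicModule.
Variables (M : lmodType T) (a : 'I_e) (d : nat) (f : {poly R}) (m : M).
Hypothesis C : cyclic_module a d f m.

Lemma cyc_ann p : ev p *: m = 0 <-> exists q, p = q * f.
Proof.
split=> [p0|[q ->]]; last by rewrite circ_pevalM -scalerA (cyc_rel C) scaler0.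
have [q [r [pE sr]]] := monic_divide p (cyc_monic C); exists q.
suff r0 : r = 0 by rewrite pE r0 addr0.
rewrite (cyc_size C) ltnS in sr; apply: (cyc_free C sr).
by move: p0; rewrite pE pevalD circ_pevalM scalerDl -scalerA (cyc_rel C)
  scaler0 add0r.
Qed.

Lemma cyc_eq p q : ev p *: m = ev q *: m <-> exists r, p = q + r * f.
Proof.
have -> : (ev p *: m = ev q *: m) <-> ev (p - q) *: m = 0.
  rewrite pevalB scalerBl; split=> [->|/eqP]; first by rewrite subrr.
  by rewrite subr_eq0 => /eqP.
rewrite cyc_ann; split=> -[r h]; exists r; first by rewrite -h addrC subrK.
by rewrite h addrC addKr.
Qed.

Lemma vertex_part_scale b p : E b *: (ev p *: m) = ev (vertex_part a b p) *: m.
Proof.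
by rewrite -[in LHS](cyc_vertex C) !scalerA vertex_partE -scalerA (cyc_vertex C).
Qed.

(** For the exponents, let g be the part of f at the vertex where the path of length d from a ends.
    Then g(X) kills m as f(X) does, and f - g has degree below d because g keeps the leading term;
    hence f = g. *)
Lemma cyc_deform_poly : deform_poly e l d f.
Proof.
have fm := cyc_monic C; have sf := cyc_size C.
have fd : f`_d = 1 by move: (monicP fm); rewrite lead_coefE sf.
split=> //; last first.
  by apply/cyc_ann; rewrite pevalXn (circ_nil H) scale0r.
pose g := vertex_part a (iter d (@ordS e) a) f.
have fg : f - g = 0.
  apply: (cyc_free C).
    apply/leq_sizeP => j; rewrite coefB coef_vertex_part leq_eqVlt =>
      /predU1P[<-|dj].
      by rewrite eqxx subrr.
    by rewrite nth_default ?sf // if_same subr0.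
  by rewrite pevalB scalerBl (cyc_rel C) -vertex_part_scale (cyc_rel C) scaler0
    subrr.
move=> j fj; have := congr1 (fun p : {poly R} => p`_j) fg.
rewrite coefB coef0 coef_vertex_part iter_ordS_eq; case: eqP => // _.
by rewrite subr0 => /fj.
Qed.

(** Since m generates M by polynomials in X, f(X) kills all of M, in particular m'. The difference
    f' - f then kills m' and has degree below d. *)
Lemma cyc_unique f' (m' : M) : cyclic_module a d f' m' -> f' = f.
Proof.
move=> C'; apply/eqP; rewrite -subr_eq0; apply/eqP.
have [p _ mE] := cyc_gen C m'.
have fm' : ev f *: m' = 0.
  by rewrite mE scalerA -circ_pevalM mulrC; apply/cyc_ann; exists p.
apply: (cyc_free C'); last by rewrite pevalB scalerBl fm' (cyc_rel C') subrr.
apply/leq_sizeP => j; rewrite coefB leq_eqVlt => /predU1P[<-|dj].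
  move: (monicP (cyc_monic C)) (monicP (cyc_monic C')).
  by rewrite !lead_coefE (cyc_size C) (cyc_size C') => -> ->; rewrite subrr.
by rewrite !nth_default ?subrr ?(cyc_size C) ?(cyc_size C').
Qed.

(** M is presented by the generator m with the two relations [E a *: m = m] and f(X) m = 0. *)
Lemma cyc_hom (M' : lmodType T) (m' : M') : E a *: m' = m' -> ev f *: m' = 0 ->
  exists g : {linear M -> M'}, forall p, g (ev p *: m) = ev p *: m'.
Proof.
move=> em' fm'.
have ex (y : M) : exists p, y = ev p *: m.
  by have [p _ yE] := cyc_gen C y; exists p.
have [c cE] := choice ex.
pose g y := ev (c y) *: m'.
have gE p : g (ev p *: m) = ev p *: m'.
  rewrite /g; have /cyc_eq[r ->] := esym (cE (ev p *: m)).
  by rewrite pevalD circ_pevalM scalerDl -[X in _ + X]scalerA fm' scaler0 addr0.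
have := @circ_linear M M' g; case=> [x y|r x|x|b x|h hE].
- by rewrite (cE x) (cE y) -scalerDl -pevalD !gE pevalD scalerDl.
- by rewrite (cE x) !gE scalerA -pevalZ gE pevalZ scalerA.
- by rewrite (cE x) !gE scalerA -{1}(pevalX iota X) -circ_pevalM gE circ_pevalM
  pevalX scalerA.
- rewrite (cE x) vertex_part_scale !gE -em' !scalerA.
  by rewrite vertex_partE.
by exists h => p; rewrite hE.
Qed.

End CyclicModule.

End CircularModules.

Section TensorCircular.
Variables (k : fieldType) (e l : nat) (R : comAlgType k).
Local Notation L := (Nalg k e l).
Local Notation T := (tensor_alg R L).

Definition tens_vertex (b : 'I_e) : T := tens_r R (vertex_elt k l b).
Definition tens_arrow : T := tens_r R (arrow_elt k e l).

Lemma tens_circular :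
  circular_alg l (@tens_l k R L : {rmorphism R -> T}) tens_vertex tens_arrow.
Proof.
have H := Nalg_circular k e l.
split.
- move=> r; elim/tensor_ind => [r' u|x y ex ey]; last by rewrite mulrDl mulrDr
  ex ey.
  rewrite -[tpure _ _ _ _]/(tpair r' u) [LHS]tpairM [RHS]tpairM.
  by rewrite mul1r mulr1 mulrC.
- move=> a b; rewrite /tens_vertex -rmorphM (circ_orth H); case: ifP => // _.
  by rewrite rmorph0.
- by rewrite -rmorph_sum (circ_sum H) rmorph1.
- by move=> b; rewrite /tens_vertex /tens_arrow -[LHS]rmorphM (circ_shift H)
  [LHS]rmorphM.
- by rewrite /tens_arrow -rmorphXn (circ_nil H) rmorph0.
elim/tensor_ind => [r u|x y [c ->] [d ->]].
  have [c uE] := circ_span H u; exists (fun b j => r * (c b j)%:A).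
  have -> : tpure _ _ r u = tens_l L r * tens_r R u.
    by rewrite [RHS]tpairM mulr1 mul1r.
  rewrite uE rmorph_sum mulr_sumr; apply: eq_bigr => b _.
  rewrite rmorph_sum mulr_sumr; apply: eq_bigr => j _.
  by rewrite !rmorphM rmorphXn /= tens_kin !mulrA.
exists (fun b j => c b j + d b j); rewrite -big_split; apply: eq_bigr => b _.
by rewrite -big_split; apply: eq_bigr => j _; rewrite rmorphD !mulrDl.
Qed.

End TensorCircular.

(** * Linear forms and dimension *)

Section FiniteDimension.
Variables (k : fieldType) (V : lmodType k).

(** A linear form on V/K. The coordinate vectors of elements of K form the row space of G, so
    multiplication by [cokermx G] depends only on the class modulo K; an entry that is nonzero at x
    is normalised. It is applied with K = 0 and with K the square of a maximal ideal. *)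
Lemma spanning_functional N (b : 'I_N -> V) (K : V -> Prop) (x : V) :
  K 0 -> (forall c y z, K y -> K z -> K (c *: y + z)) ->
  (forall y, exists c : 'rV[k]_N, K (y - \sum_i c 0 i *: b i)) -> ~ K x ->
  exists phi : V -> k, [/\ forall y z, phi (y + z) = phi y + phi z,
    forall c y, phi (c *: y) = c * phi y, phi x = 1 & forall y, K y -> phi y = 0].
Proof.
move=> K0 KL span x0; have [co coE] := choice span.
have KD y z : K y -> K z -> K (y + z) by move=> Ky; rewrite -[y]scale1r; apply: KL.
have KZ c y : K y -> K (c *: y) by move=> Ky; rewrite -[_ *: _]addr0; apply: KL.
pose S (c : 'rV[k]_N) := \sum_i c 0 i *: b i.
have SL c u v : S (c *: u + v) = c *: S u + S v.
  rewrite scaler_sumr -big_split; apply: eq_bigr => i _.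
  by rewrite !mxE scalerDl scalerA.
have S0 : S 0 = 0 by rewrite /S big1 // => i _; rewrite mxE scale0r.
have [||G WG] := @subspace_row_space k N (fun c => K (S c)).
- by rewrite S0.
- by move=> c u v Wu Wv; rewrite SL; apply: KL.
pose pi (c : 'rV[k]_N) := c *m cokermx G.
have piE (u v : 'rV[k]_N) : K (S u - S v) -> pi u = pi v.
  move=> E; have /WG : K (S (-1 *: v + u)) by rewrite SL scaleN1r addrC.
  rewrite submxE mulmxDl => /eqP; rewrite scaleN1r mulNmx addrC => /eqP.
  by rewrite subr_eq0 => /eqP.
have [j pj] : exists j, pi (co x) 0 j != 0.
  apply/existsP; rewrite -negb_forall; apply/negP => /forallP h; apply: x0.
  rewrite -[x](subrK (S (co x))); apply: KD => //.
  apply/WG; rewrite submxE; apply/eqP/rowP => j.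
  by rewrite [RHS]mxE; apply/eqP.
exists (fun y => pi (co y) 0 j / pi (co x) 0 j); split=> [y z|c y||y Ky].
- rewrite -mulrDl; congr (_ / _); rewrite (piE _ (1 *: co y + co z)).
    by rewrite scale1r /pi mulmxDl mxE.
  rewrite SL scale1r.
  have -> : S (co (y + z)) - (S (co y) + S (co z)) =
      -1 *: (y + z - S (co (y + z))) + ((y - S (co y)) + (z - S (co z))).
    by rewrite scaleN1r opprB (addrACA y) -opprD addrA subrK.
  by apply: KL => //; apply: KD.
- rewrite mulrA; congr (_ / _); rewrite (piE _ (c *: co y + 0)).
    by rewrite addr0 /pi -scalemxAl mxE.
  rewrite SL S0 addr0.
  have -> : S (co (c *: y)) - c *: S (co y) =
      -1 *: (c *: y - S (co (c *: y))) + c *: (y - S (co y)).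
    by rewrite scaleN1r opprB scalerBr addrA subrK.
  by apply: KL => //; apply: KZ.
- exact: divff.
rewrite (piE _ 0) ?S0 ?subr0; first by rewrite /pi mul0mx mxE mul0r.
rewrite -[S _]opprK -scaleN1r -[_ *: _]addr0; apply: KL => //.
rewrite -[- _](addKr y); apply: KD => //.
by rewrite -scaleN1r; apply: KZ.
Qed.

(** [vdim] selects some size of a basis, so all bases must be shown to have the same size. *)
Lemma vdimE d (b : 'I_d -> V) :
  (forall v, exists! c : 'rV[k]_d, v = \sum_i c 0 i *: b i) -> vdim V = d.
Proof.
move=> bV.
have le d1 d2 (b1 : 'I_d1 -> V) (b2 : 'I_d2 -> V) :
    (forall v, exists! c : 'rV[k]_d1, v = \sum_i c 0 i *: b1 i) ->
    (forall v, exists! c : 'rV[k]_d2, v = \sum_i c 0 i *: b2 i) -> (d1 <= d2)%N.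
  move=> b1V b2V.
  have ex i : exists c : 'rV[k]_d2, b1 i = \sum_j c 0 j *: b2 j.
    by have [c [cE _]] := b2V (b1 i); exists c.
  have ex' j : exists c : 'rV[k]_d1, b2 j = \sum_i c 0 i *: b1 i.
    by have [c [cE _]] := b1V (b2 j); exists c.
  have [A AE] := choice ex; have [B BE] := choice ex'.
  apply: (@mulmx1_min k _ _ (\matrix_i A i) (\matrix_j B j)).
  apply/row_matrixP => i; have [c [_ cU]] := b1V (b1 i).
  transitivity c; last first.
    apply: cU; rewrite (bigD1 i) //= big1 ?addr0 => [|j ji].
      by rewrite row1 mxE !eqxx scale1r.
    by rewrite row1 mxE (negbTE ji) andbF scale0r.
  apply/esym/cU; rewrite [LHS]AE; under eq_bigr do rewrite BE scaler_sumr.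
  rewrite exchange_big; apply: eq_bigr => i' _ /=.
  rewrite !mxE scaler_suml; apply: eq_bigr => j _.
  by rewrite !mxE scalerA.
have ex : [set d' | exists b : 'I_d' -> V,
    forall v, exists! c : 'rV[k]_d', v = \sum_i c 0 i *: b i]%classic d.
  by exists b.
have [b' b'V] := xgetPex 0%N (ex_intro _ d ex).
by apply/eqP; rewrite eqn_leq (le _ _ _ _ bV b'V) (le _ _ _ _ b'V bV).
Qed.

End FiniteDimension.

(** * Classification of the indecomposable modules *)

Section NakayamaModules.
Variables (k : fieldType) (e l : nat).
Local Notation L := (Nalg k e l).
Local Notation kappa := (@kin k L : {rmorphism k -> L}).
Local Notation E := (vertex_elt k l : 'I_e -> L).
Local Notation X := (arrow_elt k e l).
Local Notation H := (Nalg_circular k e l).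
Local Notation ev := (peval kappa X).
Variable V : lmodType L.

Lemma kin_functional (x : V) : fin_gen V -> x <> 0 ->
  exists phi : V -> k, [/\ forall y z, phi (y + z) = phi y + phi z,
    forall c y, phi (kin c *: y) = c * phi y & phi x = 1].
Proof.
move=> Vfg x0; have [N [b bV]] := circ_fin_gen H Vfg.
have [|c y z -> ->|y||phi [phiD phiZ phix _]] :=
  @spanning_functional k (restrict kappa V) N b (fun y => y = 0) x => //.
- by rewrite scaler0 addr0.
- by have [c cE] := bV y; exists c; apply/eqP; rewrite subr_eq0; apply/eqP.
by exists phi.
Qed.

Lemma cyclic_kdim a d f (v : V) : cyclic_module kappa E X a d f v -> kdim V = d.
Proof.
move=> C; apply: (@vdimE k (restrict kappa V) d (fun i => X ^+ i *: v)) => y.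
have evE (c : 'rV[k]_d) : ev (\poly_(i < d) (if insub i is Some j then c 0 j
  else 0)) *: v =
    \sum_i kin (c 0 i) *: (X ^+ i *: v).
  rewrite (peval_widen kappa X (size_poly _ _)) scaler_suml; apply: eq_bigr => i _.
  by rewrite coef_poly ltn_ord valK scalerA.
have [p sp ->] := cyc_gen C y; exists (\row_i p`_i); split.
  rewrite (peval_widen kappa X sp) scaler_suml; apply: eq_bigr => i _.
  by rewrite mxE -scalerA.
move=> c cy; pose q := \poly_(i < d) (if insub i is Some j then c 0 j else 0).
have pq : ev p *: v = ev q *: v by rewrite evE; exact: cy.
have pq0 : p - q = 0.
  apply: (cyc_free C); last by rewrite pevalB scalerBl pq subrr.
  by rewrite (leq_trans (size_polyD _ _)) // geq_max sp size_polyN size_poly.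
apply/rowP => i; rewrite mxE; have := congr1 (fun p : {poly k} => p`_i) pq0.
rewrite coefB coef_poly ltn_ord valK coef0 => /eqP.
by rewrite subr_eq0 => /eqP.
Qed.

(** For d = l the relation X^l v = 0 holds in every module, so any preimage of f v, projected to the
    vertex a, may serve as the image of v. *)
Lemma cyclic_projective a (v : V) :
  cyclic_module kappa E X a l 'X^l v -> projective V.
Proof.
move=> C M Y g f gsurj; have [x gx] := gsurj (f v).
have [||h hE] := cyc_hom H C (m' := E a *: x).
- by rewrite scalerA (circ_orth H) eqxx.
- by rewrite pevalXn (circ_nil H) scale0r.
exists h => y; have [p _ ->] := cyc_gen C y.
by rewrite hE !linearZ /= gx -linearZ /= (cyc_vertex C).
Qed.

(* For [v] at a vertex with [X ^+ d.-1 *: v] nonzero and [d] maximal, a linear form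
   [phi] that does not vanish on [X ^+ d.-1 *: v] makes the largest submodule [W]
   contained in the kernel of [phi] a complement of the submodule [U] of [v]. *)
Lemma indecomposable_cyclic : fin_gen V -> indecomposable V ->
  exists a d (v : V), (0 < d <= l)%N /\ cyclic_module kappa E X a d 'X^d v.
Proof.
move=> Vfg [[x0 nx0] Vind].
pose P d := `[< forall y : V, X ^+ d *: y = 0 >].
have Pl : P l by apply/asboolP => y; rewrite (circ_nil H) scale0r.
have [d /asboolP Xd dmin] := ex_minnP (ex_intro P l Pl).
have d0 : (0 < d)%N.
  by rewrite lt0n; apply/eqP => d0; apply: nx0; rewrite -(Xd x0) d0 scale1r.
have [y yX] : exists y : V, X ^+ d.-1 *: y <> 0.
  apply: contrapT => h; have := dmin d.-1; rewrite leqNgt prednK // leqnn.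
  suff -> : P d.-1 by move/(_ isT).
  by apply/asboolP => y; apply: contrapT => hy; apply: h; exists y.
have [a [v [Ev vX]]] : exists a (v : V), E a *: v = v /\ X ^+ d.-1 *: v <> 0.
  apply: contrapT => h; apply: yX; rewrite -[y]scale1r -(circ_sum H)
    scaler_suml scaler_sumr.
  rewrite big1 // => a _; apply: contrapT => ha; apply: h; exists a, (E a *: y).
  by split=> //; rewrite scalerA (circ_orth H) eqxx.
have [phi0 [phi0D phi0Z phi0v]] := kin_functional Vfg vX.
(* [phi] only sees the vertex z at which X^(d-1) v lies. This makes W stable under the idempotents
   although its definition mentions only powers of X. *)
move=> {y yX}; pose z := iter d.-1 (@ordS e) a; pose phi y := phi0 (E z *: y).
have phiD y1 y2 : phi (y1 + y2) = phi y1 + phi y2 by rewrite /phi scalerDr phi0D.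
have phiZ c y1 : phi (kin c *: y1) = c * phi y1.
  by rewrite /phi scalerA -(circ_central H) -scalerA phi0Z.
have phiv : phi (X ^+ d.-1 *: v) = 1.
  rewrite /phi -phi0v; congr phi0.
  by rewrite -[in LHS]Ev !scalerA -mulrA (circ_shiftX H) mulrA (circ_orth H)
    eqxx -(circ_shiftX H) -scalerA Ev.
have phi00 : phi0 0 = 0 by apply: (addrI (phi0 0)); rewrite -phi0D !addr0.
have phi0' : phi 0 = 0 by apply: (addrI (phi 0)); rewrite -phiD !addr0.
have phiS I (r : seq I) (F : I -> V) : phi (\sum_(i <- r) F i) = \sum_(i <- r)
  phi (F i).
  by elim/big_rec2: _ => // i u1 u2 _ <-.
have Xge j (y1 : V) : (d <= j)%N -> X ^+ j *: y1 = 0.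
  by move=> dj; rewrite -(subnK dj) exprD -scalerA Xd scaler0.
have phiev p j : phi (X ^+ j *: (ev p *: v)) = \sum_(i < size p) p`_i * phi (X
  ^+ (j + i) *: v).
  rewrite /peval scaler_suml scaler_sumr phiS; apply: eq_bigr => i _.
  have kinC c (y1 : V) : X ^+ j *: (kin c *: y1) = kin c *: (X ^+ j *: y1).
    by rewrite !scalerA (circ_central H).
  by rewrite -scalerA kinC phiZ scalerA exprD.
pose U y := exists p, y = ev p *: v.
pose W y := forall j, phi (X ^+ j *: y) = 0.
(* Triangularity: if the coefficients of p below j vanish, then [phi] takes X^(d-1-j) p(X) v to the
   coefficient at j. *)
have UW p : W (ev p *: v) -> forall j, (j < d)%N -> p`_j = 0.
  move=> Wp; elim/ltn_ind => j IH jd; have := Wp (d.-1 - j)%N; rewrite phiev.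
  have [sj _|js] := leqP (size p) j; first by rewrite nth_default.
  have jd1 : (j <= d.-1)%N by rewrite -ltnS prednK.
  rewrite (bigD1 (Ordinal js)) //= subnK // phiv mulr1 big1 ?addr0 // => i.
  rewrite -val_eqE /= neq_ltn => /orP[ij|ji]; first by rewrite IH ?mul0r //
    (ltn_trans ij).
  rewrite Xge ?phi0' ?mulr0 //.
  by rewrite -[X in (X <= _)%N](prednK d0) -{1}(subnK jd1) ltn_add2l.
have U_sub : is_submodule U.
  split=> [|t y1 y2 [p ->] [q ->]]; first by exists 0; rewrite peval0 scale0r.
  have [c ->] := circ_span H t; rewrite scaler_suml.
  have UD u1 u2 : U u1 -> U u2 -> U (u1 + u2).
    by move=> [p1 ->] [p2 ->]; exists (p1 + p2); rewrite pevalD scalerDl.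
  have U0 : U 0 by exists 0; rewrite peval0 scale0r.
  apply: (UD _ _ _ (ex_intro _ q erefl)).
  apply: (big_ind U) => // b _; rewrite scaler_suml; apply: (big_ind U) => // j _.
  exists (c b j *: ('X^j * vertex_part a b p)).
  rewrite pevalZ (circ_pevalM H) pevalXn -[in LHS]Ev !scalerA -[in RHS]Ev scalerA.
  by rewrite -!mulrA; congr (_ *: _); do 2!congr (_ * _); rewrite mulrA
    (vertex_partE H).
have W_sub : is_submodule W.
  split=> [j|t y1 y2 W1 W2 j]; first by rewrite scaler0.
  rewrite scalerDr phiD W2 addr0; have [c ->] := circ_span H t.
  rewrite scaler_suml scaler_sumr phiS big1 // => b _.
  rewrite scaler_suml scaler_sumr phiS big1 // => i _.
  rewrite scalerA mulrA mulrA -(circ_central H) -!mulrA -scalerA phiZ.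
  rewrite mulrA -exprD; suff -> : phi ((X ^+ (j + i) * E b) *: y1) = 0 by
    rewrite mulr0.
  rewrite /phi scalerA (circ_shiftX H) mulrA (circ_orth H); case: eqP =>
    [zE|_]; last first.
    by rewrite mul0r scale0r phi00.
  by rewrite -scalerA; apply: W1.
have UWV y : exists u w, [/\ U u, W w & y = u + w].
  (* The same triangular system is solved for y, from j = d - 1 downwards: adding c X^s corrects the
     value at j = d-1-s and leaves those at larger j alone. *)
  have H' s : exists p, forall j, (d - s <= j)%N -> phi (X ^+ j *: (y - ev p *:
    v)) = 0.
    elim: s => [|s [p pW]].
      by exists 0 => j; rewrite subn0 => /Xge ->.
    have [ds|sd] := leqP d s.
      exists p => j _; apply: pW; by move: ds; rewrite -subn_eq0 => /eqP ->.
    pose j0 := (d - s.+1)%N; pose c := phi (X ^+ j0 *: (y - ev p *: v)).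
    have phiN y1 : phi (- y1) = - phi y1.
      by apply: (addrI (phi y1)); rewrite -phiD !subrr.
    have E1 j : phi (X ^+ j *: (y - ev (p + c *: 'X^s) *: v)) =
        phi (X ^+ j *: (y - ev p *: v)) - c * phi (X ^+ (j + s) *: v).
      rewrite pevalD scalerDl opprD addrA scalerBr phiD phiN; congr (_ - _).
      by rewrite pevalZ pevalXn scalerA mulrA -(circ_central H) -mulrA -exprD
        -scalerA phiZ.
    exists (p + c *: 'X^s) => j; rewrite leq_eqVlt E1 => /predU1P[<-|jj].
      rewrite -/j0 -/c; suff -> : (j0 + s = d.-1)%N by rewrite phiv mulr1 subrr.
      by rewrite -[d in RHS](subnK sd) addnS.
    have dj : (d - s <= j)%N by rewrite (leq_trans _ jj) // -subSn // subSS.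
    by rewrite pW // Xge ?phi0' ?mulr0 ?subrr // addnC -leq_subLR.
  have [p pW] := H' d; exists (ev p *: v), (y - ev p *: v); split.
  - by exists p.
  - by move=> j; apply: pW; rewrite subnn.
  - by rewrite addrC subrK.
have UW0 y : U y -> W y -> y = 0.
  move=> [p ->] /UW p0; rewrite /peval scaler_suml big1 // => i _.
  have [id|di] := ltnP i d; first by rewrite p0 // rmorph0 mul0r scale0r.
  by rewrite -scalerA Xge ?scaler0.
have [U0|W0] := Vind U W U_sub W_sub UWV UW0.
  case: vX; rewrite (U0 v) ?scaler0 //; exists 1; have -> : ev 1 = 1 by rewrite
    -polyC1 pevalC rmorph1.
  by rewrite scale1r.
exists a, d, v; split; first by rewrite d0 dmin.
split=> //.
- exact: monicXn.
- by rewrite size_polyXn.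
- by rewrite pevalXn Xd.
- move=> y; have [_ [w [[p ->] Ww ->]]] := UWV y; rewrite (W0 w Ww) addr0.
  exists (take_poly d p); first exact: size_take_poly.
  rewrite -[in LHS](poly_take_drop d p) pevalD scalerDl pevalMXn -scalerA Xge //.
  by rewrite scaler0 addr0.
move=> p sp p0; apply/polyP => j; rewrite coef0.
have [jd|dj] := ltnP j d; last by rewrite nth_default // (leq_trans sp).
by apply: UW => // i; rewrite p0 scaler0.
Qed.

Lemma nakayama_classification : fin_gen V -> indecomposable V -> ~ projective V ->
  exists a d (v : V), [/\ (0 < d < l)%N, kdim V = d & cyclic_module kappa E X a
    d 'X^d v].
Proof.
move=> Vfg Vind Vnp; have [a [d [v [/andP[d0 dl] C]]]] := indecomposable_cyclic
  Vfg Vind.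
exists a, d, v; split=> //; last exact: cyclic_kdim C.
rewrite d0 ltn_neqAle dl andbT; apply/eqP => dE; apply: Vnp.
by rewrite dE in C; apply: cyclic_projective C.
Qed.

End NakayamaModules.

(** * Lifts and their characteristic polynomials *)

Section LiftReduction.
Variables (k : fieldType) (e l : nat).
Local Notation L := (Nalg k e l).
Variable V : lmodType L.
Local Notation kappa := (@kin k L : {rmorphism k -> L}).
Local Notation evk := (peval kappa (arrow_elt k e l)).

Definition reduction_linear (R : Chat k) (N : lmodType (tensor_alg R L))
    (red : base_change (residue R) N -> V) : Prop :=
  (forall x y, red (x + y) = red x + red y) /\
  (forall (u : L) x, red (tens_r k^o u *: x) = u *: red x).

Definition red_linear (R : Chat k) (M : lift_data V R) : Prop :=
  reduction_linear (@lift_red k L V R M).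

Lemma is_lift_red_linear (R : Chat k) (M : lift_data V R) :
  is_lift M -> red_linear M.
Proof. by case. Qed.

Section OneLift.
Variables (R : Chat k) (M : lift_data V R).
Hypothesis MR : red_linear M.
Local Notation T := (tensor_alg R L).
Local Notation iota := (@tens_l k R L : {rmorphism R -> T}).
Local Notation evT := (peval iota (tens_arrow e l R)).

Definition red1 (m : M) : V := lift_red (bpure (residue R) 1 m).

Lemma bpure_kin c (m : M) :
  bpure (residue R) c m = tens_r k^o (kin c) *: bpure (residue R) 1 m.
Proof.
rewrite [RHS]bscaleE mulr1 tens_kin -bpureM mul1r.
by rewrite residue_alg.
Qed.

Lemma red_bpure c (m : M) : lift_red (bpure (residue R) c m) = kin c *: red1 m.
Proof. by rewrite bpure_kin MR.2. Qed.

Lemma red1D x y : red1 (x + y) = red1 x + red1 y.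
Proof. by rewrite /red1 -MR.1; congr lift_red; apply: tpureDr. Qed.

Lemma red1_tens_r u m : red1 (tens_r R u *: m) = u *: red1 m.
Proof.
rewrite /red1 -MR.2; congr lift_red.
by rewrite [RHS]bscaleE mulr1.
Qed.

Lemma red1_tens_l r m : red1 (tens_l L r *: m) = kin (residue R r) *: red1 m.
Proof. by rewrite -red_bpure /red1 -bpureM mul1r. Qed.

Lemma red1_sum I (s : seq I) (F : I -> M) :
  red1 (\sum_(i <- s) F i) = \sum_(i <- s) red1 (F i).
Proof.
have r0 : red1 0 = 0 by apply: (addrI (red1 0)); rewrite -red1D !addr0.
by elim/big_rec2: _ => // i x y _ <-; rewrite red1D.
Qed.

Lemma red1_peval p m : red1 (evT p *: m) = evk (map_poly (residue R) p) *: red1 m.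
Proof.
rewrite (peval_widen _ _ (size_poly _ _)) /peval !scaler_suml red1_sum.
apply: eq_bigr => j _; rewrite -!scalerA red1_tens_l (coef_map (residue R)).
congr (_ *: _); rewrite /tens_arrow -(rmorphXn (@tens_r k R L)).
exact: red1_tens_r.
Qed.

End OneLift.

Lemma bpure_balanced (R : Chat k) (M M' : lmodType (tensor_alg R L))
    (g : {linear M -> M'}) :
  balanced (fun (s : R) (c : k^o) => c * residue R s)
    (fun s (m : M) => tens_l L s *: m) (fun c m => bpure (residue R) c (g m)).
Proof.
split=> [c c' m|c m m'|s c m]; first exact: tpureDl.
- by rewrite linearD; apply: tpureDr.
- by rewrite linearZ bpureM.
Qed.

Lemma bpure1_surj (R : Chat k) (M : lmodType (tensor_alg R L))
    (x : base_change (residue R) M) :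
  exists m, x = bpure (residue R) 1 m.
Proof.
elim/tensor_ind: x => [c m|_ _ [m ->] [m' ->]].
  exists (tens_l L c%:A *: m); rewrite -bpureM mul1r residue_alg; by [].
by exists (m + m'); rewrite /bpure tpureDr.
Qed.

Variables (a : 'I_e) (d : nat) (v : V).

(** The generator has to reduce to v itself, not only to some generator of V; this builds the
    reduction map of the lift into the condition. *)
Definition lift_poly (R : Chat k) (M : lift_data V R) (f : {poly R}) : Prop :=
  exists m : M, cyclic_module (@tens_l k R L : {rmorphism R -> tensor_alg R L})
    (tens_vertex l R) (tens_arrow e l R) a d f m /\ red1 m = v.

Lemma lift_poly_unique (R : Chat k) (M : lift_data V R) f f' :
  lift_poly M f -> lift_poly M f' -> f = f'.
Proof. by case=> m [C _] [m' [C' _]]; exact: (cyc_unique (tens_circular e l R)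
  C' C). Qed.

Lemma lift_poly_deform (R : Chat k) (M : lift_data V R) f :
  lift_poly M f -> deform_poly e l d f.
Proof. by case=> m [C _]; exact: (cyc_deform_poly (tens_circular e l R) C). Qed.

(** The two generators satisfy the same relations, so sending one to the other gives mutually
    inverse maps; they respect the reductions because both generators lie over v. *)
Lemma lift_poly_iso (R : Chat k) (M M' : lift_data V R) f :
  lift_poly M f -> red_linear M -> lift_poly M' f -> red_linear M' -> lift_iso M M'.
Proof.
case=> m [C mv] MR [m' [C' mv']] MR'; have H := tens_circular e l R.
have [g gE] := cyc_hom H C (cyc_vertex C') (cyc_rel C').
have [h hE] := cyc_hom H C' (cyc_vertex C) (cyc_rel C).
exists g; split.
  exists h => y; first by have [p _ ->] := cyc_gen C y; rewrite gE hE.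
  by have [p _ ->] := cyc_gen C' y; rewrite hE gE.
elim/tensor_ind => [c y|x x' ex ex']; last first.
  by rewrite tliftD ?MR.1 ?MR'.1 ?ex ?ex' //; apply: bpure_balanced.
rewrite tliftE; last exact: bpure_balanced.
rewrite -[tpure _ _ _ _]/(bpure (residue R) c y) !red_bpure //; congr (_ *: _).
by have [p _ ->] := cyc_gen C y; rewrite gE !red1_peval // mv mv'.
Qed.

Lemma lift_iso_poly (R : Chat k) (M M' : lift_data V R) f :
  lift_iso M M' -> lift_poly M f -> lift_poly M' f.
Proof.
case=> g [[h gK hK] gR] [m [C mv]]; exists (g m); split; last first.
  rewrite -mv /red1 -(gR (bpure (residue R) 1 m)); congr lift_red.
  by rewrite tliftE //; apply: bpure_balanced.
split; try by case: C.
- by rewrite -linearZ /= (cyc_vertex C).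
- by rewrite -linearZ /= (cyc_rel C) linear0.
- move=> y; have [p sp pE] := cyc_gen C (h y); exists p => //.
  by rewrite -(hK y) pE linearZ.
move=> p sp p0; apply: (cyc_free C sp); apply: (can_inj gK).
by rewrite linearZ /= p0 linear0.
Qed.

End LiftReduction.

(** * Base change of lifts *)

Section LiftPush.
Variables (k : fieldType) (e l : nat).
Local Notation L := (Nalg k e l).
Variables (V : lmodType L) (R R' : Chat k) (phi : Chat_hom R R').

Section ResidueBaseChange.
Variable M : lmodType (tensor_alg R L).

Let inner_balanced (d : k) : balanced (fun (s : R) (r : R') => r * phi s)
    (fun s (m : M) => tens_l L s *: m)
    (fun r m => bpure (residue R) (d * residue R' r) m).
Proof.
split=> [r r' m|r m m'|s r m].
- by rewrite rmorphD mulrDr; apply: tpureDl.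
- exact: tpureDr.
- by rewrite [residue R' _]rmorphM /= Chat_fun_residue mulrA bpureM.
Qed.

Let outer_balanced : balanced (fun (s : R') (c : k^o) => c * residue R' s)
    (fun s (y : base_change phi M) => tens_l L s *: y)
    (fun c y => tlift (fun r m => bpure (residue R) (c * residue R' r) m) y).
Proof.
split=> [c c' y|c y y'|s c y].
- rewrite -tliftD_fun; apply: eq_tlift => r m; rewrite mulrDl; exact: tpureDl.
- exact: tliftD.
elim/tensor_ind: y => [r m|y y' ey ey']; last by rewrite scalerDr !tliftD // ey ey'.
rewrite -[tpure _ _ _ _]/(bpure phi r m) [_ *: _]bscaleE scale1r !tliftE //.
by rewrite rmorphM mulrA.
Qed.

Lemma residue_base_changeD :
  {morph @residue_base_change k L R R' phi M : x y / x + y}.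
Proof. by move=> x y; apply: tliftD. Qed.

Lemma residue_base_changeZ u x :
  @residue_base_change k L R R' phi M (tens_r k^o u *: x) =
  tens_r k^o u *: residue_base_change x.
Proof.
elim/tensor_ind: x => [c y|x x' ex ex']; last first.
  by rewrite scalerDr !residue_base_changeD scalerDr ex ex'.
elim/tensor_ind: y => [r m|y y' ey ey']; last first.
  have -> : tpure _ _ c (y + y') = tpure (fun (s : R') (r : k^o) => r * residue
    R' s)
    (fun s (m : base_change phi M) => tens_l L s *: m) c y + tpure _ _ c y'.
    exact: tpureDr.
  by rewrite scalerDr !residue_base_changeD scalerDr ey ey'.
rewrite -[tpure _ _ c _]/(bpure (residue R') c (bpure phi r m)).
rewrite [X in residue_base_change X]bscaleE mul1r [X in bpure _ c X]bscaleE mul1r.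
by rewrite !residue_base_changeE [RHS]bscaleE mul1r.
Qed.

End ResidueBaseChange.

Variables (M : lift_data V R).
Local Notation T' := (tensor_alg R' L).
Local Notation ev := (peval (@tens_l k R L : {rmorphism R -> _}) (tens_arrow e
  l R)).
Local Notation ev' := (peval (@tens_l k R' L : {rmorphism R' -> T'})
  (tens_arrow e l R')).

Lemma push_red x :
  lift_red (l := push phi M) x = lift_red (residue_base_change x).
Proof. by []. Qed.

Lemma push_red_linear : red_linear M -> red_linear (push phi M).
Proof.
case=> MD ML.
have : reduction_linear (N := base_change phi M)
    (fun x => lift_red (residue_base_change x)).
  split=> [x y|u x].
    exact: etrans (congr1 (@lift_red _ _ _ _ M) (residue_base_changeD x y)) (MD
      _ _).
  have h := congr1 (@lift_red k L V R M) (@residue_base_changeZ M u x).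
  exact: etrans h (ML u (residue_base_change x)).
exact.
Qed.

Lemma red1_push m : red1 (M := push phi M) (bpure phi 1 m) = red1 m.
Proof. by rewrite /red1 push_red residue_base_changeE rmorph1 mulr1. Qed.

Lemma tens_l_bpure r (m : M) : tens_l L r *: bpure phi 1 m = bpure phi r m.
Proof. by rewrite [LHS]bscaleE mulr1 scale1r. Qed.

Lemma tens_r_bpure u r (m : M) :
  tens_r R' u *: bpure phi r m = bpure phi r (tens_r R u *: m).
Proof. by rewrite [LHS]bscaleE mul1r. Qed.

Lemma tens_arrowX (S : comAlgType k) j :
  tens_arrow e l S ^+ j = tens_r S (arrow_elt k e l ^+ j).
Proof. by rewrite rmorphXn. Qed.

Lemma bpure_sum I (s : seq I) (F : I -> M) :
  bpure phi 1 (\sum_(i <- s) F i) = \sum_(i <- s) bpure phi 1 (F i).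
Proof.
have b0 : bpure phi 1 (0 : M) = 0.
  by apply: (addrI (bpure phi 1 (0 : M))); rewrite -[LHS]tpureDr !addr0.
by elim/big_rec2: _ => // i x y _ <-; apply: tpureDr.
Qed.

Lemma peval_bpure p (m : M) :
  ev' (map_poly phi p) *: bpure phi 1 m = bpure phi 1 (ev p *: m).
Proof.
rewrite (peval_widen _ _ (size_poly _ _)) /peval !scaler_suml bpure_sum.
apply: eq_bigr => j _; rewrite -!scalerA (coef_map phi) !tens_arrowX tens_r_bpure.
by rewrite tens_l_bpure -bpureM mul1r.
Qed.

Variables (a : 'I_e) (d : nat) (v : V).

(** Only independence is not formal for the tensor product. It is read off from the coordinate maps
    [tlift (F j)], where [co y] is the unique polynomial of degree below d that represents y. *)
Lemma push_poly f : lift_poly a d v M f ->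
  lift_poly a d v (push phi M) (map_poly phi f).
Proof.
case=> m [C mv]; exists (bpure phi 1 m); split; last by rewrite red1_push.
have fm := cyc_monic C; have sf := cyc_size C.
have H := tens_circular e l R; have H' := tens_circular e l R'.
split.
- by rewrite tens_r_bpure (cyc_vertex C).
- exact: monic_map.
- by rewrite size_map_poly_id0 // (monicP fm) rmorph1 oner_eq0.
- rewrite peval_bpure (cyc_rel C); apply: (addrI (bpure phi 1 (0 : M))).
  by rewrite -[LHS]tpureDr !addr0.
- elim/tensor_ind => [r y|x y [p sp pE] [q sq qE]]; last first.
    exists (p + q); last by rewrite pE qE pevalD scalerDl.
    by rewrite (leq_trans (size_polyD _ _)) // geq_max sp.
  have [p sp ->] := cyc_gen C y; exists (r *: map_poly phi p).
    by rewrite (leq_trans (size_scale_leq _ _)) // (leq_trans (size_poly _ _)).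
  by rewrite pevalZ -scalerA peval_bpure tens_l_bpure.
have ex (y : M) : exists p : {poly R}, (size p <= d)%N /\ y = ev p *: m.
  by have [p sp pE] := cyc_gen C y; exists p.
have [co coE] := choice ex.
have coU (p : {poly R}) (y : M) : (size p <= d)%N -> y = ev p *: m -> co y = p.
  move=> sp yE; apply/eqP; rewrite -subr_eq0; apply/eqP/(cyc_free C).
    by rewrite (leq_trans (size_polyD _ _)) // geq_max size_polyN (coE y).1.
  by rewrite pevalB scalerBl -(coE y).2 yE subrr.
have coD (y z : M) : co (y + z) = co y + co z.
  apply: coU; last by rewrite pevalD scalerDl -(coE y).2 -(coE z).2.
  by rewrite (leq_trans (size_polyD _ _)) // geq_max (coE y).1 (coE z).1.
have coZ (s : R) (y : M) : co (tens_l L s *: y) = s *: co y.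
  apply: coU; last by rewrite pevalZ -scalerA -(coE y).2.
  by rewrite (leq_trans (size_scale_leq _ _)) // (coE y).1.
pose F j (r : R') (y : M) := r * phi (co y)`_j.
have FB j : balanced (fun (s : R) (r : R') => r * phi s)
    (fun s (y : M) => tens_l L s *: y) (F j).
  split=> [r r' y|r y z|s r y]; first by rewrite /F mulrDl.
  - by rewrite /F coD coefD rmorphD mulrDr.
  - by rewrite /F coZ coefZ rmorphM mulrA.
have F0 j : tlift (F j) (0 : base_change phi M) = 0.
  have E := tliftD (0 : base_change phi M) 0 (FB j); rewrite addr0 in E.
  by apply/eqP; rewrite -(inj_eq (addrI (tlift (F j) (0 : base_change phi M))))
    -E addr0.
move=> q sq q0; apply/polyP => j; rewrite coef0.
have [jd|dj] := ltnP j d; last by rewrite nth_default // (leq_trans sq).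
transitivity (tlift (F j) (ev' q *: bpure phi 1 m)); last by rewrite q0 F0.
rewrite (peval_widen _ _ sq) scaler_suml.
have coX i : (i < d)%N -> co (tens_r R (arrow_elt k e l ^+ i) *: m) = 'X^i.
  by move=> id; apply: coU; rewrite ?size_polyXn // pevalXn tens_arrowX.
have -> : tlift (F j) (\sum_(i < d) (tens_l L q`_i * tens_arrow e l R' ^+ i) *:
  bpure phi 1 m) =
    \sum_(i < d) tlift (F j) (bpure phi q`_i (tens_r R (arrow_elt k e l ^+ i)
      *: m)).
  elim/big_rec2: _ => // i x y _ <-; rewrite tliftD //; congr (tlift _ _ + _).
  by rewrite -scalerA tens_arrowX tens_r_bpure tens_l_bpure.
rewrite (bigD1 (Ordinal jd)) //= big1 ?addr0 => [|i ij]; rewrite tliftE // /F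
  coX ?coefXn //.
  by rewrite eqxx rmorph1 mulr1.
by rewrite -val_eqE /= eq_sym in ij; rewrite (negbTE ij) rmorph0 mulr0.
Qed.

End LiftPush.

(** * Finite bases and cyclicity of lifts *)

Section Combinations.
Variables (S : comNzRingType) (N : lmodType S).

Definition comb n (u : 'rV[S]_n) (x : 'I_n -> N) : N := \sum_i u 0 i *: x i.

Lemma combD n (u u' : 'rV[S]_n) x : comb (u + u') x = comb u x + comb u' x.
Proof.
by rewrite /comb -big_split; apply: eq_bigr => i _; rewrite mxE scalerDl.
Qed.

Lemma combZ n c (u : 'rV[S]_n) x : comb (c *: u) x = c *: comb u x.
Proof. by rewrite /comb scaler_sumr; apply: eq_bigr => i _; rewrite mxE
  scalerA. Qed.

Lemma combB n (u u' : 'rV[S]_n) x : comb (u - u') x = comb u x - comb u' x.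
Proof. by rewrite combD -[- u']scaleN1r combZ scaleN1r. Qed.

Lemma comb_delta n i (x : 'I_n -> N) : comb (delta_mx 0 i) x = x i.
Proof.
rewrite /comb (bigD1 i) //= big1 ?addr0 => [|j ji]; first by rewrite mxE !eqxx
  scale1r.
by rewrite mxE (negbTE ji) andbF scale0r.
Qed.

Lemma eq_comb n (u : 'rV[S]_n) x y : x =1 y -> comb u x = comb u y.
Proof. by move=> E; apply: eq_bigr => i _; rewrite E. Qed.

Lemma comb_mulmx n m (u : 'rV[S]_n) (A : 'M[S]_(n, m)) x :
  comb (u *m A) x = comb u (fun i => comb (row i A) x).
Proof.
rewrite /comb; under [RHS]eq_bigr do rewrite scaler_sumr.
rewrite exchange_big; apply: eq_bigr => j _ /=; rewrite mxE scaler_suml.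
by apply: eq_bigr => i _; rewrite mxE scalerA.
Qed.

(** The elements of B that occur in the expansions of the finitely many generators already span. *)
Lemma finite_basis M0 (g : 'I_M0 -> N) : free_module N ->
  (forall y, exists c, y = comb c g) ->
  exists r (b : 'I_r -> N), (forall y, exists c, y = comb c b) /\
    (forall c, comb c b = 0 -> c = 0).
Proof.
case=> B [Bspan Bfree] gspan.
have [s sP] := choice (fun i => Bspan (g i)).
pose D := undup (flatten [seq [seq p.2 | p <- s i] | i <- enum 'I_M0]).
have DP i p : p \in s i -> p.2 \in D.
  move=> ps; rewrite mem_undup; apply/flattenP; exists [seq p.2 | p <- s i].
    by apply: map_f; rewrite mem_enum.
  exact: map_f.
have DB x : x \in D -> B x.
  rewrite mem_undup => /flattenP[_ /mapP[i _ ->]] /mapP[p ps ->].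
  by have [sB _] := sP i; apply: sB.
pose b (i : 'I_(size D)) := D`_i.
have bspan x : x \in D -> exists c, x = comb c b.
  move=> xD; have h : (index x D < size D)%N by rewrite index_mem.
  by exists (delta_mx 0 (Ordinal h)); rewrite comb_delta /b nth_index.
exists (size D), b; split.
  move=> y; have [c ->] := gspan y.
  have [A AE] : exists A : 'I_M0 -> 'rV[S]_(size D), forall i, g i = comb (A i) b.
    suff ex i : exists u, g i = comb u b by have [A AE] := choice ex; exists A.
    have [_ ->] := sP i.
    elim: (s i) (DP i) => [|p t IH] tD.
      exists 0; rewrite big_nil /comb big1 // => j _; by rewrite mxE scale0r.
    have [u uE] := IH (fun q qt => tD q (mem_behead (s := p :: t) qt)).
    have [w wE] := bspan _ (tD p (mem_head _ _)).
    by exists (p.1 *: w + u); rewrite big_cons uE wE combD combZ.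
  exists (c *m \matrix_i A i); rewrite comb_mulmx; apply: eq_comb => i.
  by rewrite rowK AE.
move=> c c0; pose t := [seq (c 0 i, b i) | i <- enum 'I_(size D)].
have tE : [seq p.2 | p <- t] = D.
  apply: (@eq_from_nth _ 0); rewrite -map_comp size_map size_enum_ord // => i iD.
  by rewrite (nth_map (Ordinal iD)) ?size_enum_ord //= /b nth_enum_ord.
have t0 := Bfree t; rewrite tE undup_uniq in t0.
apply/rowP => i; rewrite mxE; apply: (t0 _ _ _ (c 0 i, b i)) => //.
- by move=> _ /mapP[j _ ->]; apply: DB; apply: mem_nth.
- by rewrite /t big_map big_enum.
- by apply/mapP; exists i; rewrite ?mem_enum.
Qed.

End Combinations.

Section LiftPolynomial.
Variables (k : fieldType) (e l : nat).
Local Notation L := (Nalg k e l).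
Variables (V : lmodType L) (a : 'I_e) (d : nat) (v : V).
Local Notation kappa := (@kin k L : {rmorphism k -> L}).
Local Notation X := (arrow_elt k e l).
Hypothesis C : cyclic_module kappa (vertex_elt k l) X a d 'X^d v.
Variables (R : Chat k) (M : lift_data V R).
Local Notation T := (tensor_alg R L).
Local Notation iota := (@tens_l k R L : {rmorphism R -> T}).
Local Notation ev := (peval iota (tens_arrow e l R)).
Local Notation N := (restrict iota M : lmodType R).

(* Nakayama's lemma by hand: an [R]-basis [b] of [M] satisfies [b = Cm x + D b], where
   [x] consists of the [X ^+ j *: m] and [D] has entries in the maximal ideal, so that
   [1 - D] is invertible.  Invertible matrices are square, whence [x] is a basis. *)
Lemma lift_poly_exists : is_lift M -> exists f, lift_poly a d v M f.
Proof.
move=> ML; have MR := is_lift_red_linear ML; case: ML => Mfg Mfree _ _ Mbij.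
have H := tens_circular e l R.
(* Any element over v, projected to the vertex a, still lies over v because v sits at a. *)
have [m [mE mv]] : exists m : M, tens_vertex l R a *: m = m /\ red1 m = v.
  have [x xv] : exists x, lift_red (l := M) x = v.
    by have [h _ hK] := Mbij; exists (h v).
  have [m0 xE] := bpure1_surj x; exists (tens_vertex l R a *: m0).
  split; first by rewrite scalerA (circ_orth H) eqxx.
  by rewrite red1_tens_r // /red1 -xE xv (cyc_vertex C).
have [r [b [bspan bfree]]] : exists r (b : 'I_r -> N),
    (forall y, exists c, y = comb c b) /\ (forall c, comb c b = 0 -> c = 0).
  have [n0 [g gspan]] := circ_fin_gen H Mfg.
  exact: (@finite_basis R N n0 g Mfree gspan).
pose res (A : R) : k := residue R A.
pose x (j : 'I_d) : N := tens_arrow e l R ^+ j *: m.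
pose xk (j : 'I_d) : restrict kappa V := X ^+ j *: v.
have redx j : red1 (x j : M) = xk j.
  by rewrite /x tens_arrowX red1_tens_r // mv.
have redcomb n0 (c : 'rV[R]_n0) (y : 'I_n0 -> N) :
    red1 (comb c y : M) = comb (map_mx res c) (fun i => red1 (y i : M) :
      restrict kappa V).
  rewrite [LHS]red1_sum //; apply: eq_bigr => i _.
  by rewrite mxE [LHS]red1_tens_l.
have xkspan (y : V) : exists c, y = comb c xk.
  have [p sp ->] := cyc_gen C y; exists (\row_i p`_i).
  rewrite (peval_widen _ _ sp) scaler_suml; apply: eq_bigr => i _.
  by rewrite mxE [RHS]scalerA.
have xkfree (c : 'rV[k]_d) : comb c xk = 0 -> c = 0.
  move=> c0; pose p := \poly_(i < d) (if insub i is Some j then c 0 j else 0).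
  have p0 : p = 0.
    apply: (cyc_free C); first exact: size_poly.
    rewrite (peval_widen _ _ (size_poly _ _)) scaler_suml -[RHS]c0.
    by apply: eq_bigr => i _; rewrite coef_poly ltn_ord valK [RHS]scalerA.
  apply/rowP => i; have := congr1 (fun p : {poly k} => p`_i) p0.
  by rewrite coef_poly ltn_ord valK coef0 mxE.
have sepb (c c' : 'rV[R]_r) : comb c b = comb c' b -> c = c'.
  by move=> E; apply/eqP; rewrite -subr_eq0; apply/eqP/bfree; rewrite combB E subrr.
have sepxk (c c' : 'rV[k]_d) : comb c xk = comb c' xk -> c = c'.
  by move=> E; apply/eqP; rewrite -subr_eq0; apply/eqP/xkfree; rewrite combB E
    subrr.
(* An element that reduces to 0 has all its coordinates in the maximal ideal: the coordinates taken
   modulo that ideal factor through the tensor product with k, on which the reduction map is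
   injective. *)
have red0 (y : N) : red1 (y : M) = 0 -> exists c, map_mx res c = 0 /\ y = comb c b.
  have [co coE] := choice bspan.
  pose F i (c : k^o) (y : M) : k := c * res (co y 0 i).
  have FB i : balanced (fun (s : R) (c : k^o) => c * residue R s)
      (fun s (y : M) => tens_l L s *: y) (F i).
    split=> [c c' z|c z z'|s c z]; first exact: mulrDl.
    - rewrite /F (sepb (co (z + z')) (co z + co z')) ?mxE ?[res _]rmorphD
      ?mulrDr //.
      by rewrite combD -!coE.
    - rewrite /F (sepb (co (tens_l L s *: z)) (s *: co z)) ?mxE ?[res (_ *
      _)]rmorphM ?mulrA //.
      by rewrite combZ -!coE.
  move=> y0; exists (co y); split=> //; apply/rowP => i; rewrite !mxE.
  have E : bpure (residue R) 1 (y : M) = bpure (residue R) 1 (0 : M).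
    have [h hK _] := Mbij; apply: (can_inj hK); rewrite -[LHS]/(red1 (y : M)) y0.
    have := red1D MR 0 0; rewrite addr0 => /eqP.
    by rewrite -subr_eq0 opprD addrA subrr sub0r oppr_eq0 => /eqP.
  have := congr1 (tlift (F i)) E; rewrite !tliftE // /F !mul1r => ->.
  rewrite (sepb (co 0) 0) ?mxE ?[res 0]rmorph0 //.
  by rewrite -coE /comb big1 // => j _; rewrite mxE scale0r.
have [A AE] := choice (fun j => bspan (x j)).
have [Ck CkE] := choice (fun i => xkspan (red1 (b i : M))).
pose Cm := \matrix_i map_mx (fun c => c%:A : R) (Ck i).
have [D [D0 DE]] : exists D : 'M[R]_r, map_mx res D = 0 /\
    forall i, b i = comb (row i Cm) x + comb (row i D) b.
  have ex i : exists c, map_mx res c = 0 /\ b i - comb (row i Cm) x = comb c b.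
    apply: red0; have E := red1D MR (b i - comb (row i Cm) x) (comb (row i Cm) x).
    rewrite subrK redcomb CkE in E; apply: (addIr (comb (Ck i) xk)).
    rewrite add0r [RHS]E; congr (_ + _); rewrite rowK -map_mx_comp.
    rewrite (eq_comb _ (y := xk)) // (_ : map_mx _ _ = Ck i) //.
    by apply/rowP => j; rewrite mxE /= [res _]residue_alg.
  have [D DP] := choice ex; exists (\matrix_i D i); split=> [|i].
    by apply/row_matrixP => i; rewrite -map_row rowK row0; case: (DP i).
  by rewrite rowK; have [_ <-] := DP i; rewrite addrC subrK.
have [Pm PmE] : exists Pm : 'M[R]_r, Pm *m (1%:M - D) = 1%:M.
  have [|u uE] := (Chat_local (\det (1%:M - D))).1.
    have -> : residue R (\det (1%:M - D)) = \det (map_mx (residue R :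
      {rmorphism R -> k}) (1%:M - D)).
      by rewrite det_map_mx.
    by rewrite map_mxB map_mx1 [map_mx _ D]D0 subr0 det1; apply/eqP/oner_neq0.
  by exists (u *: \adj (1%:M - D)); rewrite -scalemxAl mul_adj_mx
    scale_scalar_mx mulrC uE.
pose C' := Pm *m Cm.
have bE i : b i = comb (row i C') x.
  rewrite /C' row_mul comb_mulmx -[LHS]comb_delta -row1 -PmE row_mul comb_mulmx.
  apply: eq_comb => i'; rewrite linearB /= combB row1 comb_delta {1}DE addrK //.
have C'A : C' *m \matrix_j A j = 1%:M.
  apply/row_matrixP => i; rewrite row_mul row1; apply: sepb.
  rewrite comb_mulmx comb_delta bE; apply: eq_comb => j.
  by rewrite rowK -AE.
(* Over R the product in this order is not yet available, since independence of x is the goal. Over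
   k it follows from independence of the X^j v, and suffices for d <= r. *)
have AC'k : map_mx res (\matrix_j A j) *m map_mx res C' = 1%:M.
  apply/row_matrixP => j; rewrite row_mul row1; apply: sepxk.
  rewrite comb_mulmx comb_delta -redx AE redcomb -map_row rowK; apply: eq_comb => i.
  rewrite [in RHS]bE redcomb -map_row; apply: eq_comb => j'.
  by rewrite -redx.
have rd : r = d by apply/eqP; rewrite eqn_leq (mulmx1_min C'A) (mulmx1_min AC'k).
have AC' : (\matrix_j A j) *m C' = 1%:M.
  by move: (C') (\matrix_j A j) C'A; rewrite rd => C1 A1; apply: mulmx1C.
have evcomb (p : {poly R}) : (size p <= d)%N -> ev p *: m = comb (\row_i p`_i) x.
  move=> sp; rewrite (peval_widen _ _ sp) scaler_suml; apply: eq_bigr => i _.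
  by rewrite mxE [RHS]scalerA.
have gen (y : M) : exists2 p : {poly R}, (size p <= d)%N & y = ev p *: m.
  have [c yE] := bspan y.
  pose p := \poly_(i < d) (if insub i is Some j then (c *m C') 0 j else 0).
  exists p; first exact: size_poly.
  rewrite evcomb ?size_poly // (_ : \row_i p`_i = c *m C').
    by rewrite comb_mulmx [LHS]yE (eq_comb c bE).
  by apply/rowP => i; rewrite mxE coef_poly ltn_ord valK.
have [p sp pE] := gen (tens_arrow e l R ^+ d *: m).
have spd : (size p < size ('X^d : {poly R}))%N by rewrite size_polyXn ltnS.
exists ('X^d - p), m; split=> //; split=> //.
- by rewrite monicE lead_coefDl ?size_polyN // lead_coefXn.
- by rewrite size_polyDl ?size_polyN // size_polyXn.
- by rewrite pevalB scalerBl pevalXn pE subrr.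
move=> q sq; rewrite evcomb // => q0.
have qA : \row_i q`_i *m \matrix_j A j = 0 :> 'rV_r.
  apply: bfree; rewrite comb_mulmx -[RHS]q0; apply: eq_comb => j.
  by rewrite rowK -AE.
have q0' : \row_(i < d) q`_i = 0 by rewrite -[LHS]mulmx1 -AC' mulmxA qA mul0mx.
apply/polyP => j; rewrite coef0; have [jd|dj] := ltnP j d; last first.
  by rewrite nth_default // (leq_trans sq).
by have := congr1 (fun u : 'rV_d => u 0 (Ordinal jd)) q0'; rewrite !mxE.
Qed.

End LiftPolynomial.

(** * Existence of lifts *)

Section AlgebraMorphisms.
Variables (k : fieldType) (e l : nat).
Local Notation Q := (circular_quiver e).
Local Notation PA := (path_alg k Q).
Local Notation L := (Nalg k e l).

Lemma path_target_iter (p : qpath Q) :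
  path_target p = iter (size (val p).2) (@ordS e) (path_source p).
Proof.
case: p => -[v s] w; rewrite /path_target /path_source /=.
elim: s v w => //= b s IH v /andP[/eqP bv w].
by have <- : b = v := bv; rewrite (IH _ w) -iterSr.
Qed.

Lemma arrow_sum_commute (u : PA) : exists u', u * arrow_sum k e = arrow_sum k e
  * u'.
Proof.
have vc b : exists u', vertex_path k b * arrow_sum k e = arrow_sum k e * u'.
  exists (vertex_path k (ord_pred b)); by rewrite arrow_sum_shift ord_predK.
elim/path_alg_ind: u => [|p|x y [x' ex] [y' ey]|c x [x' ex]].
- by exists 0; rewrite mul0r mulr0.
- rewrite path_eltE; have [u uE] := vc (path_source p).
  exists (arrow_sum k e ^+ size (val p).2 * u).
  by rewrite -mulrA uE !mulrA -exprSr exprS.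
- by exists (x' + y'); rewrite mulrDl ex ey mulrDr.
exists (c *: x'); rewrite -[LHS]/(path_mul (c *: x) _) path_mulZl.
by rewrite -[RHS]/(path_mul _ (c *: x')) path_mulZr; congr (_ *: _).
Qed.

Lemma arrow_sumX_commute n (u : PA) :
  exists u', u * arrow_sum k e ^+ n = arrow_sum k e ^+ n * u'.
Proof.
elim: n u => [|n IH] u; first by exists u; rewrite mulr1 mul1r.
have [u1 E1] := arrow_sum_commute u; have [u2 E2] := IH u1.
by exists u2; rewrite exprS mulrA E1 -mulrA E2 !mulrA -exprS.
Qed.

(** X is normal, in that each u X is some X u', and each arrow is X times a vertex. Hence a morphism
    from the path algebra that kills X^l factors through [Nalg]. *)
Lemma ideal_pow_arrow n (x : PA) : ideal_pow (@arrow_ideal k Q) n x ->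
  exists u, x = arrow_sum k e ^+ n * u.
Proof.
have II m : is_ideal (fun x : PA => exists u, x = arrow_sum k e ^+ m * u).
  split=> [|_ _ [u ->] [w ->]|y z _ [u ->]]; first by exists 0; rewrite mulr0.
    by exists (u + w); rewrite mulrDr.
  have [y' E] := arrow_sumX_commute m y.
  by exists (y' * u * z); rewrite (mulrA y) E !mulrA.
apply: (ideal_gen_min (II n)) => _ [s [<- sP ->]].
elim: s sP => [|y s IH] sP; first by exists 1; rewrite big_nil mulr1.
have [u uE] := IH (fun z zs => sP z (mem_behead (s := y :: s) zs)).
have [w wE] : exists w, y = arrow_sum k e ^+ 1 * w.
  apply: (ideal_gen_min (II 1%N)) (sP y (mem_head _ _)) => _ [b ->].
  exists (vertex_path k b); rewrite expr1 -[vertex_path k b]/(path_elt k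
    (@trivial_path Q b)).
  by apply/esym/arrow_sum_mul.
have [w' E] := arrow_sumX_commute (size s) w.
by exists (w' * u); rewrite big_cons uE wE -mulrA (mulrA w) E expr1 !mulrA -exprS.
Qed.

Variables (B : pzRingType) (iota : {rmorphism k -> B}) (E : 'I_e -> B) (X : B).
Hypothesis iotaC : forall c x, iota c * x = x * iota c.
Hypothesis orth : forall a b, E a * E b = if a == b then E a else 0.
Hypothesis sumE : \sum_b E b = 1.
Hypothesis shift : forall b, X * E b = E (ordS b) * X.
Hypothesis nilX : X ^+ l = 0.

Let shiftX b j : X ^+ j * E b = E (iter j (@ordS e) b) * X ^+ j.
Proof.
elim: j => [|j IH]; first by rewrite mul1r mulr1.
by rewrite exprS -mulrA IH mulrA shift -mulrA.
Qed.

Let Bk : lmodType k := restrict iota (B^o : lmodType B).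

Let path_val (p : qpath Q) : Bk := X ^+ size (val p).2 * E (path_source p).

Lemma path_alg_hom : exists rho : {rmorphism PA -> B},
  [/\ forall c, rho (kin c) = iota c, forall b, rho (vertex_path k b) = E b
    & rho (arrow_sum k e) = X].
Proof.
pose rho (x : PA) : B := fglift path_val x.
have rhoB : zmod_morphism rho by move=> x y; exact: (lift_is_additive path_val x y).
pose rhoz : {additive PA -> B} := HB.pack rho (GRing.isZmodMorphism.Build _ _
  rho rhoB).
have rhoZ c x : rho (c *: x) = iota c * rho x by exact: (fgliftZ path_val c x).
have rhop p : rho (path_elt k p) = path_val p by exact: (fgliftU1 path_val p).
have rhov b : rho (vertex_path k b) = E b by rewrite rhop [LHS]mul1r.
have rhoM : monoid_morphism rho.
  split.
    rewrite -[1]/(\sum_(b : 'I_e) vertex_path k b) [LHS](raddf_sum rhoz) -sumE.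
    by apply: eq_bigr => b _; apply: rhov.
  move=> x y; elim/path_alg_ind: x => [|p|x x' ex ex'|c x ex].
  - by rewrite mul0r [rho 0](raddf0 rhoz) mul0r.
  - elim/path_alg_ind: y => [|q|y y' ey ey'|c y ey].
    + by rewrite mulr0 [rho 0](raddf0 rhoz) mulr0.
    + rewrite [path_elt k p * _]path_mulE !rhop /path_val.
      rewrite -mulrA (mulrA (E _)).
      have -> : E (path_source p) * X ^+ size (val q).2 * E (path_source q) =
          if path_source p == path_target q then X ^+ size (val q).2 * E
            (path_source q) else 0.
        rewrite -mulrA shiftX mulrA orth -path_target_iter.
        by case: eqP => [->|_]; rewrite ?mul0r // path_target_iter -shiftX.
      case: eqP => [pq|npq]; last by rewrite path_compN //= mulr0 [rho
        0](raddf0 rhoz).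
      have [r -> rE] := path_compT pq; rewrite /= rhop /path_val rE size_cat.
      by rewrite -[path_source r]/((val r).1) rE /= mulrA -exprD addnC.
    + by rewrite mulrDr [LHS](raddfD rhoz) [rho (y + y')](raddfD rhoz) mulrDr
      -ey -ey'.
    + have -> : path_elt k p * (c *: y) = c *: (path_elt k p * y) by apply:
      path_mulZr.
      by rewrite !rhoZ ey mulrA iotaC mulrA.
  - by rewrite mulrDl [LHS](raddfD rhoz) [rho (x + x')](raddfD rhoz) mulrDl -ex
    -ex'.
  - have -> : (c *: x) * y = c *: (x * y) by apply: path_mulZl.
    by rewrite !rhoZ ex mulrA.
pose rhor : {rmorphism PA -> B} := HB.pack rho
  (GRing.isZmodMorphism.Build _ _ rho rhoB) (GRing.isMonoidMorphism.Build _ _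
    rho rhoM).
exists rhor; split=> //.
  by move=> c; rewrite [LHS]rhoZ rhoM.1 mulr1.
rewrite [LHS](raddf_sum rhoz) -[RHS]mulr1 -sumE mulr_sumr; apply: eq_bigr => b _.
exact: rhop.
Qed.

(** The relations of [circular_alg] present the algebra N(e,l), so a representation is given by
    matrices for the vertices and for X. *)
Lemma Nalg_hom : exists rho : {rmorphism L -> B},
  [/\ forall c, rho (kin c) = iota c, forall b, rho (vertex_elt k l b) = E b
    & rho (arrow_elt k e l) = X].
Proof.
have [rho [rhok rhov rhox]] := path_alg_hom.
pose pr := qproj (ideal_pow (@arrow_ideal k Q) l).
pose sig (u : L) : B := rho (repr (u : algquot _)).
have rho0 x : ideal_gen (ideal_pow (@arrow_ideal k Q) l) x -> rho x = 0.
  have KI : is_ideal (fun x => rho x = 0).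
    split=> [|y z y0 z0|y z w w0]; first exact: rmorph0.
      by rewrite rmorphD y0 z0 addr0.
    by rewrite !rmorphM w0 mulr0 mul0r.
  apply: (ideal_gen_min KI) => y /ideal_pow_arrow[u ->].
  by rewrite rmorphM rmorphXn rhox nilX mul0r.
have sigE x : sig (pr x) = rho x.
  apply/eqP; rewrite -subr_eq0 -rmorphB; apply/eqP/rho0.
  by apply/qproj_eq; rewrite /qproj reprK.
have sigB : zmod_morphism sig.
  move=> u w; have [x ->] := qproj_surj u; have [y ->] := qproj_surj w.
  by rewrite -[_ - _](rmorphB pr) !sigE rmorphB.
have sigM : monoid_morphism sig.
  split=> [|u w]; first by rewrite -[1](rmorph1 pr) sigE rmorph1.
  have [x ->] := qproj_surj u; have [y ->] := qproj_surj w.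
  by rewrite -[_ * _ in LHS](rmorphM pr) !sigE rmorphM.
pose sigr : {rmorphism L -> B} := HB.pack sig
  (GRing.isZmodMorphism.Build _ _ sig sigB) (GRing.isMonoidMorphism.Build _ _
    sig sigM).
exists sigr; split.
- by move=> c; rewrite [LHS]sigE.
- by move=> b; rewrite [LHS]sigE.
- by rewrite [LHS]sigE.
Qed.

End AlgebraMorphisms.

Lemma tensor_alg_hom (k : fieldType) (R : comAlgType k) (L : pzAlgType k) (B :
  pzRingType)
    (iota : {rmorphism R -> B}) (rho : {rmorphism L -> B}) :
  (forall r x, iota r * x = x * iota r) -> (forall c, rho (kin c) = iota c%:A) ->
  exists sig : {rmorphism tensor_alg R L -> B},
    (forall r, sig (tens_l L r) = iota r) /\ (forall u, sig (tens_r R u) = rho u).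
Proof.
move=> iotaC rhok; pose F r u : B := iota r * rho u.
have FB : balanced (fun (c : k) (r : R) => c *: r) (fun c (u : L) => kin c * u) F.
  split=> [r r' u|r u u'|c r u]; rewrite /F ?rmorphD ?mulrDl ?mulrDr //.
  by rewrite rmorphM rhok mulrA -rmorphM mulr_algr.
pose sig (x : tensor_alg R L) : B := tlift F x.
have sigE r u : sig (tpair r u) = F r u by apply: tliftE.
have sigD x y : sig (x + y) = sig x + sig y by apply: tliftD.
have sig0 : sig 0 = 0 by apply: (addrI (sig 0)); rewrite -sigD !addr0.
have sigB : zmod_morphism sig.
  by move=> x y; apply: (addIr (sig y)); rewrite -sigD !subrK.
have sigM : monoid_morphism sig.
  split; first by rewrite -[1]/(tpair 1 1) sigE /F !rmorph1 mulr1.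
  move=> x y; elim/tensor_ind: x => [r u|x x' ex ex']; last first.
    by rewrite mulrDl !sigD mulrDl ex ex'.
  elim/tensor_ind: y => [r' u'|y y' ey ey']; last by rewrite mulrDr !sigD
    mulrDr ey ey'.
  rewrite -[tpure _ _ r u]/(tpair r u) -[tpure _ _ r' u']/(tpair r' u') tpairM
    !sigE /F.
  by rewrite !rmorphM -!mulrA; congr (_ * _); rewrite !mulrA iotaC.
pose sigr : {rmorphism tensor_alg R L -> B} := HB.pack sig
  (GRing.isZmodMorphism.Build _ _ sig sigB) (GRing.isMonoidMorphism.Build _ _
    sig sigM).
exists sigr; split=> [r|u]; first by rewrite [LHS]sigE /F rmorph1 mulr1.
by rewrite [LHS]sigE /F rmorph1 mul1r.
Qed.

(** A copy of the type of columns, which keeps the action of the matrix ring apart from the scaling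
    by R. *)
Definition col_module (R : comNzRingType) (d : nat) : Type := 'cV[R]_d.

Section ColumnModule.
Variables (R : comNzRingType) (d : nat).
Local Notation N := (col_module R d).

HB.instance Definition _ := GRing.Zmodule.on N.

Definition col_scale (A : 'M[R]_d) (v : N) : N := A *m v.

Fact col_scaleA A B v : col_scale A (col_scale B v) = col_scale (A * B) v.
Proof. exact: mulmxA. Qed.

Fact col_scale1 : left_id 1 col_scale. Proof. exact: mul1mx. Qed.

Fact col_scaleDr : right_distributive col_scale +%R.
Proof. by move=> A u v; apply: mulmxDr. Qed.

Fact col_scaleDl v : {morph col_scale^~ v : A B / A + B}.
Proof. by move=> A B; apply: mulmxDl. Qed.

HB.instance Definition _ := GRing.Zmodule_isLmodule.Build 'M[R]_d N
  col_scaleA col_scale1 col_scaleDr col_scaleDl.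

End ColumnModule.

(** * Modules with a prescribed polynomial *)

Section UniversalModule.
Variables (k : fieldType) (e l : nat) (R : comAlgType k).
Local Notation L := (Nalg k e l).
Local Notation T := (tensor_alg R L).
Local Notation iota := (@tens_l k R L : {rmorphism R -> T}).
Local Notation ev := (peval iota (tens_arrow e l R)).

(** R[X]/(f) in coordinates: X acts by the companion matrix, and the class of X^j is put at the
    vertex j steps after a. *)
Lemma cyclic_module_exists (a : 'I_e) d (f : {poly R}) : (0 < d)%N ->
  deform_poly e l d f ->
  exists (M : lmodType T) (m : M),
    cyclic_module iota (tens_vertex l R) (tens_arrow e l R) a d f m.
Proof.
case: d => // d _ [fm sf hf [q fl]].
pose Cx : 'M[R]_d.+1 := companion d.+1 f.
pose sh j := iter j (@ordS e) a.
pose Eb (b : 'I_e) : 'M[R]_d.+1 := diag_mx (\row_i (sh i == b)%:R).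
pose scal := @scalar_mx R d.+1 : {rmorphism R -> 'M[R]_d.+1}.
have scalC c (A : 'M[R]_d.+1) : scal c * A = A * scal c by exact/esym/scalar_mxC.
pose iotak : {rmorphism k -> 'M[R]_d.+1} := scal \o GRing.in_alg R.
have iotaC c (A : 'M[R]_d.+1) : iotak c * A = A * iotak c by apply: scalC.
have [||||rho [rhok rhoE rhoX]] := @Nalg_hom k e l _ iotak Eb Cx iotaC.
- move=> b b'; rewrite [LHS]mulmx_diag; case: eqP => [<-|ne].
    by congr diag_mx; apply/rowP => i; rewrite !mxE; case: eqP; rewrite
      !(mulr0, mulr1).
  apply/matrixP => i j; rewrite !mxE; case: eqP => [->|]; last by rewrite mul0r
    mul0rn.
  by case: eqP => [/ne//|_]; rewrite mulr0 mul0rn.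
- apply/matrixP => i j; rewrite summxE (bigD1 (sh i)) //= big1 ?addr0.
    by rewrite !mxE eqxx.
  by move=> b /negbTE bi; rewrite !mxE eq_sym bi mul0rn.
- move=> b; rewrite [LHS]mul_mx_diag [RHS]mul_diag_mx; apply/matrixP => i j;
  rewrite !mxE.
  have shS s t : (s = t.+1 %[mod e]) -> (sh s == ordS b) = (sh t == b).
    move=> st; rewrite -(inj_eq (can_inj (@ordSK e)) (sh t)) -[ordS (sh t)]/(sh
      t.+1).
    by congr (_ == _); apply/eqP; rewrite iter_ordS_eq; apply/eqP.
  (* Outside the last column, X moves a basis vector to the next one. A nonzero entry of the last
     column lies in a row i congruent to d + 1 modulo e by [hf], so it also leads to the next
     vertex. *)
  have [jd|jd] := eqVneq j.+1 d.+1; last first.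
    have [ij|_] := eqVneq (i : nat) j.+1; last by rewrite !(mulr0, mul0r).
    by rewrite (shS i j) ?ij // mulrC.
  have [fi|/eqP fi] := eqVneq f`_i 0; first by rewrite fi oppr0 mulr0 mul0r.
  by rewrite (shS i j); [apply: mulrC | rewrite jd; apply: hf].
- by apply/(companion_exp_eq0 l fm sf); exists q.
have [sig [sigl sigr]] := tensor_alg_hom scalC rhok.
pose M := restrict sig (col_module R d.+1) : lmodType T.
have evE (p : {poly R}) (v : M) : ev p *: v = (peval scal Cx p *m v : 'cV[R]_d.+1).
  rewrite -[LHS]/(sig (ev p) *m v); congr (_ *m _).
  rewrite /peval rmorph_sum; apply: eq_bigr => j _.
  by rewrite rmorphM rmorphXn /= sigl sigr rhoX.
pose m : M := (delta_mx ord0 0 : 'cV[R]_d.+1).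
have evm (p : {poly R}) : (size p <= d.+1)%N -> ev p *: m = (\col_i p`_i :
  'cV[R]_d.+1).
  by move=> sp; rewrite evE peval_companion_delta.
exists M, m; split=> //.
- rewrite -[LHS]/(sig (tens_r R (vertex_elt k l a)) *m m) sigr rhoE.
  rewrite mul_diag_mx; apply/matrixP => i j; rewrite !mxE ord1 eqxx andbT.
  by have [->|_] := eqVneq i ord0; rewrite ?mulr0 // /sh /= eqxx mulr1.
- rewrite evE (_ : peval _ _ _ = 0) ?mul0mx //.
  by apply/peval_companion_eq0 => //; exists 1; rewrite mul1r.
- move=> y; pose p := \poly_(i < d.+1) (if insub i is Some j then (y :
  'cV_d.+1) j 0 else 0).
  exists p; first exact: size_poly.
  rewrite evm ?size_poly //; apply/matrixP => i j.
  by rewrite mxE coef_poly ltn_ord valK ord1.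
move=> p sp; rewrite evm // => p0; apply/polyP => j; rewrite coef0.
have [jd|dj] := ltnP j d.+1; last by rewrite nth_default // (leq_trans sp).
by have := congr1 (fun u : 'cV[R]_d.+1 => u (Ordinal jd) 0) p0; rewrite !mxE.
Qed.

End UniversalModule.

Section CyclicLift.
Variables (k : fieldType) (e l : nat).
Local Notation L := (Nalg k e l).
Variables (V : lmodType L) (a : 'I_e) (d : nat) (v : V).
Local Notation kappa := (@kin k L : {rmorphism k -> L}).
Local Notation X := (arrow_elt k e l).
Local Notation evk := (peval kappa X).
Hypothesis C : cyclic_module kappa (vertex_elt k l) X a d 'X^d v.
Variables (R : Chat k) (f : {poly R}).
Local Notation T := (tensor_alg R L).
Local Notation iota := (@tens_l k R L : {rmorphism R -> T}).
Local Notation ev := (peval iota (tens_arrow e l R)).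
Variables (M : lmodType T) (m : M).
Hypothesis CM : cyclic_module iota (tens_vertex l R) (tens_arrow e l R) a d f m.

Let H := tens_circular e l R.
Let Hk := Nalg_circular k e l.

Lemma cyclic_free : free_module (restrict iota M).
Proof.
pose x (j : nat) : restrict iota M := tens_arrow e l R ^+ j *: m.
pose B y := exists2 j, (j < d)%N & y = x j.
exists B; split.
  move=> y; have [p sp ->] := cyc_gen CM y.
  exists [seq (p`_i, x i) | i <- index_iota 0 d]; split.
    move=> z /mapP[i]; rewrite mem_index_iota => /andP[_ id] ->.
    exact: (ex_intro2 _ _ i id erefl).
  rewrite big_map big_mkord (peval_widen _ _ sp) scaler_suml.
  by apply: eq_bigr => i _; rewrite [RHS]scalerA.
move=> s us sB s0.
have [ix ixP] : exists ix : restrict iota M -> nat, forall y, B y -> (ix y <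
  d)%N /\ y = x (ix y).
  suff ex (y : restrict iota M) : exists j, B y -> (j < d)%N /\ y = x j.
    by have [ix ixP] := choice ex; exists ix.
  by have [[j jd yE]|nB] := pselect (B y); [exists j | exists 0%N].
pose q : {poly R} := \sum_(p <- s) p.1 *: 'X^(ix p.2).
have q0 : q = 0.
  apply: (cyc_free CM).
    rewrite /q big_seq; apply: (big_ind (fun q : {poly R} => (size q <= d)%N)).
    - by rewrite size_poly0.
    - by move=> p p' sp sp'; rewrite (leq_trans (size_polyD _ _)) // geq_max sp.
    - move=> p /sB/ixP[lt _]; rewrite (leq_trans (size_scale_leq _ _)) //.
      by rewrite size_polyXn.
  rewrite -[RHS]s0 /q big_seq [RHS]big_seq.
  elim/big_rec2: _ => [|p y q' /sB/ixP[_ pE] <-]; first by rewrite peval0 scale0r.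
  rewrite pevalD scalerDl pevalZ pevalXn -scalerA; congr (_ + _).
  by rewrite [in RHS]pE.
move=> p ps; have := congr1 (fun q : {poly R} => q`_(ix p.2)) q0.
rewrite coef0 coef_sum (bigD1_seq p) ?(map_uniq us) //= coefZ coefXn eqxx mulr1.
rewrite big_seq_cond big1 ?addr0 // => p' /andP[ps' pp'].
rewrite coefZ coefXn; case: eqP => [E|]; last by rewrite mulr0.
case/eqP: pp'; have [_ E1] := ixP _ (sB _ ps); have [_ E2] := ixP _ (sB _ ps').
have i1 : (index p s < size [seq p.2 | p <- s])%N by rewrite size_map index_mem.
have i2 : (index p' s < size [seq p.2 | p <- s])%N by rewrite size_map index_mem.
have := nth_uniq 0 i1 i2 us; rewrite !(nth_map p) ?index_mem // !nth_index //.
rewrite E1 E2 E eqxx => /esym/eqP Ei.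
by rewrite -(nth_index p ps') -Ei nth_index.
Qed.

Hypothesis f0 : map_poly (residue R) f = 'X^d.

Local Notation rp := (map_poly (residue R)).

(* The semilinear map [p(X) m |-> p(X) v], where [p] is reduced modulo the maximal
   ideal; it induces the isomorphism from the reduction of [M] to [V]. *)
Lemma cyclic_reduction : exists g : M -> V,
  [/\ forall p, g (ev p *: m) = evk (rp p) *: v,
    forall y z, g (y + z) = g y + g z,
    forall r y, g (tens_l L r *: y) = kin (residue R r) *: g y
    & forall u y, g (tens_r R u *: y) = u *: g y].
Proof.
have ex (y : M) : exists p, y = ev p *: m by have [p _ ->] := cyc_gen CM y;
  exists p.
have [co coE] := choice ex; pose g y : V := evk (rp (co y)) *: v.
have gE p : g (ev p *: m) = evk (rp p) *: v.
  have [r rE] := (cyc_eq H CM _ _).1 (esym (coE (ev p *: m))).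
  rewrite /g rE rmorphD rmorphM /= f0 pevalD (circ_pevalM Hk) scalerDl -[X in _
    + X]scalerA.
  by rewrite (cyc_rel C) scaler0 addr0.
have gD y z : g (y + z) = g y + g z.
  rewrite (coE y) (coE z) -scalerDl -pevalD !gE rmorphD pevalD scalerDl; by [].
have gR r y : g (tens_l L r *: y) = kin (residue R r) *: g y.
  by rewrite (coE y) scalerA -pevalZ !gE map_polyZ pevalZ scalerA.
have gX y : g (tens_arrow e l R *: y) = X *: g y.
  rewrite (coE y) scalerA -{1}(pevalX iota (tens_arrow e l R)) -(circ_pevalM H) !gE.
  by rewrite rmorphM /= map_polyX (circ_pevalM Hk) pevalX scalerA.
have gV b y : g (tens_vertex l R b *: y) = vertex_elt k l b *: g y.
  rewrite (coE y) (vertex_part_scale H CM) !gE (vertex_part_scale Hk C).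
  congr (peval _ _ _ *: _); apply/polyP => j.
  rewrite (coef_map (residue R)) !coef_vertex_part (coef_map (residue R)).
  by case: ifP => // _; apply: rmorph0.
have g0 : g 0 = 0 by apply: (addrI (g 0)); rewrite -gD !addr0.
have gS I (s : seq I) (F : I -> M) : g (\sum_(i <- s) F i) = \sum_(i <- s) g (F i).
  by elim/big_rec2: _ => // i y z _ <-; rewrite gD.
have gXn j y : g (tens_arrow e l R ^+ j *: y) = X ^+ j *: g y.
  by elim: j => [|j IH]; rewrite ?scale1r // !exprS -!scalerA gX IH.
exists g; split=> // u y; have [c ->] := circ_span Hk u.
rewrite rmorph_sum !scaler_suml gS; apply: eq_bigr => b _.
rewrite rmorph_sum !scaler_suml gS; apply: eq_bigr => j _.
rewrite !rmorphM rmorphXn /= tens_kin -!scalerA gR residue_alg.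
by congr (_ *: _); rewrite -gV -gXn.
Qed.

(** Every element of the reduction is 1 tensor p(X) m with p of degree below d. If p(X) v = 0 after
    reduction, the coefficients of p lie in the maximal ideal and move across the tensor sign to
    become 0. *)
Lemma cyclic_is_lift : exists U : lift_data V R, is_lift U /\ lift_poly a d v U f.
Proof.
have [g [gE gD gR gL]] := cyclic_reduction.
pose F (c : k^o) (y : M) : V := kin (c : k) *: g y.
have FB : balanced (fun (s : R) (c : k^o) => c * residue R s)
    (fun s (y : M) => tens_l L s *: y) F.
  split=> [c c' y|c y z|s c y]; rewrite /F ?gD ?scalerDr //.
    by rewrite [kin _]rmorphD scalerDl.
  by rewrite gR scalerA -rmorphM.
pose red (x : base_change (residue R) M) : V := tlift F x.
have redE c y : red (bpure (residue R) c y) = kin (c : k) *: g y by apply: tliftE.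
have redD x y : red (x + y) = red x + red y by apply: tliftD.
have redL u x : red (tens_r k^o u *: x) = u *: red x.
  elim/tensor_ind: x => [c y|x x' ex ex']; last by rewrite scalerDr !redD
    scalerDr ex ex'.
  rewrite -[tpure _ _ _ _]/(bpure (residue R) c y) [_ *: _ in LHS]bscaleE mul1r
    !redE.
  by rewrite gL !scalerA kin_central.
have red1E y : red (bpure (residue R) 1 y) = g y by rewrite redE rmorph1 scale1r.
have bp0 (y : M) : bpure (residue R) 0 y = 0 by apply: tpure0.
have b1D (y z : M) : bpure (residue R) 1 (y + z) = bpure (residue R) 1 y +
  bpure (residue R) 1 z.
  exact: tpureDr.
have redI x : red x = 0 -> x = 0.
  have [y ->] := bpure1_surj x; rewrite red1E; have [p sp ->] := cyc_gen CM y.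
  rewrite gE => /(cyc_free C) p0.
  have {}p0 : rp p = 0 by apply: p0; rewrite (leq_trans (size_poly _ _)).
  have b10 : bpure (residue R) 1 (0 : M) = 0.
    by apply: (addrI (bpure (residue R) 1 (0 : M))); rewrite -b1D !addr0.
  rewrite /peval scaler_suml; apply: (big_ind (fun y => bpure (residue R) 1 y =
    0)) => //.
    by move=> y1 y2 e1 e2; rewrite b1D e1 e2 addr0.
  move=> i _; rewrite -scalerA -bpureM mul1r.
  have -> : residue R p`_i = 0; last exact: bp0.
  by rewrite -(coef_map (residue R)) p0 coef0.
have redS w : exists x, red x = w.
  have [p _ ->] := cyc_gen C w; pose q := map_poly (GRing.in_alg R) p.
  exists (bpure (residue R) 1 (ev q *: m)); rewrite red1E gE; congr (peval _ _
    _ *: _).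
  apply/polyP => j; rewrite (coef_map (residue R)) coef_map; exact: residue_alg.
exists (@LiftData k L V R M red); split; last first.
  exists m; split=> //; rewrite /red1 [LHS]red1E.
  have := gE 1; rewrite rmorph1 -!polyC1 !pevalC !rmorph1 !scale1r; by [].
split=> //.
- exists [:: m] => y; have [p _ ->] := cyc_gen CM y; exists (fun=> ev p).
  by rewrite big_ord_recl big_ord0 addr0.
- exact: cyclic_free.
have [h hK] := choice redS; exists h => // x.
apply/eqP; rewrite -subr_eq0; apply/eqP/redI.
by apply: (addIr (red x)); rewrite -redD subrK add0r hK.
Qed.

End CyclicLift.

(** * Versal deformation rings *)

Section CompleteLocalAlgebras.
Variable k : fieldType.

Lemma ideal_powM (A : comNzRingType) (S : A -> Prop) i j x y :
  ideal_pow S i x -> ideal_pow S j y -> ideal_pow S (i + j) (x * y).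
Proof.
move=> Sx Sy; have [I0 ID IM] := ideal_gen_is_ideal (products S (i + j)).
suff II : is_ideal (fun x => ideal_pow S (i + j) (x * y)).
  apply: (ideal_gen_min II) Sx => {II x} _ [s [ss sS ->]].
  have IJ : is_ideal (fun y => ideal_pow S (i + j) (\prod_(z <- s) z * y)).
    split=> [|u w Iu Iw|u w z Iz]; first by rewrite mulr0.
      by rewrite mulrDr; apply: ID.
    move: (\prod_(z <- s) z) Iz => P Iz.
    have -> : P * (u * z * w) = u * (P * z) * w by ring.
    exact: IM.
  apply: (ideal_gen_min IJ) Sy => {IJ y} _ [t [st tS ->]]; rewrite -big_cat /=.
  apply: mem_ideal_gen; exists (s ++ t); split=> //; first by rewrite size_cat
    ss st.
  by move=> z; rewrite mem_cat => /orP[/sS|/tS].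
split=> [|u w Iu Iw|u w z Iz]; first by rewrite mul0r.
  by rewrite mulrDl; apply: ID.
have -> : u * z * w * y = u * (z * y) * w by ring.
exact: IM.
Qed.

Lemma residue_hom_max_pow (R R' : Chat k) (f : {lrmorphism R -> R'}) :
  (forall x, residue R' (f x) = residue R x) ->
  forall j x, max_pow j x -> max_pow j (f x).
Proof.
move=> fR j x; have [I0 ID IM] := ideal_gen_is_ideal (products (fun x =>
  residue R' x = 0) j).
have II : is_ideal (fun x : R => max_pow j (f x)).
  split=> [|u w Iu Iw|u w z Iz]; rewrite ?rmorph0 ?rmorphD ?rmorphM; [exact:
    I0|exact: ID|exact: IM].
apply: (ideal_gen_min II) => _ [s [<- sS ->]]; apply: mem_ideal_gen.
exists [seq f z | z <- s]; rewrite size_map big_map rmorph_prod; split=> //.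
by move=> _ /mapP[z zs ->]; rewrite fR; apply: sS.
Qed.

Lemma residue_hom (R R' : Chat k) (f : {lrmorphism R -> R'}) :
  (forall x, residue R' (f x) = residue R x) ->
  exists phi : Chat_hom R R', phi =1 f.
Proof.
move=> fR; have fC n : exists m, forall x : R, max_pow m x -> max_pow n (f x).
  by exists n; apply: residue_hom_max_pow.
by exists (MkChatHom fC fR).
Qed.

Lemma max_pow1 (R : Chat k) (x : R) : max_pow 1 x <-> residue R x = 0.
Proof.
split=> [|x0]; last first.
  apply: mem_ideal_gen; exists [:: x]; rewrite big_seq1; split=> // y.
  by rewrite inE => /eqP ->.
have II : is_ideal (fun x : R => residue R x = 0).
  split=> [|u w u0 w0|u w z z0]; first exact: rmorph0.
    by rewrite rmorphD /= u0 w0 addr0.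
  by rewrite !rmorphM /= z0 mulr0 mul0r.
apply: (ideal_gen_min II) => _ [[|y [|z s]] [//= _ yS ->]].
by rewrite big_seq1; apply: yS; rewrite inE.
Qed.

Lemma max_pow_ideal (R : Chat k) j : is_ideal (@max_pow k R j).
Proof. exact: ideal_gen_is_ideal. Qed.

(* A [k]-linear form on [R] that vanishes on the square of the maximal ideal gives
   a morphism to the dual numbers. *)
Lemma dual_separates (R : Chat k) (y : R) : residue R y = 0 -> ~ max_pow 2 y ->
  exists phi : Chat_hom R (dual_numbers k), phi y <> 0.
Proof.
move=> y0 ny; have [I0 ID IM] := max_pow_ideal R 2.
have [s sI] := Chat_noetherian (@max_pow_ideal R 1).
have KL (c : k) u w : max_pow 2 u -> max_pow 2 w -> max_pow 2 (c *: u + w : R).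
  by move=> Iu Iw; apply: ID => //; rewrite -mulr_algl -[_ * _]mulr1; apply: IM.
(* Modulo the square of the maximal ideal, R is spanned over k by 1 and the generators s of that
   ideal, because a coefficient of a generator may be replaced by its residue. *)
pose b (i : 'I_(size s).+1) : R := nth 0 (1 :: s) i.
have m2 (u w : R) : residue R u = 0 -> residue R w = 0 -> max_pow 2 (u * w).
  by move=> u0 w0; rewrite -[2%N]/(1 + 1)%N; apply: ideal_powM; apply/max_pow1.
have sub_res (r : R) : residue R (r - (residue R r : k)%:A) = 0.
  by rewrite rmorphB /= residue_alg subrr.
have span1 (x : R) : residue R x = 0 -> exists c : 'rV[k]_(size s).+1,
    max_pow 2 (x - \sum_i c 0 i *: b i).
  move=> /max_pow1/sI[t [tS ->]]; elim: t tS => [|p t IH] tS.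
    exists 0; rewrite big_nil big1 ?subrr // => i _; by rewrite mxE scale0r.
  have [c cP] := IH (fun q qt => tS q (mem_behead (s := p :: t) qt)).
  have ps := tS p (mem_head _ _).
  have lt : ((index p.1.2 s).+1 < (size s).+1)%N by rewrite ltnS index_mem.
  pose r := p.1.1 * p.2.
  exists ((residue R r : k) *: delta_mx 0 (Ordinal lt) + c).
  have -> : \sum_i ((residue R r : k) *: delta_mx 0 (Ordinal lt) + c) 0 i *: b i =
      (residue R r : k) *: p.1.2 + \sum_i c 0 i *: b i.
    under eq_bigr do rewrite !mxE scalerDl.
    rewrite big_split /= (bigD1 (Ordinal lt)) //= !eqxx mulr1 big1 => [|i ii].
      by rewrite addr0 /b /= nth_index.
    by rewrite (negbTE ii) mulr0 scale0r.
  rewrite big_cons opprD addrACA; apply: ID => //.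
  rewrite mulrAC -/r -mulr_algl -mulrBl; apply: m2; first exact: sub_res.
  by apply/max_pow1/sI/mem_ideal_gen.
have span (x : R) : exists c : 'rV[k]_(size s).+1, max_pow 2 (x - \sum_i c 0 i
  *: b i).
  have [c cP] := span1 _ (sub_res x).
  exists ((residue R x : k) *: delta_mx 0 ord0 + c).
  have -> : \sum_i ((residue R x : k) *: delta_mx 0 ord0 + c) 0 i *: b i =
      (residue R x : k)%:A + \sum_i c 0 i *: b i.
    under eq_bigr do rewrite !mxE scalerDl.
    rewrite big_split /= (bigD1 ord0) //= mulr1 big1 ?addr0 // => i ii.
    by rewrite (negbTE ii) mulr0 scale0r.
  by rewrite opprD addrA.
have [lam [lamD lamZ lamy lam2]] := spanning_functional I0 KL span ny.
have lam0 : lam 0 = 0 by apply: lam2.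
have lamN u : lam (- u) = - lam u by rewrite -scaleN1r lamZ mulN1r.
pose rs (r : R) : k := residue R r.
pose f (r : R) : dual k := Dual (rs r) (lam (r - (rs r)%:A)).
have fB : zmod_morphism f.
  move=> u w; apply: dualP; first exact: (rmorphB (residue R)).
  rewrite /= -lamN -lamD; congr lam.
  rewrite /rs rmorphB /= scalerBl; move: (_%:A : R) (_%:A : R) => p q; ring.
have rsM u w : rs (u * w) = rs u * rs w by exact: (rmorphM (residue R)).
have rs1 : rs 1 = 1 by exact: (rmorph1 (residue R)).
have fM : monoid_morphism f.
  split; first by apply: dualP => //; rewrite /= rs1 scale1r subrr.
  move=> u w; apply: dualP; first exact: rsM.
  rewrite /= [lam _ * rs w]mulrC -!lamZ -lamD rsM -[RHS]addr0.
  (* The defect of multiplicativity is [lam] of a product of two elements of the maximal ideal,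
     which is 0. *)
  rewrite -(lam2 ((u - (rs u)%:A) * (w - (rs w)%:A))); last by apply: m2;
    apply: sub_res.
  rewrite -lamD -(mulr_algl (rs u) (w - _)) -(mulr_algl (rs w) (u - _)); congr lam.
  have -> : (rs u * rs w)%:A = (rs u)%:A * (rs w)%:A :> R by rewrite mulr_algl
    scalerA.
  by move: ((rs u)%:A : R) ((rs w)%:A : R) => p q; ring.
have fZ : scalable f.
  move=> c u; have rsZ : rs (c *: u) = c * rs u by rewrite /rs linearZ.
  apply: dualP => //=; rewrite rsZ -lamZ; congr lam.
  by rewrite scalerBr scalerA.
pose F : {lrmorphism R -> dual_numbers k} := HB.pack f
  (GRing.isZmodMorphism.Build R (dual k) f fB)
  (GRing.isMonoidMorphism.Build R (dual k) f fM)
  (GRing.isScalable.Build k R (dual k) *:%R f fZ).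
have [|phi phiE] := @residue_hom R (dual_numbers k) F; first by [].
exists phi; rewrite phiE => /(congr1 (@dual_eps k)).
rewrite /= /rs y0 scale0r subr0 lamy => /eqP; by rewrite oner_eq0.
Qed.

Section Versality.
Variables (n a : nat) (na : (n <= a)%N) (R : Chat k) (c : 'I_n -> R).
Hypothesis c0 : tuple_mx c ^+ a = 0.
Hypothesis c_surj : forall (R' : Chat k) (c' : 'I_n -> R'), tuple_mx c' ^+ a = 0 ->
  exists phi : Chat_hom R R', forall s, phi (c s) = c' s.
Hypothesis c_inj : forall phi psi : Chat_hom R (dual_numbers k),
  (forall s, phi (c s) = psi (c s)) -> phi =1 psi.

Local Notation R0 := (versal_chat k na).

(* [gamma] is [alpha \o beta] and [delta = id - gamma] is idempotent.  The injectivity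
   over the dual numbers says that [delta] maps the maximal ideal to its square, hence
   every power of the maximal ideal to the next one, so that [delta] vanishes. *)
Lemma versal_bijection : exists (alpha : Chat_hom R0 R) (beta : Chat_hom R R0),
  [/\ forall s, alpha (versal_param k na s) = c s, cancel alpha beta & cancel
    beta alpha].
Proof.
have [alpha alphaE] := versal_hom na c0.
have [beta betaE] := c_surj (versal_param_exp k na : tuple_mx (versal_param k
  na : _ -> R0) ^+ a = 0).
have ab : cancel alpha beta.
  move=> u; have E : (beta \o alpha : {lrmorphism R0 -> R0}) =1 (idfun :
    {lrmorphism R0 -> R0}).
    by apply: versal_ext => s /=; rewrite alphaE betaE.
  exact: E u.
exists alpha, beta; split=> // x.
pose gl : {lrmorphism R -> R} := alpha \o beta; pose gamma (y : R) : R := gl y.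
have gR y : residue R (gamma y) = residue R y.
  by rewrite -[gamma y]/(alpha (beta y)) !Chat_fun_residue.
have gg y : gamma (gamma y) = gamma y by exact: (congr1 alpha (ab (beta y))).
have gB y z : gamma (y - z) = gamma y - gamma z by exact: (rmorphB gl).
have gD y z : gamma (y + z) = gamma y + gamma z by exact: (rmorphD gl).
have gM y z : gamma (y * z) = gamma y * gamma z by exact: (rmorphM gl).
have g0 : gamma 0 = 0 by exact: (rmorph0 gl).
have g1 : gamma 1 = 1 by exact: (rmorph1 gl).
pose delta y := y - gamma y.
have dd y : delta (delta y) = delta y.
  by rewrite /delta gB gg subrr subr0.
have dM y z : delta (y * z) = delta y * z + gamma y * delta z.
  by rewrite /delta gM; ring.
have dD y z : delta (y + z) = delta y + delta z by rewrite /delta gD; ring.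
have dR y : residue R (delta y) = 0 by rewrite rmorphB /= gR subrr.
have d1 y : max_pow 1 (delta y) by apply/max_pow1.
have gm j y : max_pow j y -> max_pow j (gamma y).
  exact: (residue_hom_max_pow (f := gl)).
have d2 y : residue R y = 0 -> max_pow 2 (delta y).
  move=> y0; apply: contrapT => h.
  have [phi] := dual_separates (dR y) h.
  (* [gamma] fixes every c_s, so [phi] and its composite with [gamma] agree on c; injectivity over
     the dual numbers makes them equal, and [phi] kills the image of [delta]. *)
  have [|psi psiE] := @residue_hom R (dual_numbers k) (phi \o gl : {lrmorphism
    R -> dual_numbers k}).
    by move=> z; rewrite -[RHS]gR -(Chat_fun_residue phi).
  case; rewrite rmorphB /= -[phi (gamma y)]psiE (@c_inj phi psi) ?subrr // => s.
  by rewrite psiE /= betaE alphaE.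
(* By the twisted Leibniz rule [dM], each step of a product gains one power: [delta] of a factor
   lies in the square of the maximal ideal, and [gamma] preserves its powers. *)
have dS j y : max_pow j y -> max_pow j.+1 (delta y).
  have [I0 ID IM] := max_pow_ideal R j.+1.
  have d0 : delta 0 = 0 by rewrite /delta g0 subrr.
  have dP s : (forall z, z \in s -> residue R z = 0) -> size s = j ->
      max_pow j.+1 (delta (\prod_(z <- s) z)).
    move=> sm <-; elim: s sm => [|z s IH] sm.
      by rewrite big_nil /delta g1 subrr; have [] := max_pow_ideal R 1.
    have [J0 JD JM] := max_pow_ideal R (size (z :: s)).+1.
    have z0 : residue R z = 0 by apply: sm; rewrite mem_head.
    have sm' w : w \in s -> residue R w = 0 by move=> ws; apply: sm; rewrite
      inE ws orbT.
    rewrite big_cons dM; apply: JD.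
      rewrite -[(size (z :: s)).+1]/(2 + size s)%N; apply: ideal_powM; first
        exact: d2.
      by apply: mem_ideal_gen; exists s.
    rewrite -[(size (z :: s)).+1]/(1 + (size s).+1)%N; apply: ideal_powM; last
      exact: IH.
    by apply/gm/max_pow1.
  case=> t [tP ->]; rewrite big_seq; elim/big_rec: _ => [|p z /tP [s [sj sm
    pE]] IH].
    by rewrite d0.
  rewrite dD; apply: (ID) => //; rewrite mulrAC dM; apply: ID.
    rewrite -[j.+1]/(1 + j)%N; apply: ideal_powM; first exact: d1.
    by apply: mem_ideal_gen; exists s.
  by rewrite -[_ * delta _]mulr1; apply: IM; rewrite pE; apply: dP.
have dj j y : max_pow j (delta y).
  elim: j y => [|j IH] y; last by rewrite -dd; apply: dS.
  rewrite -[delta y]mulr1 -[X in max_pow _ X]mulr1.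
  have [_ _ IM] := max_pow_ideal R 0; apply: IM; apply: mem_ideal_gen.
  by exists [::]; rewrite big_nil.
apply/eqP; rewrite eq_sym -subr_eq0; apply/eqP.
by apply: Chat_separated => j; apply: dj.
Qed.

Lemma versal_iso : alg_iso R (mps_quot k n a).
Proof.
have [alpha [beta [_ ab ba]]] := versal_bijection.
exists (beta : {rmorphism R -> versal_ring k na}); split; last by exists alpha.
move=> d; rewrite -[LHS]/(beta d%:A) rmorph_alg.
by rewrite -[LHS]/(versal_proj na (kin d) * 1) mulr1.
Qed.

Lemma versal_inj (R' : Chat k) (phi psi : Chat_hom R R') :
  (forall s, phi (c s) = psi (c s)) -> phi =1 psi.
Proof.
move=> E x; have [alpha [beta [aE _ ba]]] := versal_bijection.
have := @versal_ext k n a na R' (phi \o alpha : {lrmorphism R0 -> R'}) (psi \o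
  alpha : {lrmorphism R0 -> R'}).
move=> /(_ _ (beta x)) /= h; rewrite -(ba x); apply: h => s.
by rewrite /= aE.
Qed.

End Versality.

End CompleteLocalAlgebras.

Lemma dvdXn_field (F : fieldType) (f q : {poly F}) d l :
  f \is monic -> size f = d.+1 -> 'X^l = q * f -> f = 'X^d.
Proof.
move=> fm sf E; apply/polyP => j; rewrite coefXn.
have [jd|dj|->] := ltngtP j d; last by have := monicP fm; rewrite lead_coefE sf.
  have [|K] := coef_dvdXn_nilp fm E (j := j); first by rewrite sf.
  by move/eqP; rewrite expf_eq0 => /andP[_ /eqP].
by rewrite nth_default // sf.
Qed.

(** * Deformations as points of the parameter space *)

Section DeformationParameters.
Variables (k : fieldType) (e l : nat).
Local Notation L := (Nalg k e l).
Variables (V : lmodType L) (x : 'I_e) (d : nat) (v : V).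
Hypothesis d_gt0 : (0 < d)%N.
Hypothesis C : cyclic_module (@kin k L : {rmorphism k -> L}) (vertex_elt k l)
  (arrow_elt k e l) x d 'X^d v.
Variables (n i r a : nat) (sw : bool).
Hypotheses (ie : (i < e)%N) (re : (r < e)%N) (lE : l = (i + r + e * a)%N).
Hypothesis nl : (n * e + i <= l)%N.
Hypothesis dE : d = (if sw then l - (n * e + i) else n * e + i)%N.

Definition lift_param (R : Chat k) (M : lift_data V R) (c : 'I_n -> R) : Prop :=
  exists2 f, lift_poly x d v M f & parametrizes e l i sw c f.

Lemma lift_param_exists (R : Chat k) (M : lift_data V R) : is_lift M ->
  exists2 c, lift_param M c & tuple_mx c ^+ a = 0.
Proof.
move=> ML; have [f Mf] := lift_poly_exists C ML.
have [c [cf c0]] := deform_poly_param ie re lE nl dE (lift_poly_deform Mf).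
by exists c => //; exists f.
Qed.

Lemma lift_param_iso (R : Chat k) (M M' : lift_data V R) c :
  lift_param M c -> red_linear M -> lift_param M' c -> red_linear M' ->
    lift_iso M M'.
Proof.
move=> [f Mf cf] MR [f' Mf' cf'] MR'; rewrite (parametrizes_fun ie cf' cf) in Mf'.
exact: lift_poly_iso Mf MR Mf' MR'.
Qed.

Lemma lift_iso_param (R : Chat k) (M M' : lift_data V R) c :
  lift_iso M M' -> lift_param M c -> lift_param M' c.
Proof. by move=> I [f Mf cf]; exists f => //; apply: lift_iso_poly I Mf. Qed.

Lemma lift_param_unique (R : Chat k) (M : lift_data V R) c c' :
  lift_param M c -> lift_param M c' -> c =1 c'.
Proof.
move=> [f Mf cf] [f' Mf' cf']; rewrite (lift_poly_unique Mf' Mf) in cf'.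
have [fm _ _ _] := lift_poly_deform Mf.
exact: (parametrizes_inj ie fm cf cf').
Qed.

Lemma push_param (R R' : Chat k) (phi : Chat_hom R R') (M : lift_data V R) c :
  lift_param M c -> lift_param (push phi M) (fun s => phi (c s)).
Proof.
move=> [f Mf cf]; exists (map_poly phi f); first exact: push_poly.
exact: (parametrizes_map phi cf).
Qed.

Lemma param_lift (R : Chat k) (c : 'I_n -> R) : tuple_mx c ^+ a = 0 ->
  exists M : lift_data V R, is_lift M /\ lift_param M c.
Proof.
move=> c0; have [f [cf fd]] := param_deform_poly ie re lE nl dE c0.
have [M [m CM]] := cyclic_module_exists x d_gt0 fd.
have f0 : map_poly (residue R) f = 'X^d.
  case: fd => fm sf _ [q E]; apply: (@dvdXn_field k _ (map_poly (residue R) q) d l).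
  - exact: monic_map.
  - by rewrite size_map_poly_id0 // (monicP fm) rmorph1 oner_eq0.
  - by rewrite -rmorphM -E /= map_polyXn.
by have [U [UL Uf]] := cyclic_is_lift C CM f0; exists U; split=> //; exists f.
Qed.

Section Versal.
Variables (R : Chat k) (U : lift_data V R) (c : 'I_n -> R).
Hypotheses (UL : is_lift U) (Uc : lift_param U c).

(** Deformations over R' correspond to the tuples killed by the equations, and pushing U along [phi]
    becomes applying [phi] to c. *)
Lemma def_surjectiveE R' : def_surjective U R' <->
  forall c' : 'I_n -> R', tuple_mx c' ^+ a = 0 ->
    exists phi : Chat_hom R R', forall s, phi (c s) = c' s.
Proof.
split=> [S c' c'0|S M ML].
  have [M [ML Mc]] := param_lift c'0; have [phi I] := S M ML.
  exists phi; apply: (lift_param_unique _ Mc).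
  exact: lift_iso_param I (push_param phi Uc).
have [c' Mc c'0] := lift_param_exists ML; have [phi phiE] := S c' c'0.
exists phi; apply: lift_param_iso Mc _; last exact: is_lift_red_linear.
- by have := push_param phi Uc; rewrite (funext phiE).
- exact/push_red_linear/is_lift_red_linear.
Qed.

Lemma def_injectiveE R' : def_injective U R' <->
  forall phi psi : Chat_hom R R', (forall s, phi (c s) = psi (c s)) -> phi =1 psi.
Proof.
have push_lin (phi : Chat_hom R R') : red_linear (push phi U).
  exact/push_red_linear/is_lift_red_linear.
split=> S phi psi h; apply: S.
  apply: lift_param_iso (push_param phi Uc) _ _ _ => //.
  have := push_param psi Uc; suff -> : (fun s => psi (c s)) = (fun s => phi (c
    s)) by [].
  by apply: funext => s.
exact: (lift_param_unique (lift_iso_param h (push_param phi Uc)) (push_param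
  psi Uc)).
Qed.

End Versal.

Hypothesis na : (n <= a)%N.

Lemma versal_universal (R : Chat k) (U : lift_data V R) : versal U ->
  universal U /\ alg_iso R (mps_quot k n a).
Proof.
case=> UL US UI; have [c Uc c0] := lift_param_exists UL.
have S R' := (def_surjectiveE UL Uc R').1 (US R').
have I := (def_injectiveE UL Uc _).1 UI.
split; last exact: (versal_iso na c0 S I).
split=> // R'; split=> //; apply/(def_injectiveE UL Uc) => phi psi.
exact: (versal_inj na c0 S I).
Qed.

(** The classes of the variables form the tautological point of the quotient ring, and a lift with
    this parameter is versal. *)
Lemma versal_exists : exists (R : Chat k) (U : lift_data V R), versal U.
Proof.
have [U [UL Uc]] := param_lift (versal_param_exp k na : tuple_mx (versal_param
  k na : _ -> versal_chat k na) ^+ a = 0).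
exists (versal_chat k na), U; split=> // [R'|].
  by apply/(def_surjectiveE UL Uc) => c' c'0; apply: versal_hom.
by apply/(def_injectiveE UL Uc) => phi psi E; apply: (versal_ext (phi := phi)
  (psi := psi)).
Qed.

End DeformationParameters.

Local Close Scope ring_scope.

Theorem theorem1p2 (k : fieldType) (e l : nat) (he : 1 <= e) (hl : 2 <= l)
    (mu l' : nat) (hlmu : l = mu * e + l') (hl' : l' <= e - 1)
    (V : lmodType (Nalg k e l)) (Vfg : fin_gen V) (Vind : indecomposable V)
    (Vnp : ~ projective V)
    (n i : nat) (hlV : minn (kdim V) (l - kdim V) = n * e + i)
    (hi : i <= e - 1) :
  (exists (R : Chat k) (U : lift_data V R), versal U) /\
  forall (R : Chat k) (U : lift_data V R), versal U ->
    universal U /\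
    alg_iso R (mps_quot k n (if i <= l' then mu else mu - 1)).
Proof.
have [x [d [v [/andP[d0 dl] dimV C]]]] := nakayama_classification Vfg Vind Vnp.
rewrite dimV in hlV.
have ie : i < e by rewrite (leq_ltn_trans hi) // subn1 ltn_predL.
have l'e : l' < e by rewrite (leq_ltn_trans hl') // subn1 ltn_predL.
have two : 2 * (n * e + i) <= mu * e + l' by lia.
(* Here 2 n e <= mu e + l' < (mu + 1) e; if l' < i, the term 2 i outweighs l' and the bound becomes
   strict. *)
have n2mu : 2 * n <= mu by rewrite -ltnS -(ltn_pmul2r he) mulSn; lia.
have n2mu' : l' < i -> 2 * n < mu by move=> l'i; rewrite -(ltn_pmul2r he); lia.
set a := if i <= l' then mu else mu - 1.
(* Taking i from the remainder l' of l leaves l' - i if i <= l'. Otherwise a block of length e is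
   borrowed, whence mu - 1; [n2mu'] gives mu > 0, so the subtraction is not truncated. *)
have [r re lE] : exists2 r, r < e & l = i + r + e * a.
  rewrite {}/a hlmu mulnC; case: leqP => [il|/[dup] li /n2mu' mu0].
    by exists (l' - i); lia.
  exists (e + l' - i); first lia.
  have emu : e <= e * mu by rewrite leq_pmulr // (leq_ltn_trans _ mu0).
  by rewrite mulnBr muln1; lia.
have na : n <= a by rewrite /a; case: (leqP i l') => [_|/n2mu' ?]; lia.
have nl : n * e + i <= l by lia.
(* The switch is on when the syzygy, of dimension l - d, is strictly smaller than V; on a tie V
   itself is used. *)
have dE : d = if l - d < d then l - (n * e + i) else n * e + i.
  by case: ltnP => ?; lia.
split; first exact: (versal_exists d0 C ie re lE nl dE na).
by move=> R U; apply: (versal_universal d0 C ie re lE nl dE na).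
Qed.
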